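(* Let $G$ be a polynomial semigroup in $\mathcal{G}$ generated by a (possibly non-compact) family of polynomials of degree two. Then $J(G)$ is connected.
   Context: $\hat{\mathbb{C}}$ is the Riemann sphere. A polynomial semigroup is a semigroup, under composition, generated by a non-empty family of non-constant polynomial maps $\hat{\mathbb{C}}\to\hat{\mathbb{C}}$. The Fatou set $F(G)$ is the set of $z\in\hat{\mathbb{C}}$ having a neighborhood on which $G$ is a normal family; the Julia set is $J(G)=\hat{\mathbb{C}}\setminus F(G)$. $CV(g)$ is the set of critical values of $g:\hat{\mathbb{C}}\to\hat{\mathbb{C}}$, $P(G)=\overline{\bigcup_{g\in G}CV(g)}$ (closure in $\hat{\mathbb{C}}$), and $P^{\ast}(G)=P(G)\setminus\{\infty\}$. $\mathcal{G}$ is the set of all polynomial semigroups $G$ such that each element of $G$ has degree at least two and $P^{\ast}(G)$ is bounded in $\mathbb{C}$. *)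

(* Defs.v *)
From HB Require Import structures.
From mathcomp Require Import all_boot all_order all_algebra.
From mathcomp Require Import complex.
From mathcomp Require Import all_classical all_reals all_analysis.

Set Implicit Arguments.
Unset Strict Implicit.
Unset Printing Implicit Defensive.

Import Order.TTheory GRing.Theory Num.Theory.
Import numFieldNormedType.Exports.

Local Open Scope classical_set_scope.
Local Open Scope ring_scope.

(* The ascription to numClosedFieldType is what gives [R[i]] the topology and
   the norm that MathComp-Analysis puts on every numFieldType, so that
   derivatives of functions [Cplx R -> Cplx R] are complex derivatives. *)
Definition Cplx (R : realType) : numClosedFieldType := R[i].

(* [None] is the point at infinity. *)
Definition sphere (R : realType) : topologicalType :=
  one_point_compactification (Cplx R).

Section PolynomialSemigroups.
Variable R : realType.
Local Notation C := (Cplx R).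
Local Notation S2 := (sphere R).

Definition infty : S2 := None.
Definition fin (z : C) : S2 := Some z.

(* The chordal (spherical) metric; its values are the nonnegative reals of C. *)
Definition chordal (x y : S2) : C :=
  match x, y with
  | Some z, Some w =>
      2 * `|z - w| / (sqrtC (1 + `|z| ^+ 2) * sqrtC (1 + `|w| ^+ 2))
  | Some z, None | None, Some z => 2 / sqrtC (1 + `|z| ^+ 2)
  | None, None => 0
  end.

(* Only used for nonconstant p, for which infinity is indeed sent to itself. *)
Definition poly_map (p : {poly C}) (x : S2) : S2 :=
  if x is Some z then fin p.[z] else infty.

(* [size p] is the degree of p plus one. *)
Definition has_degree (d : nat) (g : S2 -> S2) : Prop :=
  exists2 p : {poly C}, size p = d.+1 & g = poly_map p.

Definition generated_semigroup (A : set (S2 -> S2)) : set (S2 -> S2) :=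
  smallest (fun H : set (S2 -> S2) => forall g h, H g -> H h -> H (g \o h)) A.

Definition polynomial_semigroup (G : set (S2 -> S2)) : Prop :=
  exists A : set (S2 -> S2),
    [/\ A !=set0, forall g, A g -> exists2 d, (0 < d)%N & has_degree d g
      & G = generated_semigroup A].

(* Every sequence in G has a subsequence converging, uniformly on the compact
   subsets of U for the spherical metric, to some map U -> S2 (whose values
   outside U are irrelevant). *)
Definition normal_on (U : set S2) (G : set (S2 -> S2)) : Prop :=
  forall f : nat -> S2 -> S2, (forall n, G (f n)) ->
  exists (s : nat -> nat) (l : S2 -> S2),
    {homo s : m n / (m < n)%N} /\
    forall K, compact K -> K `<=` U -> forall e : C, 0 < e ->
      \forall n \near \oo, forall x, K x -> chordal (f (s n) x) (l x) < e.

Definition Fatou (G : set (S2 -> S2)) : set S2 :=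
  [set x | exists2 U, open_nbhs x U & normal_on U G].

Definition Julia (G : set (S2 -> S2)) : set S2 := ~` Fatou G.

(* The holomorphic involution x |-> 1/x of the sphere. *)
Definition sphere_inv (x : S2) : S2 :=
  if x is Some z then (if z == 0 then infty else fin z^-1) else fin 0.

(* The chart of the sphere used around a point: the identity around a finite
   point, x |-> 1/x around infinity. It is an involution. *)
Definition chart_at (x : S2) : S2 -> S2 := if x is Some _ then id else sphere_inv.

(* The value 0 at infinity is irrelevant: see [local_expr]. *)
Definition to_C (x : S2) : C := if x is Some z then z else 0.

(* g read in the charts around x and g x. *)
Definition local_expr (g : S2 -> S2) (x : S2) (w : C) : C :=
  to_C (chart_at (g x) (g (chart_at x (fin w)))).

Definition critical_point (g : S2 -> S2) (x : S2) : Prop :=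
  is_derive (to_C (chart_at x x)) (1 : C) (local_expr g x) 0.

Definition CV (g : S2 -> S2) : set S2 := g @` critical_point g.

Definition postcritical (G : set (S2 -> S2)) : set S2 :=
  closure (\bigcup_(g in G) CV g).

Definition planar_postcritical (G : set (S2 -> S2)) : set S2 :=
  postcritical G `\ infty.

Definition calG : set (set (S2 -> S2)) :=
  [set G | [/\ polynomial_semigroup G,
     forall g, G g -> exists2 d, (2 <= d)%N & has_degree d g
   & bounded_set (fin @^-1` planar_postcritical G : set C)]].

End PolynomialSemigroups.

(* Main.v *)
(* For a word w in the generators and a generator x, let T(w, x) = w^-1(K(x)) where
   K(x) is the filled Julia set of x. All of P^*(G) lies in T(w, x), so T(w, x) and
   its complement are connected, and hence so is the boundary of T(w, x).

   If h has degree two and leading coefficient a, then cap(h^-1(T))^2 = cap(T) / |a|.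
   Hence for generators h, k and words of the same length n, any T(w, x) is joined to
   any T(w', x') by a chain in which the ratio of consecutive capacities is at most
   C^(2^-n). If the boundaries of two consecutive members were at distance at least
   delta, they would be nested, the larger one containing a copy of the smaller one
   scaled by a fixed factor 1 + t, and this is impossible for large n. So the
   closure L of the union of these boundaries is connected. Capacities only enter
   through leading coefficients and the maximum principle for quotients of polynomials.

   Each boundary lies in J(G). Conversely, on a disc disjoint from L any g in G either
   maps into K(h) or avoids K(h), for a fixed generator h. In the second case
   ln |h^m o g| is positive and harmonic for large m, and the Harnack inequality
   controls the oscillation of ln |g|; hence G is equicontinuous, and J(G) = L. *)
Require Import Defs.
From mathcomp Require Import all_boot all_order all_algebra.
From mathcomp Require Import complex ring lra.
From mathcomp Require Import all_classical all_reals all_analysis.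

Set Implicit Arguments.
Unset Strict Implicit.
Unset Printing Implicit Defensive.

Import Order.TTheory GRing.Theory Num.Theory.
Import numFieldNormedType.Exports.

Local Open Scope classical_set_scope.
Local Open Scope ring_scope.

(** * The complex plane *)

(** Non-compactness is the obstacle. No escape radius and no bound on ratios of leading coefficients
    need be common to all generators, and the two halves of a separation of L may approach each
    other near infinity. Hence T(w, x) and T(w', x') are compared through chains using only the
    letters of these two words: the constants C and delta then come from a finite list of letters
    and from one disc. Large n is available because x^-1(K(x)) = K(x), so that appending copies of x
    to w leaves T(w, x) unchanged. Degree two enters twice. The fibers of a generator are the orbits
    of an involution, so a preimage is connected as soon as it contains one suitable connected set.
    And T(h k^m, k) and T(k h^m, h) have exactly the same capacity, both letters having total
    exponent 2^m. The analytic estimates rest on one computation: at a maximum the second-order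
    coefficients in the directions 1 and i are at most 0, their sum is half a Laplacian, and ln
    |p|^2 contributes nothing to it when p is a nonvanishing polynomial. *)

Section Modulus.
Variable R : realType.
Local Notation C := (Cplx R).

(* The norm of [Cplx R] takes its values in [Cplx R] itself. *)
Definition cabs (z : C) : R := complex.Re `|z|.
Definition rc (x : R) : C := real_complex R x.

Lemma cabsE (z : C) : `|z| = rc (cabs z).
Proof. by rewrite /rc /cabs RRe_real ?normr_real. Qed.

Lemma rcD x y : rc (x + y) = rc x + rc y. Proof. exact: rmorphD. Qed.
Lemma rcM x y : rc (x * y) = rc x * rc y. Proof. exact: rmorphM. Qed.
Lemma rcB x y : rc (x - y) = rc x - rc y. Proof. exact: rmorphB. Qed.
Lemma rcV x : rc (x^-1) = (rc x)^-1. Proof. exact: fmorphV. Qed.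
Lemma rcX x n : rc (x ^+ n) = rc x ^+ n. Proof. exact: rmorphXn. Qed.
Lemma rc0 : rc 0 = 0. Proof. by []. Qed.
Lemma rc1 : rc 1 = 1. Proof. by []. Qed.
Lemma rc_nat n : rc n%:R = n%:R. Proof. exact: rmorph_nat. Qed.
Lemma rc_le x y : (rc x <= rc y) = (x <= y). Proof. exact: lecR. Qed.
Lemma rc_lt x y : (rc x < rc y) = (x < y). Proof. exact: ltcR. Qed.
Lemma rc_inj : injective rc. Proof. exact: complexI. Qed.
Lemma rc_eq0 x : (rc x == 0) = (x == 0). Proof. exact: fmorph_eq0. Qed.

Lemma cabs_ge0 z : 0 <= cabs z.
Proof. by rewrite -rc_le -cabsE normr_ge0. Qed.
Hint Resolve cabs_ge0 : core.
Lemma cabs0 : cabs 0 = 0.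
Proof. by apply: rc_inj; rewrite -cabsE normr0. Qed.
Lemma cabs1 : cabs 1 = 1.
Proof. by apply: rc_inj; rewrite -cabsE normr1. Qed.
Lemma cabs_eq0 z : (cabs z == 0) = (z == 0).
Proof. by rewrite -rc_eq0 -cabsE normr_eq0. Qed.
Lemma cabs_gt0 z : (0 < cabs z) = (z != 0).
Proof. by rewrite lt_def cabs_eq0 cabs_ge0 andbT. Qed.
Lemma cabsM z w : cabs (z * w) = cabs z * cabs w.
Proof. by apply: rc_inj; rewrite rcM -!cabsE normrM. Qed.
Lemma cabsX z n : cabs (z ^+ n) = cabs z ^+ n.
Proof. by apply: rc_inj; rewrite rcX -!cabsE normrX. Qed.
Lemma cabsV z : cabs z^-1 = (cabs z)^-1.
Proof. by apply: rc_inj; rewrite rcV -!cabsE normfV. Qed.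
Lemma cabsN z : cabs (- z) = cabs z.
Proof. by apply: rc_inj; rewrite -!cabsE normrN. Qed.
Lemma cabsB z w : cabs (z - w) = cabs (w - z).
Proof. by rewrite -cabsN opprB. Qed.
Lemma cabsD z w : cabs (z + w) <= cabs z + cabs w.
Proof. by rewrite -rc_le rcD -!cabsE ler_normD. Qed.
Lemma cabsBD z w : cabs (z - w) <= cabs z + cabs w.
Proof. by rewrite -(cabsN w) cabsD. Qed.
Lemma cabs_tri z w v : cabs (z - w) <= cabs (z - v) + cabs (v - w).
Proof. by apply: le_trans (cabsD _ _); rewrite addrA subrK. Qed.
Lemma cabs_sub z w : cabs z - cabs w <= cabs (z - w).
Proof. by rewrite lerBlDr; apply: le_trans (cabsD _ _); rewrite subrK. Qed.
Lemma cabs_subD z w : cabs z - cabs w <= cabs (z + w).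
Proof. by rewrite -(cabsN w) -{2}(opprK w) cabs_sub. Qed.
Lemma cabs_rc x : cabs (rc x) = `|x|.
Proof. by apply: rc_inj; rewrite -cabsE /rc normc_def /= expr0n /= addr0 sqrtr_sqr. Qed.
Lemma cabs_Re z : `|complex.Re z| <= cabs z.
Proof.
have := normc_ge_Re z; rewrite -[X in _ <= X]/(`|(z : C)|) cabsE.
by rewrite rc_le.
Qed.
Lemma cabs_i : cabs 'i%C = 1.
Proof.
by apply: rc_inj; rewrite -cabsE normc_def /= expr0n/= expr1n add0r sqrtr1.
Qed.
Lemma cabs_Im z : `|complex.Im z| <= cabs z.
Proof.
have := cabs_Re (z * 'i%C); rewrite ReiNIm normrN => /le_trans; apply.
by rewrite cabsM cabs_i mulr1.
Qed.
Lemma cabs_sq z : cabs z ^+ 2 = complex.Re z ^+ 2 + complex.Im z ^+ 2.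
Proof. by apply: rc_inj; rewrite rcX -cabsE /rc add_Re2_Im2. Qed.
Lemma cabs_rect x y : cabs (x +i* y)%C <= `|x| + `|y|.
Proof.
have e : (x +i* y)%C = rc x + 'i%C * rc y :> C.
  by rewrite /rc {1}(complexE (x +i* y)%C).
rewrite e; apply: le_trans (cabsD _ _) _; rewrite cabsM !cabs_rc lerD2l.
by rewrite cabs_i mul1r.
Qed.
Lemma rc_mulC (x : R) (z : C) : rc x * z = (x * complex.Re z +i* (x * complex.Im z))%C.
Proof. by case: z => a b; apply/eqP; rewrite eq_complex /= !mul0r subr0 addr0 !eqxx. Qed.

(** Positive elements of [Cplx R] are real, so the radii of balls, which live in [Cplx R], can be
    traded for radii in [R]. *)
Lemma nbhsC (z : C) (A : set C) :
  nbhs z A <-> exists2 e : R, 0 < e & forall y, cabs (y - z) < e -> A y.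
Proof.
split.
  move/nbhs_ballP => [e /= e0 be].
  have er : e = rc (complex.Re e) by rewrite /rc RRe_real// ger0_real// ltW.
  exists (complex.Re e); first by rewrite -rc_lt -er.
  move=> y ye; apply: be; rewrite -ball_normE /ball_ /=.
  by rewrite distrC cabsE er rc_lt.
move=> [e e0 be]; apply/nbhs_ballP; exists (rc e); rewrite /= ?rc_lt// => y.
rewrite -ball_normE /ball_ /= distrC cabsE rc_lt; exact: be.
Qed.

Lemma openCP (A : set C) :
  open A <-> forall z, A z -> exists2 e : R, 0 < e & forall y, cabs (y - z) < e -> A y.
Proof.
rewrite openE; split.
  by move=> oA z /oA; rewrite /interior nbhsC.
by move=> oA z /oA; rewrite /interior/= nbhsC.
Qed.

Lemma closureCP (A : set C) z :
  closure A z <-> forall e : R, 0 < e -> exists2 y, A y & cabs (y - z) < e.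
Proof.
split.
  move=> cA e e0; have [|y [Ay ye]] := cA [set y | cabs (y - z) < e].
    by apply/nbhsC; exists e.
  by exists y.
move=> cA B /nbhsC [e e0 eB]; have [y Ay ye] := cA e e0.
by exists y; split=> //; apply: eB.
Qed.

Lemma contCC (f : C -> C) z : {for z, continuous f} <->
  forall e : R, 0 < e -> exists2 d : R, 0 < d & forall y, cabs (y - z) < d -> cabs (f y - f z) < e.
Proof.
split.
  move=> cf e e0; apply/(nbhsC z (fun y => cabs (f y - f z) < e)).
  by apply: (cf (fun w => cabs (w - f z) < e)); apply/nbhsC; exists e.
move=> cf B /nbhsC [e e0 eB]; have [d d0 dP] := cf e e0.
by apply/nbhsC; exists d => // y /dP; apply: eB.
Qed.

Lemma contCR (f : C -> R) z : {for z, continuous f} <->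
  forall e : R, 0 < e -> exists2 d : R, 0 < d & forall y, cabs (y - z) < d -> `|f y - f z| < e.
Proof.
split.
  move=> cf e e0; apply/(nbhsC z (fun y => `|f y - f z| < e)).
  apply: (cf (fun w => `|w - f z| < e)); apply/nbhs_ballP; exists e => // w.
  by rewrite -ball_normE /ball_ /= distrC.
move=> cf B /nbhs_ballP [e e0 eB]; have [d d0 dP] := cf e e0.
apply/nbhsC; exists d => // y /dP h; apply: eB.
by rewrite -ball_normE /ball_ /= distrC.
Qed.

Lemma contRC (f : R -> C) t : {for t, continuous f} <->
  forall e : R, 0 < e -> exists2 d : R, 0 < d & forall y, `|y - t| < d -> cabs (f y - f t) < e.
Proof.
split.
  move=> cf e e0; have : nbhs t (fun y => cabs (f y - f t) < e).
    by apply: (cf (fun w => cabs (w - f t) < e)); apply/nbhsC; exists e.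
  move=> /nbhs_ballP [d d0 dP]; exists d => // y yd; apply: dP.
  by rewrite -ball_normE /ball_ /= distrC.
move=> cf B /nbhsC [e e0 eB]; have [d d0 dP] := cf e e0.
apply/nbhs_ballP; exists d => // y; rewrite -ball_normE /ball_ /= distrC => /dP.
exact: eB.
Qed.

Lemma cabs_continuous : continuous cabs.
Proof.
move=> z; apply/contCR => e e0; exists e => // y; apply: le_lt_trans.
by rewrite ler_norml cabs_sub lerNl opprB cabsB cabs_sub.
Qed.

Lemma horner_continuous (p : {poly C}) : continuous (horner p).
Proof.
elim/poly_ind: p => [|p c IH] z.
  by rewrite (_ : horner 0 = fun=> 0); [exact: cst_continuous|apply/funext => x; rewrite horner0].
rewrite (_ : horner _ = fun x => p.[x] * x + c); last first.
  by apply/funext => x; rewrite !hornerE.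
have h : {for z, continuous (fun x : C => p.[x] * x)}.
  exact: (@continuousM C C (horner p) id z (IH z) (fun _ => id)).
exact: (@continuousD C C C (fun x => p.[x] * x) (cst c) z h (@cst_continuous _ _ c z)).
Qed.

Lemma Re_continuous : continuous (@complex.Re R : C -> R).
Proof.
move=> z; apply/contCR => e e0; exists e => // y; apply: le_lt_trans.
by rewrite -raddfB cabs_Re.
Qed.

Lemma disc_compact r : compact [set z : C | cabs z <= r].
Proof.
(* The disc is a closed subset of the image of a square under this map. *)
have cf : continuous (fun u : R * R => (u.1 +i* u.2)%C : C).
  move=> u B /nbhsC [e e0 eB].
  have e2 : 0 < e / 2 by rewrite divr_gt0.
  apply/nbhs_ballP; exists (e / 2) => //= v [/= v1 v2]; apply: eB.
  rewrite (_ : _ - _ = ((v.1 - u.1) +i* (v.2 - u.2))%C)//.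
  apply: le_lt_trans (cabs_rect _ _) _.
  by rewrite [e]splitr ltrD// distrC.
have cS : compact (`[- r, r]%classic `*` `[- r, r]%classic : set (R * R)).
  by apply: compact_setX; exact: segment_compact.
have cI := continuous_compact (continuous_subspaceT cf) cS.
apply: subclosed_compact cI _.
  rewrite (_ : mkset _ = cabs @^-1` [set x | x <= r])//.
  apply: closed_comp => [z _|]; first exact: cabs_continuous.
  exact: closed_le.
move=> z /= zr; exists (complex.Re z, complex.Im z); last by case: z {zr}.
by split; rewrite /= in_itv /= -ler_norml (le_trans _ zr) ?cabs_Re ?cabs_Im.
Qed.

End Modulus.
#[global] Hint Resolve cabs_ge0 : core.

(** * Compactness and connectedness in the plane *)

Section PlaneTopology.
Variable R : realType.
Local Notation C := (Cplx R).

(** Near-covering compactness along the filter of small positive numbers; [heine] and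
    [compact_closed_gap] are instances. *)
Lemma compact_uniform_real (K : set C) (P : R -> C -> Prop) : compact K ->
  (forall x, K x -> exists2 e : R, 0 < e &
     forall y d, cabs (y - x) < e -> 0 < d -> d < e -> P d y) ->
  exists2 d : R, 0 < d & forall x, K x -> P d x.
Proof.
move=> /compact_near_coveringP cK HP.
have : \forall d \near (0:R)^'+, K `<=` P d.
  apply: cK => x Kx; have [e e0 eP] := HP x Kx.
  exists ([set y | cabs (y - x) < e], [set d | 0 < d < e]) => /=.
    split; first by apply/nbhsC; exists e.
    near=> d; apply/andP; split; near: d; first exact: nbhs_right_gt.
    exact: nbhs_right_lt.
  by move=> [y d] /= [ye /andP[d0 de]]; exact: eP.
move=> H; have : \forall d \near (0:R)^'+, 0 < d /\ K `<=` P d.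
  by near=> d; split; near: d => //; exact: nbhs_right_gt.
by move=> /filter_ex [d [d0 dP]]; exists d.
Unshelve. all: by end_near. Qed.

Lemma compact_uniform_nat (K : set C) (P : nat -> C -> Prop) : compact K ->
  (forall x, K x -> exists n, exists2 e : R, 0 < e &
     forall y m, cabs (y - x) < e -> (n <= m)%N -> P m y) ->
  exists n, forall m x, (n <= m)%N -> K x -> P m x.
Proof.
move=> /compact_near_coveringP cK HP.
have : \forall n \near \oo, K `<=` P n.
  apply: cK => x Kx; have [n [e e0 eP]] := HP x Kx.
  exists ([set y | cabs (y - x) < e], [set m | (n <= m)%N]) => /=.
    split; first by apply/nbhsC; exists e.
    by exists n.
  by move=> [y d] /= [ye nd]; exact: eP.
by move=> [n _ nP]; exists n => m x nm Kx; exact: (nP m nm).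
Qed.

Lemma heine (K : set C) (f : C -> C) (e : R) : compact K -> continuous f -> 0 < e ->
  exists2 d : R, 0 < d & forall x y, K x -> cabs (y - x) < d -> cabs (f y - f x) < e.
Proof.
move=> cK cf e0.
suff [d d0 dP] : exists2 d : R, 0 < d & forall x, K x ->
    forall y, cabs (y - x) < d -> cabs (f y - f x) < e.
  by exists d => // x y Kx; exact: dP.
apply: compact_uniform_real => // x Kx.
have e2 : 0 < e / 2 by rewrite divr_gt0.
have /contCC/(_ _ e2) [d d0 dP] := cf x.
exists (d / 2); first by rewrite divr_gt0.
move=> y d' yx d'0 d'd z zy.
apply: le_lt_trans (cabs_tri _ _ (f x)) _; rewrite [e]splitr ltrD//; last first.
  by rewrite cabsB dP// (lt_le_trans yx)//; lra.
apply: dP; apply: le_lt_trans (cabs_tri _ _ y) _; rewrite [d]splitr ltrD//.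
exact: lt_trans zy _.
Qed.

Lemma compact_closed_gap (K F : set C) : compact K -> closed F -> K `&` F = set0 ->
  exists2 d : R, 0 < d & forall x y, K x -> F y -> d <= cabs (x - y).
Proof.
move=> cK cF KF.
suff [d d0 dP] : exists2 d : R, 0 < d & forall x, K x ->
    forall y, F y -> d <= cabs (x - y).
  by exists d => // x y Kx; exact: dP.
apply: compact_uniform_real => // x Kx.
have nF : (~` F) x by move=> Fx; rewrite -[False]/(set0 x) -KF.
have /openCP/(_ _ nF) [e e0 eP] : open (~` F) by exact: closed_openC.
exists (e / 2); first by rewrite divr_gt0.
move=> y d yx d0 de z Fz; rewrite leNgt; apply/negP => yz.
apply: (eP z) => //; rewrite cabsB; apply: le_lt_trans (cabs_tri _ _ y) _.
rewrite [e]splitr ltrD//; first by rewrite cabsB.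
exact: lt_trans yz _.
Qed.

Definition bd (T : set C) : set C := closure T `&` closure (~` T).

Lemma bd_closed T : closed (bd T).
Proof. by apply: closedI; exact: closed_closure. Qed.

Lemma bd_sub T : closed T -> bd T `<=` T.
Proof. by move=> cT x [cx _]; rewrite (closure_id T).1. Qed.

(** Off [bd T], membership in [T] is locally constant, so the part of [E] in [T] would be open and
    closed in [E]. *)
Lemma connected_bd E T : connected E -> E `&` T !=set0 -> E `&` ~` T !=set0 ->
  E `&` bd T !=set0.
Proof.
move=> cE [x [Ex Tx]] [y [Ey Ty]]; apply/set0P/negP => /eqP E0.
suff : E `&` T = E by move=> ET; apply: Ty; move: Ey; rewrite -ET => -[].
have h z : E z -> closure T z -> ~ closure (~` T) z.
  by move=> Ez c1 c2; rewrite -[False]/(set0 z) -E0.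
apply: cE; first by exists x.
  exists (~` closure (~` T)); first exact/closed_openC/closed_closure.
  apply/seteqP; split=> z [Ez].
    by move=> Tz; split=> //; apply: h => //; exact: subset_closure.
  by move=> nz; split=> //; apply: contrapT => nT; apply: nz; exact: subset_closure.
exists (closure T); first exact: closed_closure.
apply/seteqP; split=> z [Ez].
  by move=> Tz; split=> //; exact: subset_closure.
move=> cz; split=> //; apply: contrapT => nT; apply: (h z Ez cz); exact: subset_closure.
Qed.

Definition seg (z w : C) (t : R) : C := z + rc t * (w - z).

Lemma seg0 z w : seg z w 0 = z. Proof. by rewrite /seg rc0 mul0r addr0. Qed.
Lemma seg1 z w : seg z w 1 = w. Proof. by rewrite /seg rc1 mul1r addrC subrK. Qed.
Lemma seg_sub z w s t : cabs (seg z w s - seg z w t) = `|s - t| * cabs (w - z).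
Proof.
rewrite /seg (_ : _ - _ = rc (s - t) * (w - z)) ?cabsM ?cabs_rc//.
by rewrite rcB; ring.
Qed.

Lemma seg_continuous z w : continuous (seg z w).
Proof.
have d0 : 0 < cabs (w - z) + 1 by rewrite ltr_wpDl ?cabs_ge0 ?ltr01.
move=> t; apply/contRC => e e0; exists (e / (cabs (w - z) + 1)).
  by rewrite divr_gt0.
move=> s; rewrite seg_sub ltr_pdivlMr//; apply: le_lt_trans.
by rewrite ler_wpM2l// lerDl.
Qed.

Definition segment z w : set C := seg z w @` `[0, 1]%classic.

Lemma segmentP z w v : segment z w v <-> exists t : R, [/\ 0 <= t, t <= 1 & v = seg z w t].
Proof.
split=> [[t]|[t [t0 t1 ->]]]; last by exists t => //=; rewrite in_itv/= t0 t1.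
by rewrite /= in_itv /= => /andP[t0 t1] <-; exists t.
Qed.

Lemma segment_connectedC z w : connected (segment z w).
Proof.
apply: connected_continuous_connected; first exact: segment_connected.
exact/continuous_subspaceT/seg_continuous.
Qed.
Lemma segmentl z w : segment z w z.
Proof. by exists 0; rewrite ?seg0//= in_itv/= lexx ler01. Qed.
Lemma segmentr z w : segment z w w.
Proof. by exists 1; rewrite ?seg1//= in_itv/= lexx ler01. Qed.

Lemma segment_diam z w x y : segment z w x -> segment z w y ->
  cabs (x - y) <= cabs (w - z).
Proof.
move=> /segmentP[s [s0 s1 ->]] /segmentP[t [t0 t1 ->]]; rewrite seg_sub ler_piMl ?cabs_ge0//.
by rewrite ler_norml; apply/andP; split; lra.
Qed.

Lemma connected_star (A : set C) (x : C) : A x ->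
  (forall y, A y -> segment x y `<=` A) -> connected A.
Proof.
move=> Ax H; rewrite (_ : A = \bigcup_(y in A) segment x y).
  apply: bigcup_connected => [|y _]; last exact: segment_connectedC.
  by exists x => y _; exact: segmentl.
apply/seteqP; split=> y; first by move=> Ay; exists y => //; exact: segmentr.
by move=> [z Az]; exact: H.
Qed.

Lemma ball_connected c r : connected [set z : C | cabs (z - c) <= r].
Proof.
have [r0|r0] := leP 0 r; last first.
  rewrite (_ : mkset _ = set0); first exact: connected0.
  by apply/seteqP; split=> z //= /(le_trans (cabs_ge0 _)); rewrite leNgt r0.
apply: (@connected_star _ c) => /= [|y yr _ /segmentP[t [t0 t1 ->]]].
  by rewrite subrr cabs0.
rewrite /= /seg addrAC subrr add0r cabsM cabs_rc ger0_norm//.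
by apply: le_trans yr; apply: ler_piMl; [exact: cabs_ge0|exact: t1].
Qed.

Lemma halfplane_connected (l : C -> R) r :
  (forall x y t, l (seg x y t) = l x + t * (l y - l x)) ->
  connected [set z | r < l z].
Proof.
move=> lE; have [->|/set0P[x xr]] := eqVneq [set z | r < l z] set0.
  exact: connected0.
apply: (@connected_star _ x) => // y /= yr _ /segmentP[t [t0 t1 ->]].
move: xr; rewrite /= lE => xr.
have [/eqP ->|t0'] := boolP (t == 0); first by rewrite mul0r addr0.
have : 0 < t by rewrite lt_def t0' t0.
by move=> tp; nra.
Qed.

Lemma Re_seg x y t : complex.Re (seg x y t) = complex.Re x + t * (complex.Re y - complex.Re x).
Proof. by rewrite /seg raddfD rc_mulC /= raddfB. Qed.
Lemma Im_seg x y t : complex.Im (seg x y t) = complex.Im x + t * (complex.Im y - complex.Im x).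
Proof. by rewrite /seg raddfD rc_mulC /= raddfB. Qed.

(** The four half planes where a coordinate exceeds [r] in absolute value have a connected union.
    The radial segment from [z] to [3 * z] stays outside the disc and ends in that union, since a
    coordinate of [z] exceeds [r / 2] in absolute value. *)
Lemma outside_connected r : 0 < r -> connected [set z : C | r < cabs z].
Proof.
move=> r0.
pose H1 := [set z : C | r < complex.Re z]; pose H2 := [set z : C | r < complex.Im z].
pose H3 := [set z : C | r < - complex.Re z]; pose H4 := [set z : C | r < - complex.Im z].
pose U := (H1 `|` H2) `|` (H3 `|` H4).
pose a := r + 1; have ar : r < a by rewrite /a; lra.
have cU : connected U.
  apply: connectedU.
  - by exists ((- a) +i* a)%C; split; [right|left]; rewrite /H2 /H3 /= ?opprK.
  - apply: connectedU.
    + by exists (a +i* a)%C; split; rewrite /H1 /H2 /=.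
    + exact/halfplane_connected/Re_seg.
    + exact/halfplane_connected/Im_seg.
  - apply: connectedU.
    + by exists ((- a) +i* (- a))%C; split; rewrite /H3 /H4 /= opprK.
    + by apply: halfplane_connected => x y t; rewrite Re_seg; ring.
    + by apply: halfplane_connected => x y t; rewrite Im_seg; ring.
have sU : U `<=` [set z | r < cabs z].
  move=> z [[]|[]] /= h; apply: (lt_le_trans h).
  - exact: le_trans (ler_norm _) (cabs_Re z).
  - exact: le_trans (ler_norm _) (cabs_Im z).
  - by apply: le_trans (cabs_Re z); rewrite -normrN ler_norm.
  - by apply: le_trans (cabs_Im z); rewrite -normrN ler_norm.
rewrite (_ : mkset _ = \bigcup_(z in [set z | r < cabs z]) (segment z (rc 3 * z) `|` U)).
  apply: bigcup_connected.
    by exists (rc a) => z _; right; left; left.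
  move=> z rz; apply: connectedU => //; last exact: segment_connectedC.
  exists (rc 3 * z); split; first exact: segmentr.
  have h : cabs z <= `|complex.Re z| + `|complex.Im z|.
    by case: z {rz} => x y; exact: cabs_rect.
  move: rz h => /=; rewrite /U /H1 /H2 /H3 /H4 /= => rz h.
  rewrite rc_mulC /=; move: h.
  have [hx|hx] := leP 0 (complex.Re z); have [hy|hy] := leP 0 (complex.Im z);
    rewrite ?(ger0_norm hx) ?(ger0_norm hy) ?(ltr0_norm hx) ?(ltr0_norm hy) => h.
  - by case: (lerP (complex.Re z) (complex.Im z)) => hc; left; [right|left]; rewrite /=; lra.
  - by case: (lerP (complex.Re z) (- complex.Im z)) => hc; [right;right|left;left]; rewrite /=; lra.
  - by case: (lerP (- complex.Re z) (complex.Im z)) => hc; [left;right|right;left]; rewrite /=; lra.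
  - by case: (lerP (- complex.Re z) (- complex.Im z)) => hc; [right;right|right;left]; rewrite /=; lra.
apply/seteqP; split=> z; first by move=> rz; exists z => //; left; exact: segmentl.
move=> [w /= rw] [|]; last exact: sU.
move=> /segmentP[t [t0 t1 ->]].
rewrite (_ : seg _ _ _ = rc (1 + 2 * t) * w); last first.
  by rewrite (rcD 1 (2 * t)) (rcM 2 t) /seg rc1 !rc_nat; ring.
rewrite cabsM cabs_rc ger0_norm; last lra.
by apply: (lt_le_trans rw); rewrite ler_peMl//; lra.
Qed.

End PlaneTopology.
Arguments segment_connectedC {R} z w.
Arguments outside_connected {R} r _.
Arguments bd_closed {R} T.

(** * Boundaries of full continua *)

Section Unicoherence.
Variable R : realType.
Local Notation C := (Cplx R).

Lemma continuous_mulC (f g : C -> C) : continuous f -> continuous g ->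
  continuous (fun z => f z * g z).
Proof. by move=> cf cg z; exact: (@continuousM C C f g z (cf z) (cg z)). Qed.

Lemma continuous_addC (f g : C -> C) : continuous f -> continuous g ->
  continuous (fun z => f z + g z).
Proof. by move=> cf cg z; exact: (@continuousD C C C f g z (cf z) (cg z)). Qed.

Lemma continuous_cstC (c : C) : continuous (fun _ : C => c).
Proof. by move=> z; exact: cst_continuous. Qed.

Lemma continuous_rc (f : C -> R) : continuous f -> continuous (fun z => rc (f z)).
Proof.
move=> cf z; apply/contCC => e e0; have /contCR/(_ e e0) [d d0 dP] := cf z.
by exists d => // y /dP; rewrite -rcB cabs_rc.
Qed.

Lemma cabs_conj (z : C) : cabs (z^*)%C = cabs z.
Proof. by apply: rc_inj; rewrite -!cabsE !normc_def; case: z => a b /=; rewrite sqrrN. Qed.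

Lemma continuous_conj (f : C -> C) : continuous f -> continuous (fun z => (f z)^*%C : C).
Proof.
move=> cf z; apply/contCC => e e0; have /contCC/(_ e e0) [d d0 dP] := cf z.
exists d => // y /dP; rewrite -[X in X < _ -> _]cabs_conj.
by rewrite (_ : (f y - f z)^*%C = (f y)^*%C - (f z)^*%C :> C)// -rmorphB.
Qed.

Lemma mul_conjC (z : C) : z * (z^*)%C = rc (cabs z ^+ 2).
Proof. by rewrite rcX -cabsE -sqr_normc. Qed.

(** The radial retraction onto the disc of radius [r]; it lets uniform continuity on the disc serve
    for all [z]. *)
Definition retract (r : R) (z : C) : C := rc (r / Num.max r (cabs z)) * z.

Lemma retract_continuous r : 0 < r -> continuous (retract r).
Proof.
move=> r0; apply: continuous_mulC; last by move=> z; exact: id.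
apply: continuous_rc => z; have m0 : Num.max r (cabs z) != 0.
  by rewrite gt_eqF// lt_max r0.
apply: (@continuousM R C (cst r) (fun z => (Num.max r (cabs z))^-1)); first exact: cst_continuous.
apply: continuousV => //.
exact: (@continuous_max _ _ (cst r) (@cabs R) z (@cst_continuous _ _ r z) (@cabs_continuous R z)).
Qed.

Lemma retract_in r z : 0 < r -> cabs (retract r z) <= r.
Proof.
move=> r0; have m0 : 0 < Num.max r (cabs z) by rewrite lt_max r0.
rewrite cabsM cabs_rc ger0_norm ?divr_ge0 ?(ltW r0) ?(ltW m0)//.
rewrite mulrAC ler_pdivrMr// ler_wpM2l ?(ltW r0)//.
by rewrite le_max lexx orbT.
Qed.

Lemma retract_id r z : 0 < r -> cabs z <= r -> retract r z = z.
Proof. by move=> r0 zr; rewrite /retract max_l// divff ?gt_eqF// rc1 mul1r. Qed.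

Lemma retract_out r z : 0 < r -> r <= cabs z -> r <= cabs (retract r z).
Proof.
move=> r0 zr; rewrite cabsM cabs_rc max_r// ger0_norm ?divr_ge0 ?cabs_ge0 ?(ltW r0)//.
by rewrite divfK// gt_eqF// (lt_le_trans r0).
Qed.

(** [w + |w|] bisects the angle between [w] and the positive axis, so its square points in the
    direction of [w]; it depends continuously on [w], with no branch to choose. *)
Lemma pos_sqrt (w : C) : 0 < complex.Re w ->
  exists2 k : R, 0 < k & (w + rc (cabs w)) ^+ 2 = rc k * w.
Proof.
move=> w0; exists (2 * (complex.Re w + cabs w)).
  by rewrite mulr_gt0// ltr_wpDr ?cabs_ge0.
have e : w * (w^*)%C = rc (cabs w) ^+ 2 by rewrite mul_conjC rcX.
have e2 : w + (w^*)%C = 2 * rc (complex.Re w).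
  exact: addcJ.
rewrite (rcM 2) (rcD (complex.Re w)) rc_nat mulrDr -e2.
transitivity (w ^+ 2 + w * (w^*)%C + 2 * rc (cabs w) * w); last by ring.
by rewrite e; ring.
Qed.

(* g(z) is the telescoping product of g(0) and of the ratios
   g((k+1)z/N) / g(kz/N); these are close to 1, hence have, up to a positive
   factor, a square root depending continuously on z. *)
Lemma plane_sqrt (g : C -> C) (r : R) : 0 < r -> continuous g ->
  (forall z, g z != 0) -> (forall z, r <= cabs z -> g z = 1) ->
  exists2 s : C -> C, continuous s &
    forall z, exists2 k : R, 0 < k & (s z) ^+ 2 = rc k * g z.
Proof.
move=> r0 cg g0 g1; pose D := [set z : C | cabs z <= r].
have cD : compact D := @disc_compact R r.
have D0 : D !=set0 by exists 0; rewrite /D /= cabs0 ltW.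
have cag : continuous (fun z => cabs (g z)).
  by move=> z; apply: continuous_comp; [exact: cg|exact: cabs_continuous].
have [c _ cmin] := compact_EVT_min D0 cD (continuous_subspaceT cag).
have gc : 0 < cabs (g c) by rewrite cabs_gt0.
(* The tolerance is the minimum of [|g|] on the disc: samples closer than [d] differ by less than
   the modulus of either. *)
have [d d0 dP] := heine cD cg gc.
have {}dP x y : D x -> cabs (y - x) < d -> cabs (g y - g x) < cabs (g x).
  move=> Dx yx; apply: lt_le_trans (cmin x (mem_set Dx)).
  exact: dP.
have [N Nr] : exists N : nat, r / N.+1%:R < d.
  have dr : 0 < d / r by rewrite divr_gt0.
  have [N Nr] := ltr_add_invr dr.
  exists N; rewrite add0r in Nr.
  by rewrite mulrC -ltr_pdivlMr.
pose gk (k : nat) z := g (rc (k%:R / N.+1%:R) * retract r z).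
have cgk k : continuous (gk k).
  move=> z; apply: (@continuous_comp _ _ _ (fun z => rc (k%:R / N.+1%:R) * retract r z) g).
    by apply: continuous_mulC; [exact: continuous_cstC|exact: retract_continuous].
  exact: cg.
(* Outside the disc both [z] and its retraction have modulus at least [r], where [g] is 1. *)
have gkN z : gk N.+1 z = g z.
  rewrite /gk divff// rc1 mul1r; have [zr|zr] := leP (cabs z) r.
    by rewrite retract_id.
  by rewrite [RHS]g1 ?(ltW zr)// g1// retract_out// ltW.
suff H (k : nat) : (k <= N.+1)%N -> exists2 s : C -> C, continuous s &
    forall z, exists2 l : R, 0 < l & (s z) ^+ 2 = rc l * gk k z.
  have [s cs sP] := H _ (leqnn _); exists s => // z.
  by have [l l0] := sP z; rewrite gkN; exists l.
elim: k => [_|k IH kN].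
  exists (fun=> sqrtC (g 0)); first exact: continuous_cstC.
  by move=> z; exists 1; rewrite // rc1 mul1r /gk mul0r rc0 mul0r sqrtCK.
have [s cs sP] := IH (ltnW kN).
(* A positive multiple of the ratio of consecutive samples; it lies in the right half plane because
   they differ by less than [|gk k z|]. *)
pose w z := gk k.+1 z * (gk k z)^*%C.
have cw : continuous w := continuous_mulC (cgk k.+1) (continuous_conj (cgk k)).
exists (fun z => s z * (w z + rc (cabs (w z)))).
  apply: (continuous_mulC cs); apply: (continuous_addC cw); apply: continuous_rc.
  by move=> z; apply: continuous_comp; [exact: cw|exact: cabs_continuous].
move=> z; have [l l0 sl] := sP z.
have step : cabs (gk k.+1 z - gk k z) < cabs (gk k z).
  apply: dP.
    rewrite /D /= cabsM cabs_rc ger0_norm ?divr_ge0//.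
    apply: le_trans (retract_in z r0); rewrite ler_piMl ?cabs_ge0//.
    by rewrite ler_pdivrMr// mul1r ler_nat ltnW.
  rewrite -mulrBl -rcB cabsM cabs_rc -mulrBl -natrB ?leqnSn// subSnn mul1r.
  rewrite ger0_norm ?invr_ge0//; apply: le_lt_trans Nr; rewrite mulrC.
  by rewrite ler_wpM2r ?invr_ge0// retract_in.
have w0 : 0 < complex.Re (w z).
  have -> : w z = rc (cabs (gk k z) ^+ 2) + (gk k.+1 z - gk k z) * (gk k z)^*%C.
    by rewrite -mul_conjC /w; ring.
  rewrite raddfD /= -(opprK (_ ^+ 2)) addrC subr_gt0.
  set u := (_ * _).
  have uk : cabs u < cabs (gk k z) ^+ 2.
    by rewrite /u cabsM cabs_conj expr2 ltr_pM2r// cabs_gt0 g0.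
  by have := le_lt_trans (cabs_Re u) uk; rewrite ltr_norml => /andP[].
have [m m0 wm] := pos_sqrt w0.
exists (l * m * cabs (gk k z) ^+ 2).
  by apply: mulr_gt0; [exact: mulr_gt0|rewrite exprn_gt0// cabs_gt0 g0].
by rewrite exprMn sl wm (rcM (l * m)) (rcM l m) -mul_conjC /w; ring.
Qed.

Lemma Urysohn_gap (A B : set C) (d : R) : 0 < d ->
  (forall x y, A x -> B y -> d <= cabs (x - y)) ->
  exists f : C -> R, [/\ continuous f, forall z, 0 <= f z <= 1,
    forall z, A z -> f z = 0 & forall z, B z -> f z = 1].
Proof.
move=> d0 AB.
have us : uniform_separator (A : set C) (B : set C).
  apply: uniform_separatorW; exists [set u : C * C | cabs (u.1 - u.2) < d].
    rewrite -entourage_ballE; exists (rc d); first by rewrite /= rc_lt.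
    by move=> [x y]; rewrite /= -ball_normE /ball_ /= cabsE rc_lt.
  apply/seteqP; split=> // -[x y] /= [[Ax By]]; rewrite ltNge => /negP; apply; exact: AB.
exists (Urysohn A B); split.
- exact: Urysohn_continuous.
- move=> z; have := @Urysohn_range _ R A B (Urysohn A B z).
  by rewrite /= in_itv /=; apply; exists z.
- by move=> z Az; apply: (Urysohn_sub0 us); exists z.
- by move=> z Bz; apply: (Urysohn_sub1 us); exists z.
Qed.

End Unicoherence.

(** * The boundary of a full continuum is not separated by two closed sets *)

Section BoundaryConnected.
Variable R : realType.
Local Notation C := (Cplx R).

Lemma glue_continuous (a b : C -> C) (T : set C) : continuous a -> continuous b ->
  (forall z, bd T z -> a z = b z) ->
  continuous (fun z => if `[< T z >] then a z else b z).
Proof.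
move=> ca cb ab z; apply/contCC => e e0.
have /contCC/(_ e e0) [d1 d10 d1P] := ca z.
have /contCC/(_ e e0) [d2 d20 d2P] := cb z.
have [bz|nbz] := pselect (bd T z).
  exists (Num.min d1 d2); first by rewrite lt_min d10.
  move=> y; rewrite lt_min => /andP[y1 y2].
  have -> : (if `[< T z >] then a z else b z) = b z by case: ifP => _ //; rewrite ab.
  by case: ifP => _; [rewrite -(ab _ bz); exact: d1P|exact: d2P].
have [cT|ncT] := pselect (closure T z); last first.
  have /openCP/(_ _ ncT) [d3 d30 d3P] : open (~` closure T) by exact/closed_openC/closed_closure.
  have nT y : cabs (y - z) < d3 -> `[< T y >] = false.
    by move=> /d3P h; apply/asboolP => /subset_closure.
  exists (Num.min d2 d3); first by rewrite lt_min d20.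
  move=> y; rewrite lt_min => /andP[y2 y3].
  by rewrite (nT y)// (nT z) ?subrr ?cabs0//; exact: d2P.
have ncT' : (~` closure (~` T)) z by move=> h; apply: nbz.
have /openCP/(_ _ ncT') [d3 d30 d3P] : open (~` closure (~` T)) by exact/closed_openC/closed_closure.
have nT y : cabs (y - z) < d3 -> `[< T y >] = true.
  by move=> /d3P h; apply/asboolP; apply: contrapT => nT; apply: h; exact: subset_closure.
exists (Num.min d1 d3); first by rewrite lt_min d10.
move=> y; rewrite lt_min => /andP[y2 y3].
by rewrite (nT y)// (nT z) ?subrr ?cabs0//; exact: d1P.
Qed.

(** A number with positive square is real and nonzero, and its sign cannot change on a connected
    set. *)
Lemma constant_sign (A : set C) (u : C -> C) : connected A -> continuous u ->
  (forall z, A z -> exists2 k : R, 0 < k & u z ^+ 2 = rc k) ->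
  (forall z, A z -> 0 < complex.Re (u z)) \/ (forall z, A z -> complex.Re (u z) < 0).
Proof.
move=> cA cu uP.
have un0 z : A z -> complex.Re (u z) != 0.
  move=> /uP [k k0]; case: (u z) => x y; rewrite expr2 => h; apply/eqP => /= x0.
  have := congr1 (@complex.Re R) h; rewrite /= x0 mul0r sub0r => hk.
  by move: k0; rewrite -hk oppr_gt0 ltNge -expr2 sqr_ge0.
have cR : continuous (fun z => complex.Re (u z)).
  by move=> z; apply: continuous_comp; [exact: cu|exact: Re_continuous].
have [E0|/set0P E0] := eqVneq (A `&` [set z | 0 < complex.Re (u z)]) set0.
  right=> z Az; rewrite lt_neqAle un0//= leNgt; apply/negP => h.
  by rewrite -[False]/(set0 z) -E0.
left=> z Az; suff AE : A `&` [set z | 0 < complex.Re (u z)] = A by move: Az; rewrite -{1}AE => -[].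
apply: cA => //.
  exists [set z | 0 < complex.Re (u z)] => //.
  by apply: (@open_comp _ _ (fun z => complex.Re (u z)) [set x | 0 < x]) => [y _|]; [exact: cR|exact: open_gt].
exists [set z | 0 <= complex.Re (u z)].
  by apply: (@closed_comp _ _ (fun z => complex.Re (u z)) [set x | 0 <= x]) => [y _|]; [exact: cR|exact: closed_ge].
by apply/seteqP; split=> y /= [Ay h]; split=> //; [exact: ltW|rewrite lt_def un0].
Qed.

(* If f is 1 on bd T `&` P and 0 on bd T `&` Q, the path from 1 to -1 through the
   upper half plane composed with f on T, and the one through the lower half
   plane on the complement of T, glue to a nonvanishing function of the plane.
   A square root of it is, up to sign, a square root of each path on T and on
   its complement, and the signs cannot agree both where f = 0 and where f = 1. *)
Lemma bd_one_side (T P Q : set C) : compact T -> connected T -> connected (~` T) ->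
  closed P -> closed Q -> bd T `&` P `&` Q = set0 -> bd T `<=` P `|` Q ->
  bd T `<=` P \/ bd T `<=` Q.
Proof.
move=> cT coT coT' cP cQ PQ0 bPQ; apply: contrapT => /not_orP[nP nQ].
have [p bp Qp] : exists2 p, bd T p & Q p.
  apply: contrapT => h; apply: nP => z bz; have [//|Qz] := bPQ z bz.
  by exfalso; apply: h; exists z.
have [q bq Pq] : exists2 q, bd T q & P q.
  apply: contrapT => h; apply: nQ => z bz; have [Pz|//] := bPQ z bz.
  by exfalso; apply: h; exists z.
have cloT : closed T.
  apply: compact_closed cT; exact: norm_hausdorff.
have [r r0 rT] : exists2 r : R, 0 < r & forall z, T z -> cabs z < r.
  have T0 : T !=set0 by exists p; exact: bd_sub bp.
  have [c _ cmax] := compact_EVT_max T0 cT (continuous_subspaceT (@cabs_continuous R)).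
  exists (cabs c + 1); first by rewrite ltr_wpDl ?cabs_ge0.
  by move=> z /mem_set /cmax /le_lt_trans; apply; rewrite ltrDl.
(* The exterior of a disc containing [T] is added so that [f] vanishes there and [g] is 1 there, as
   [plane_sqrt] requires. *)
pose F := (bd T `&` Q) `|` [set z | r <= cabs z].
have cK : compact (bd T `&` P).
  apply: subclosed_compact cT _; first exact: (closedI (@bd_closed _ T) cP).
  by move=> z [/(bd_sub cloT)].
have cF : closed F.
  apply: closedU; first exact: (closedI (@bd_closed _ T) cQ).
  by apply: (@closed_comp _ _ (@cabs R) [set x | r <= x]) => [y _|]; [exact: cabs_continuous|exact: closed_ge].
have KF : bd T `&` P `&` F = set0.
  apply/seteqP; split=> // z [[bz Pz] [[_ Qz]|/=]]; first by rewrite -PQ0.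
  by rewrite leNgt rT//; exact: bd_sub bz.
have [d d0 dP] := compact_closed_gap cK cF KF.
have [f [cf f01 f0 f1]] : exists f : C -> R, [/\ continuous f, forall z, 0 <= f z <= 1,
    forall z, F z -> f z = 0 & forall z, (bd T `&` P) z -> f z = 1].
  by apply: (Urysohn_gap d0) => x y Fx Ky; rewrite cabsB; exact: dP.
(* The segments from 1 to [i] and from 1 to [- i]; their squares are the two paths from 1 to -1, and
   [a] and [b] are explicit square roots of these. *)
pose a z : C := rc (1 - f z) + 'i%C * rc (f z).
pose b z : C := rc (1 - f z) - 'i%C * rc (f z).
have aE z : a z = ((1 - f z) +i* f z)%C.
  by rewrite /a /rc [RHS]complexE.
have bE z : b z = (a z)^*%C.
  by rewrite aE /b /rc [RHS]complexE /= rmorphN mulrN.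
have cn : continuous (fun z => 1 - f z).
  by move=> z; apply: (@continuousB R R C (cst 1) f z); [exact: cst_continuous|exact: cf].
have ca : continuous a.
  by apply: continuous_addC; [|apply: continuous_mulC; [exact: continuous_cstC|]]; exact: continuous_rc.
have cb : continuous b.
  by rewrite (_ : b = fun z => (a z)^*%C :> C); [exact: continuous_conj|apply/funext].
pose n z := (1 - f z) ^+ 2 + f z ^+ 2.
have n0 z : 0 < n z.
  by rewrite /n; have := f01 z => /andP[]; nra.
have abn z : a z * b z = rc (n z).
  by rewrite bE mul_conjC cabs_sq aE.
have a0 z : a z != 0.
  by apply/eqP => h; have := abn z; rewrite h mul0r => /esym/eqP; rewrite rc_eq0 gt_eqF.
have b0 z : b z != 0.
  by apply/eqP => h; have := abn z; rewrite h mulr0 => /esym/eqP; rewrite rc_eq0 gt_eqF.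
have aF z : F z -> a z = 1 /\ b z = 1.
  by move=> /f0 h; rewrite /a /b h subr0 rc1 rc0 mulr0 addr0 subr0.
have aK z : (bd T `&` P) z -> a z = 'i%C /\ b z = - 'i%C.
  by move=> /f1 h; rewrite /a /b h subrr rc1 rc0 mulr1 add0r sub0r.
have abd z : bd T z -> a z ^+ 2 = b z ^+ 2.
  move=> bz; have [Pz|Qz] := bPQ z bz.
    by have [-> ->] := aK z (conj bz Pz); rewrite sqrrN.
  by have [-> ->] := aF z (or_introl (conj bz Qz)).
pose g z := if `[< T z >] then a z ^+ 2 else b z ^+ 2.
have cg : continuous g.
  by apply: glue_continuous; [exact: (continuous_mulC ca ca)|exact: (continuous_mulC cb cb)|exact: abd].
have g0 z : g z != 0 by rewrite /g; case: ifP => _; rewrite expf_neq0.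
have g1 z : r <= cabs z -> g z = 1.
  by move=> rz; rewrite /g; have [-> ->] := aF z (or_intror rz); rewrite expr1n; case: ifP.
have [s cs sP] := plane_sqrt r0 cg g0 g1.
have gT z : T z -> g z = a z ^+ 2 by rewrite /g => /asboolT ->.
have gT' z : closure (~` T) z -> g z = b z ^+ 2.
  move=> cz; rewrite /g; case: asboolP => // Tz; apply: abd.
  by split=> //; exact: subset_closure.
(* Since [a z * b z] is positive, multiplying [s] by the conjugate path replaces dividing it by the
   square root [e1]. *)
have sgn (e1 e2 : C -> C) (A : set C) : connected A -> continuous e2 ->
    (forall z, e1 z * e2 z = rc (n z)) -> (forall z, A z -> g z = e1 z ^+ 2) ->
  (forall z, A z -> 0 < complex.Re (s z * e2 z)) \/ (forall z, A z -> complex.Re (s z * e2 z) < 0).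
  move=> cA ce en ge; apply: (constant_sign cA (continuous_mulC cs ce)).
  move=> z Az; have [k k0 sk] := sP z; exists (k * n z ^+ 2).
    by rewrite mulr_gt0// exprn_gt0.
  by rewrite exprMn sk ge// rcM rcX -en; ring.
have HT := sgn a b T coT cb abn gT.
(* Taken on the closure of the complement so that the sign is also known at the boundary points [p]
   and [q]. *)
have HT' := sgn b a (closure (~` T)) (connected_closure coT') ca (fun z => etrans (mulrC _ _) (abn z)) gT'.
have Tp : T p := bd_sub cloT bp.
have Tq : T q := bd_sub cloT bq.
have [ap bp1] := aF p (or_introl (conj bp Qp)).
have [aq bq1] := aK q (conj bq Pq).
have q1 : complex.Re (s q * b q) = - complex.Re (s q * a q).
  by rewrite aq bq1 mulrN raddfN.
(* At [p] both paths are 1 and the signs must agree; at [q] they are [i] and [- i] and the signs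
   must differ. *)
case: HT => HT; case: HT' => HT'.
- by have := HT q Tq; rewrite q1 oppr_gt0 ltNge ltW// HT'//; exact: bq.2.
- by have := HT p Tp; have := HT' p bp.2; rewrite ap bp1 => /ltW; rewrite leNgt => /negP.
- by have := HT p Tp; have := HT' p bp.2; rewrite ap bp1 => /ltW; rewrite leNgt => /negP.
- by have := HT q Tq; rewrite q1 oppr_lt0 ltNge ltW// HT'//; exact: bq.2.
Qed.

End BoundaryConnected.

(** * The maximum principle for polynomials *)

Section SecondOrderExpansions.
Variable R : realType.
Local Notation C := (Cplx R).

(** A Taylor expansion of order two at 0 with cubic remainder, as a relation on the coefficients: it
    composes with sums, products and [ln] without handling second derivatives. The coefficient [c2]
    is half a second derivative. *)
Definition expands (phi : R -> R) (c0 c1 c2 : R) : Prop :=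
  exists K d0 : R, 0 < d0 /\ forall d, `|d| < d0 ->
    `|phi d - (c0 + c1 * d + c2 * d ^+ 2)| <= K * `|d| ^+ 3.

Lemma expandsP (phi : R -> R) c0 c1 c2 : expands phi c0 c1 c2 ->
  exists K d0 : R, [/\ 0 < K, 0 < d0, d0 <= 1 & forall d, `|d| < d0 ->
    `|phi d - (c0 + c1 * d + c2 * d ^+ 2)| <= K * `|d| ^+ 3].
Proof.
move=> [K [d0 [d00 H]]]; exists (`|K| + 1), (Num.min d0 1); split.
- by rewrite ltr_wpDl.
- by rewrite lt_min d00 ltr01.
- by rewrite ge_min lexx orbT.
move=> d; rewrite lt_min => /andP[/H h _]; apply: (le_trans h).
by rewrite ler_wpM2r ?exprn_ge0//; apply: le_trans (ler_norm _) _; rewrite lerDl.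
Qed.

Lemma expands_ext phi psi c0 c1 c2 : phi =1 psi -> expands phi c0 c1 c2 -> expands psi c0 c1 c2.
Proof. by move=> /funext ->. Qed.

Lemma expands_near phi psi c0 c1 c2 (e : R) : 0 < e -> (forall d, `|d| < e -> phi d = psi d) ->
  expands phi c0 c1 c2 -> expands psi c0 c1 c2.
Proof.
move=> e0 h [K [d0 [d00 H]]]; exists K, (Num.min d0 e); split; first by rewrite lt_min d00.
by move=> d; rewrite lt_min => /andP[/H hd /h <-].
Qed.

Lemma expands_poly2 c0 c1 c2 : expands (fun d => c0 + c1 * d + c2 * d ^+ 2) c0 c1 c2.
Proof. by exists 0, 1; split=> // d _; rewrite subrr normr0 mul0r. Qed.

Lemma expands_O (phi : R -> R) (K d0 : R) : 0 < d0 ->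
  (forall d, `|d| < d0 -> `|phi d| <= K * `|d| ^+ 3) -> expands phi 0 0 0.
Proof.
by move=> d00 H; exists K, d0; split=> // d /H; rewrite !mul0r !addr0 subr0.
Qed.

Lemma expandsD phi psi a0 a1 a2 b0 b1 b2 : expands phi a0 a1 a2 -> expands psi b0 b1 b2 ->
  expands (fun d => phi d + psi d) (a0 + b0) (a1 + b1) (a2 + b2).
Proof.
move=> [K [d0 [d00 H]]] [K' [d0' [d00' H']]]; exists (K + K'), (Num.min d0 d0').
split; first by rewrite lt_min d00.
move=> d; rewrite lt_min => /andP[/H h /H' h'].
rewrite (_ : _ - _ = (phi d - (a0 + a1 * d + a2 * d ^+ 2)) + (psi d - (b0 + b1 * d + b2 * d ^+ 2))); last ring.
by rewrite mulrDl; apply: le_trans (ler_normD _ _) (lerD h h').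
Qed.

Lemma expandsZ k phi a0 a1 a2 : expands phi a0 a1 a2 ->
  expands (fun d => k * phi d) (k * a0) (k * a1) (k * a2).
Proof.
move=> [K [d0 [d00 H]]]; exists (`|k| * K), d0; split=> // d /H h.
rewrite (_ : _ - _ = k * (phi d - (a0 + a1 * d + a2 * d ^+ 2))); last ring.
by rewrite normrM -mulrA ler_wpM2l.
Qed.

Lemma expandsM phi psi a0 a1 a2 b0 b1 b2 : expands phi a0 a1 a2 -> expands psi b0 b1 b2 ->
  expands (fun d => phi d * psi d) (a0 * b0) (a0 * b1 + a1 * b0) (a0 * b2 + a1 * b1 + a2 * b0).
Proof.
move=> /expandsP[K [d0 [K0 d00 d01 H]]] /expandsP[K' [d0' [K0' d00' d01' H']]].
pose A := `|a0| + `|a1| + `|a2|; pose B := `|b0| + `|b1| + `|b2|.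
exists (A * K' + B * K + K * K' + (`|a1| * `|b2| + `|a2| * `|b1| + `|a2| * `|b2|)), (Num.min d0 d0').
split; first by rewrite lt_min d00.
move=> d; rewrite lt_min => /andP[dd dd']; have := H d dd; have := H' d dd'.
have d1 : `|d| <= 1 by apply: ltW; apply: lt_le_trans dd _.
set p := a0 + _ + _; set q := b0 + _ + _.
set u := phi d - p; set v := psi d - q => hv hu.
have D3 : 0 <= `|d| ^+ 3 by rewrite exprn_ge0.
have D2 : `|d| ^+ 2 <= 1 by rewrite exprn_ile1.
have pA : `|p| <= A.
  rewrite /p /A; apply: le_trans (ler_normD _ _) _; apply: lerD.
    by apply: le_trans (ler_normD _ _) _; rewrite lerD2l normrM ler_piMr.
  by rewrite normrM normrX ler_piMr.
have qB : `|q| <= B.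
  rewrite /q /B; apply: le_trans (ler_normD _ _) _; apply: lerD.
    by apply: le_trans (ler_normD _ _) _; rewrite lerD2l normrM ler_piMr.
  by rewrite normrM normrX ler_piMr.
rewrite (_ : _ - _ = p * v + q * u + u * v + ((a1 * b2) * d ^+ 3 + (a2 * b1) * d ^+ 3 + (a2 * b2 * d) * d ^+ 3)); last first.
  by rewrite /u /v /p /q; ring.
rewrite [leRHS](_ : _ = A * (K' * `|d| ^+ 3) + B * (K * `|d| ^+ 3) + K * K' * `|d| ^+ 3 +
  (`|a1 * b2| * `|d| ^+ 3 + `|a2 * b1| * `|d| ^+ 3 + `|a2 * b2| * `|d| ^+ 3)); last first.
  by rewrite !normrM; ring.
have t1 : `|p * v| <= A * (K' * `|d| ^+ 3) by rewrite normrM ler_pM.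
have t2 : `|q * u| <= B * (K * `|d| ^+ 3) by rewrite normrM ler_pM.
have t3 : `|u * v| <= K * K' * `|d| ^+ 3.
  rewrite normrM; apply: (@le_trans _ _ ((K * `|d| ^+ 3) * (K' * `|d| ^+ 3))).
    by rewrite ler_pM.
  rewrite mulrACA ler_wpM2l ?mulr_ge0 ?(ltW K0) ?(ltW K0')//.
  by rewrite ler_piMl// exprn_ile1.
have t4 : `|a1 * b2 * d ^+ 3| <= `|a1 * b2| * `|d| ^+ 3 by rewrite normrM normrX.
have t5 : `|a2 * b1 * d ^+ 3| <= `|a2 * b1| * `|d| ^+ 3 by rewrite normrM normrX.
have t6 : `|a2 * b2 * d * d ^+ 3| <= `|a2 * b2| * `|d| ^+ 3.
  by rewrite normrM normrX ler_wpM2r// normrM ler_piMr.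
apply: le_trans (ler_normD _ _) _; apply: lerD.
  apply: le_trans (ler_normD _ _) (lerD _ t3).
  exact: le_trans (ler_normD _ _) (lerD t1 t2).
apply: le_trans (ler_normD _ _) (lerD _ t6).
exact: le_trans (ler_normD _ _) (lerD t4 t5).
Qed.

Lemma expands_small phi c1 c2 : expands phi 0 c1 c2 ->
  exists K d0 : R, [/\ 0 < K, 0 < d0 & forall d, `|d| < d0 -> `|phi d| <= K * `|d|].
Proof.
move=> /expandsP[K [d0 [K0 d00 d01 H]]].
exists (K + `|c1| + `|c2|), d0; split=> //; first by rewrite -addrA ltr_wpDr// addr_ge0.
move=> d dd; have d1 : `|d| <= 1 by apply/ltW/(lt_le_trans dd).
have h := H d dd.
rewrite (_ : phi d = (phi d - (0 + c1 * d + c2 * d ^+ 2)) + (c1 * d) + (c2 * d ^+ 2)); last ring.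
rewrite !mulrDl; apply: le_trans (ler_normD _ _) _; apply: lerD.
  apply: le_trans (ler_normD _ _) _; apply: lerD; last by rewrite normrM.
  apply: (le_trans h); rewrite ler_wpM2l ?(ltW K0)// exprS ler_piMr//.
  by rewrite exprn_ile1.
by rewrite normrM normrX ler_wpM2l// expr2 ler_piMr.
Qed.

(** The left-hand function has derivative [y ^+ 2 / (1 + y)], at most [2 * y ^+ 2] for [y] at least
    [- 2^-1]; the mean value theorem concludes. *)
Lemma ln_taylor2 (x : R) : `|x| <= 2^-1 -> `|ln (1 + x) - x + x ^+ 2 / 2| <= 2 * `|x| ^+ 3.
Proof.
pose F y := ln (1 + y) - y + y ^+ 2 / 2 : R.
have dF (y : R) : - 2^-1 <= y -> is_derive y 1 F (y ^+ 2 / (1 + y)).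
  move=> y1; have y0 : 0 < 1 + y by lra.
  have h : is_derive y 1 (cst 1 + id : R -> R) (0 + 1) by exact: is_deriveD.
  have d1 : is_derive y 1 ((@ln R) \o (cst 1 + id : R -> R)) (1 + y)^-1.
    apply: is_derive_eq (is_derive1_comp (is_derive1_ln y0) h) _.
    by rewrite add0r mulr1.
  have d2 : is_derive y 1 ((fun z : R => z) ^+ 2 : R -> R) (2 * y).
    by apply: is_derive_eq; rewrite /GRing.scale /= mulr1 expr1.
  have d5 := is_deriveD (is_deriveB d1 (is_derive_id y 1)) (is_deriveZ 2^-1 d2).
  have -> : F = ((@ln R) \o (cst 1 + id : R -> R)) - id + 2^-1 *: (fun z : R => z) ^+ 2.
    by apply/funext => z; rewrite /F !fctE /GRing.scale /= [X in _ = _ + X]mulrC.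
  by apply: is_derive_eq d5 _; rewrite /GRing.scale /=; field; lra.
have dFc (a b : R) : - 2^-1 <= a -> {within `[a, b], continuous F}.
  move=> a1; apply: derivable_within_continuous => y.
  rewrite in_itv /= => /andP[ay _]; have [] := dF y => //; exact: le_trans ay.
have F0 : F 0 = 0 by rewrite /F addr0 ln1 expr2 !mul0r subr0 addr0.
have bound (c : R) : - 2^-1 <= c -> `|c| <= `|x| -> `|c ^+ 2 / (1 + c)| <= 2 * `|x| ^+ 2.
  move=> c1 cx; have c0 : 0 < 1 + c by lra.
  rewrite normrM normrX normfV (gtr0_norm c0) mulrC ler_pM ?invr_ge0 ?exprn_ge0 ?(ltW c0)//.
    by rewrite -[leRHS]invrK lef_pV2 ?posrE ?invr_gt0//; lra.
  by rewrite lerXn2r ?nnegrE.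
move=> x2; have /andP[xl xr] : - 2^-1 <= x <= 2^-1 by rewrite -ler_norml.
rewrite -/(F x); have [x0|x0|->] := ltgtP x 0.
- have dx (z : R) : z \in `]x, 0[%R -> is_derive z 1 F (z ^+ 2 / (1 + z)).
    by rewrite in_itv /= => /andP[xc _]; apply: dF; lra.
  have [c /[!in_itv]/= /andP[xc c0] Fc] := MVT x0 dx (dFc x 0 xl).
  have -> : F x = - (c ^+ 2 / (1 + c) * (0 - x)) by rewrite -Fc F0; ring.
  rewrite normrN normrM sub0r normrN (exprSr _ 2) mulrA ler_wpM2r// bound//; first lra.
  by rewrite !ltr0_norm// lerNl opprK ltW.
- have dx (z : R) : z \in `]0, x[%R -> is_derive z 1 F (z ^+ 2 / (1 + z)).
    by rewrite in_itv /= => /andP[xc _]; apply: dF; lra.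
  have h0 : - 2^-1 <= 0 :> R by lra.
  have [c /[!in_itv]/= /andP[xc c0] Fc] := MVT x0 dx (dFc 0 x h0).
  have -> : F x = c ^+ 2 / (1 + c) * (x - 0) by rewrite -Fc F0; ring.
  rewrite normrM subr0 (exprSr _ 2) mulrA ler_wpM2r// bound//; first lra.
  by rewrite !gtr0_norm// ltW.
- by rewrite F0 !normr0 expr0n mulr0.
Qed.

Lemma expands_ln phi c0 c1 c2 : 0 < c0 -> expands phi c0 c1 c2 ->
  expands (fun d => ln (phi d)) (ln c0) (c1 / c0) (c2 / c0 - (c1 / c0) ^+ 2 / 2).
Proof.
move=> c00 H; have cn : c0 != 0 by rewrite gt_eqF.
(* Factoring out [c0] reduces to [ln (1 + x)] with [x] of order [d]. *)
pose x d := c0^-1 * phi d - 1.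
have ex : expands x 0 (c1 / c0) (c2 / c0).
  have := expandsD (expandsZ c0^-1 H) (expands_poly2 (-1) 0 0).
  rewrite mulVf// subrr !addr0 ![c0^-1 * _]mulrC; apply: expands_ext => d.
  by rewrite !mul0r !addr0.
have [K [d0 [K0 d00 xK]]] := expands_small ex.
have e2 := expandsM ex ex.
pose y d := ln (1 + x d) - x d + x d ^+ 2 / 2.
have ey : expands y 0 0 0.
  apply: (@expands_O _ (2 * K ^+ 3) (Num.min d0 ((2 * K)^-1))).
    by rewrite lt_min d00 invr_gt0 mulr_gt0.
  move=> d; rewrite lt_min => /andP[dd dK].
  have xd := xK d dd.
  have x2 : `|x d| <= 2^-1.
    apply: (le_trans xd); rewrite -ler_pdivlMl//; apply: ltW.
    by apply: (lt_le_trans dK); rewrite invfM mulrC.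
  apply: (le_trans (ln_taylor2 x2)); rewrite -mulrA -exprMn ler_wpM2l//.
  by rewrite lerXn2r ?nnegrE// mulr_ge0// ltW.
have e3 := expandsD (expandsD (expandsD ey ex) (expandsZ (- 2^-1) e2)) (expands_poly2 (ln c0) 0 0).
rewrite (_ : ln c0 = 0 + 0 + - 2^-1 * (0 * 0) + ln c0); last ring.
rewrite (_ : c1 / c0 = 0 + c1 / c0 + - 2^-1 * (0 * (c1 / c0) + c1 / c0 * 0) + 0); last ring.
rewrite [X in expands _ _ _ X](_ : _ = 0 + c2 / c0 + - 2^-1 * (0 * (c2 / c0) + c1 / c0 * (c1 / c0) + c2 / c0 * 0) + 0); last by field.
apply: (@expands_near _ _ _ _ _ (Num.min d0 ((2 * K)^-1)) _ _ e3).
  by rewrite lt_min d00 invr_gt0 mulr_gt0.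
move=> d; rewrite lt_min => /andP[dd dK].
have xd := xK d dd.
have x2 : `|x d| <= 2^-1.
  apply: (le_trans xd); rewrite -ler_pdivlMl//; apply: ltW.
  by apply: (lt_le_trans dK); rewrite invfM mulrC.
have x1 : 0 < 1 + x d.
  by move: x2; rewrite ler_norml => /andP[]; lra.
have -> : phi d = (1 + x d) * c0 by rewrite /x; field.
by rewrite lnM ?posrE// /y; field.
Qed.

(** Adding the inequalities at [d] and at [- d] cancels the linear term; [d] is taken so small that
    the cubic error [K * d ^+ 3] is below [c2 * d ^+ 2]. *)
Lemma expands_max phi c0 c1 c2 (e : R) : 0 < e -> expands phi c0 c1 c2 ->
  (forall d, `|d| < e -> phi d <= c0) -> c2 <= 0.
Proof.
move=> e0 /expandsP[K [d0 [K0 d00 _ H]]] hm.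
rewrite leNgt; apply/negP => c20.
pose d := Num.min (Num.min d0 e) (c2 / K) / 2.
have m0 : 0 < Num.min (Num.min d0 e) (c2 / K) by rewrite !lt_min d00 e0 divr_gt0.
have dp : 0 < d by rewrite divr_gt0.
have dm : d < Num.min (Num.min d0 e) (c2 / K) by rewrite /d; lra.
move: (dm); rewrite !lt_min => /andP[/andP[dd0 de] dK].
have dK' : K * d < c2 by rewrite mulrC -ltr_pdivlMr.
have nd : `|d| = d by rewrite gtr0_norm.
have nd' : `|- d| = d by rewrite normrN gtr0_norm.
have := H d; rewrite nd => /(_ dd0); rewrite ler_norml => /andP[h1 _].
have := H (- d); rewrite nd' => /(_ dd0); rewrite ler_norml => /andP[h2 _].
have := hm d; rewrite nd => /(_ de) m1.
have := hm (- d); rewrite nd' => /(_ de) m2.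
have p1 : (c2 - K * d) * d ^+ 2 <= - c1 * d.
  by move: h1 m1; rewrite exprSr; lra.
have p2 : (c2 - K * d) * d ^+ 2 <= c1 * d.
  by move: h2 m2; rewrite sqrrN exprSr; lra.
have : 0 < (c2 - K * d) * d ^+ 2 by rewrite mulr_gt0 ?subr_gt0 ?exprn_gt0.
by move: p1 p2; rewrite mulNr; lra.
Qed.

Lemma expands_derive (phi : R -> R) (t c1 c2 : R) :
  expands (fun d => phi (t + d)) (phi t) c1 c2 -> is_derive t 1 phi c1.
Proof.
move=> /expandsP[K [d0 [K0 d00 d01 H]]].
have cv : h^-1 *: (phi (h *: 1 + t) - phi t) @[h --> (0:R)^'] --> c1.
  apply/cvgrPdist_le => e e0.
  have M0 : 0 < K + `|c2| + 1 by rewrite -addrA ltr_pwDl// ?addr_ge0.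
  near=> h; have hn0 : h != 0 by near: h; exact: nbhs_dnbhs_neq.
  have hd : `|h| < Num.min d0 (e / (K + `|c2| + 1)).
    by near: h; apply: dnbhs0_lt; rewrite lt_min d00 divr_gt0.
  move: hd; rewrite lt_min => /andP[hd he].
  have h1 : `|h| <= 1 by apply/ltW/(lt_le_trans hd).
  have := H h hd; rewrite [t + h]addrC /GRing.scale /= mulr1 => Hh.
  have hp : 0 < `|h| by rewrite normr_gt0.
  rewrite -(ler_pM2l hp) -normrM.
  rewrite (_ : h * _ = - (phi (h + t) - (phi t + c1 * h + c2 * h ^+ 2)) - c2 * h ^+ 2); last by field.
  apply: le_trans (ler_normB _ _) _; rewrite normrN normrM normrX.
  apply: (@le_trans _ _ (`|h| * ((K + `|c2| + 1) * `|h|))).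
    rewrite (_ : `|h| * _ = K * `|h| ^+ 2 + `|c2| * `|h| ^+ 2 + `|h| ^+ 2); last ring.
    rewrite -[leLHS]addr0 !lerD// ?exprn_ge0//; apply: (le_trans Hh).
    by rewrite ler_wpM2l ?(ltW K0)// exprS ler_piMl ?exprn_ge0.
  by rewrite ler_pM2l// mulrC -ler_pdivlMr// ltW.
have dv : derivable phi t 1 by apply/cvg_ex; exists c1.
apply: DeriveDef => //; exact: cvg_lim cv.
Unshelve. all: by end_near. Qed.

End SecondOrderExpansions.

(** * Expansions of the logarithm of the modulus of a polynomial *)

Section MaximumPrinciple.
Variable R : realType.
Local Notation C := (Cplx R).
Local Notation Re := (@complex.Re R).
Local Notation Im := (@complex.Im R).

Lemma poly_taylor2 (p : {poly C}) (z : C) : exists (b : C) (r : {poly C}),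
  forall h, p.[z + h] = p.[z] + p^`().[z] * h + b * h ^+ 2 + h ^+ 3 * r.[h].
Proof.
elim/poly_ind: p => [|p c [b [r H]]].
  by exists 0, 0 => h; rewrite deriv0 !horner0 !mul0r mulr0 !addr0.
exists (p^`().[z] + b * z), (r * ('X + z%:P) + b%:P) => h.
rewrite derivD derivM derivX derivC mulr1 addr0 !(hornerD, hornerM, hornerX, hornerC) H.
by ring.
Qed.

Lemma disc_bounded (r : {poly C}) (d : R) : exists2 M : R, 0 < M &
  forall h, cabs h <= d -> cabs r.[h] <= M.
Proof.
have [d0|d0] := ltP d 0.
  by exists 1 => // h /(le_trans (cabs_ge0 _)); rewrite leNgt d0.
have D0 : [set z : C | cabs z <= d] !=set0 by exists 0; rewrite /= cabs0.
have cr : continuous (fun z => cabs r.[z]).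
  by move=> z; apply: continuous_comp; [exact: horner_continuous|exact: cabs_continuous].
have [c _ cm] := compact_EVT_max D0 (@disc_compact R d) (continuous_subspaceT cr).
exists (cabs r.[c] + 1); first by rewrite ltr_wpDl ?cabs_ge0.
by move=> h hd; apply: le_trans (cm h (mem_set hd)) _; rewrite lerDl.
Qed.

Lemma Re_rcM (x : R) (z : C) : Re (rc x * z) = x * Re z.
Proof. by rewrite rc_mulC. Qed.
Lemma Im_rcM (x : R) (z : C) : Im (rc x * z) = x * Im z.
Proof. by rewrite rc_mulC. Qed.

(** The quantifier order matters: one [b] serves all directions [e], so that the terms in
    [b * e ^+ 2] cancel between the directions 1 and [i]. *)
Lemma expands_norm2 (p : {poly C}) (z : C) : exists b : C, forall e : C,
  expands (fun d => cabs p.[z + rc d * e] ^+ 2) (cabs p.[z] ^+ 2)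
    (2 * (Re p.[z] * Re (p^`().[z] * e) + Im p.[z] * Im (p^`().[z] * e)))
    (cabs (p^`().[z] * e) ^+ 2 + 2 * (Re p.[z] * Re (b * e ^+ 2) + Im p.[z] * Im (b * e ^+ 2))).
Proof.
have [b [r H]] := poly_taylor2 p z; exists b => e.
have [M M0 MP] := disc_bounded r (cabs e).
set a0 := p.[z]; set a1 := p^`().[z] * e; set a2 := b * e ^+ 2.
pose q d := p.[z + rc d * e].
have qE d : q d = a0 + rc d * a1 + rc (d ^+ 2) * a2 + rc (d ^+ 3) * (e ^+ 3 * r.[rc d * e]).
  by rewrite /q H /a0 /a1 /a2 !rcX; ring.
have bound (f : C -> R) : (forall w, `|f w| <= cabs w) -> (forall x y, f (x + y) = f x + f y) ->
    (forall x y, f (rc x * y) = x * f y) -> expands (fun d => f (q d)) (f a0) (f a1) (f a2).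
  move=> fle fD fM; exists (cabs (e ^+ 3) * M), 1; split=> // d d1.
  rewrite qE !fD !fM.
  rewrite (_ : _ - _ = d ^+ 3 * f (e ^+ 3 * r.[rc d * e])); last ring.
  rewrite normrM normrX mulrC ler_wpM2r ?exprn_ge0//.
  apply: le_trans (fle _) _; rewrite cabsM ler_wpM2l ?cabs_ge0//; apply: MP.
  by rewrite cabsM cabs_rc ler_piMl ?cabs_ge0// ltW.
have eR : expands (fun d => Re (q d)) (Re a0) (Re a1) (Re a2).
  by apply: bound; [exact: cabs_Re|exact: raddfD|exact: Re_rcM].
have eI : expands (fun d => Im (q d)) (Im a0) (Im a1) (Im a2).
  by apply: bound; [exact: cabs_Im|exact: raddfD|exact: Im_rcM].
have ee := expandsD (expandsM eR eR) (expandsM eI eI).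
rewrite !cabs_sq.
rewrite [X in expands _ X](_ : _ = Re a0 * Re a0 + Im a0 * Im a0); last by rewrite !expr2.
rewrite [X in expands _ _ X](_ : _ = Re a0 * Re a1 + Re a1 * Re a0 + (Im a0 * Im a1 + Im a1 * Im a0)); last ring.
rewrite [X in expands _ _ _ X](_ : _ = Re a0 * Re a2 + Re a1 * Re a1 + Re a2 * Re a0 +
  (Im a0 * Im a2 + Im a1 * Im a1 + Im a2 * Im a0)); last ring.
by apply: expands_ext ee => d; rewrite cabs_sq !expr2.
Qed.

Lemma expands_ln_norm2 (p : {poly C}) (z : C) : p.[z] != 0 -> exists B : C,
  forall e : C, expands (fun d => ln (cabs p.[z + rc d * e] ^+ 2)) (ln (cabs p.[z] ^+ 2))
    (2 * Re (p^`().[z] / p.[z] * e))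
    (cabs (p^`().[z] / p.[z] * e) ^+ 2 + 2 * Re (B * e ^+ 2) - 2 * Re (p^`().[z] / p.[z] * e) ^+ 2).
Proof.
move=> p0.
have c0 : 0 < cabs p.[z] ^+ 2 by rewrite exprn_gt0// cabs_gt0.
pose P := (p.[z])^-1 *: p.
have P1 : P.[z] = 1 by rewrite hornerZ mulVf.
have P' : P^`().[z] = p^`().[z] / p.[z] by rewrite derivZ hornerZ mulrC.
have [b E] := expands_norm2 P z; exists b => e.
have cP : 0 < cabs P.[z] ^+ 2 by rewrite P1 cabs1 expr1n.
have := expandsD (expands_ln cP (E e)) (expands_poly2 (ln (cabs p.[z] ^+ 2)) 0 0).
rewrite P1 cabs1 expr1n ln1 !divr1 /= !mul1r !mul0r !addr0 add0r P'.
set u := p^`().[z] / p.[z] * e; set w := b * e ^+ 2 => h.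
rewrite [X in expands _ _ _ X](_ : _ = cabs u ^+ 2 + 2 * Re w - (2 * Re u) ^+ 2 / 2); last by field.
have [K [d0 [K0 d00 pK]]] : exists K d0 : R, [/\ 0 < K, 0 < d0 & forall d, `|d| < d0 -> P.[z + rc d * e] != 0].
  have /contCC/(_ 1 ltr01) [d1 d10 d1P] := @horner_continuous R P z.
  exists 1, (d1 / (cabs e + 1)); split=> //.
    by rewrite divr_gt0// ltr_wpDl ?cabs_ge0.
  move=> d; rewrite ltr_pdivlMr ?ltr_wpDl ?cabs_ge0// => dd.
  have : cabs (P.[z + rc d * e] - P.[z]) < 1.
    apply: d1P; rewrite addrAC subrr add0r cabsM cabs_rc; apply: le_lt_trans dd.
    by rewrite ler_wpM2l// lerDl.
  by rewrite P1; case: eqP => // ->; rewrite sub0r cabsN cabs1 ltxx.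
apply: expands_near d00 _ h => d /pK Pd.
rewrite !mul0r !addr0 -lnM ?posrE ?exprn_gt0 ?cabs_gt0//.
by rewrite -exprMn -cabsM /P hornerZ mulrAC mulVf// mul1r.
Qed.

End MaximumPrinciple.

Section MaximumPrinciple2.
Variable R : realType.
Local Notation C := (Cplx R).
Local Notation Re := (@complex.Re R).
Local Notation Im := (@complex.Im R).

Lemma horner_neq0_near (p : {poly C}) (z : C) : p.[z] != 0 ->
  exists2 d : R, 0 < d & forall y, cabs (y - z) < d -> p.[y] != 0.
Proof.
rewrite -cabs_gt0 => p0; have /contCC/(_ _ p0) [d d0 dP] := @horner_continuous R p z.
exists d => // y /dP; rewrite cabsB => h; rewrite -cabs_gt0.
by have := cabs_sub p.[z] p.[y]; lra.
Qed.

(* The second-order coefficients of ln |p|^2 in the directions 1 and i cancel: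
   ln |p|^2 is harmonic away from the roots of p. *)
Lemma sum_directions (A B : C) :
  (cabs (A * 1) ^+ 2 + 2 * Re (B * 1 ^+ 2) - 2 * Re (A * 1) ^+ 2) +
  (cabs (A * 'i%C) ^+ 2 + 2 * Re (B * 'i%C ^+ 2) - 2 * Re (A * 'i%C) ^+ 2) = 0.
Proof.
rewrite ReiNIm sqrrN !mulr1 expr1n mulr1 (sqr_i R) mulrN1 raddfN.
by rewrite cabsM cabs_i mulr1 cabs_sq; ring.
Qed.

Lemma sum_Re_directions (A : C) :
  Re (A * 1) ^+ 2 + Re (A * 'i%C) ^+ 2 = cabs A ^+ 2.
Proof. by rewrite ReiNIm sqrrN mulr1 cabs_sq. Qed.

(** The sum is half the Laplacian of the logarithm of [1 + eta * |z|^2]. A positive [eta] perturbs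
    the maximum principle; [eta = -1] gives the density of the hyperbolic metric of the disc. *)
Lemma expands_ln_weight (eta : R) (z : C) : 0 < 1 + eta * cabs z ^+ 2 ->
  exists c : C -> R, [/\ forall e : C, exists c1, expands (fun d => ln (1 + eta * cabs (z + rc d * e) ^+ 2))
     (ln (1 + eta * cabs z ^+ 2)) c1 (c e) &
   c 1 + c 'i%C = 2 * eta / (1 + eta * cabs z ^+ 2) ^+ 2].
Proof.
set B := 1 + _ => B0.
pose c1 e := eta * (2 * (Re z * Re e + Im z * Im e)).
exists (fun e => eta * cabs e ^+ 2 / B - (c1 e / B) ^+ 2 / 2); split.
  move=> e; exists (c1 e / B); apply: expands_ln => //.
  apply: expands_ext (expands_poly2 _ _ _) => d.
  by rewrite /B /c1 !cabs_sq !raddfD /= !Re_rcM !Im_rcM; ring.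
rewrite /c1 cabs1 cabs_i.
have BE : B = 1 + eta * (Re z ^+ 2 + Im z ^+ 2) by rewrite /B cabs_sq.
have B0' : B != 0 by rewrite gt_eqF.
rewrite /= !mulr1 !mulr0 addr0 add0r !expr1n !mulr1.
by move: B0'; rewrite BE => B0'; field.
Qed.

Lemma closure_bounded (U : set C) (M : R) : (forall z, U z -> cabs z <= M) ->
  forall z, closure U z -> cabs z <= M.
Proof.
move=> UM z cz; rewrite leNgt; apply/negP => zM.
have e0 : 0 < cabs z - M by rewrite subr_gt0.
have [y /UM yM] := (closureCP U z).1 cz _ e0.
have := cabs_sub z y; rewrite cabsB; lra.
Qed.

(* Otherwise |P|^2 / |Q|^2 * (1 + eta |z|^2) has an interior maximum for a small
   eta > 0, although its logarithm is strictly subharmonic. *)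
Lemma max_principle (U : set C) (M : R) (P Q : {poly C}) : open U ->
  (forall z, U z -> cabs z <= M) -> (forall z, closure U z -> Q.[z] != 0) ->
  (forall z, closure U z -> ~ U z -> cabs P.[z] <= cabs Q.[z]) ->
  forall z, U z -> cabs P.[z] <= cabs Q.[z].
Proof.
move=> oU UM Q0 PQ z0 Uz0; rewrite leNgt; apply/negP => PQz0.
have cUM := closure_bounded UM.
have cU : compact (closure U).
  by apply: subclosed_compact (@disc_compact R M) _; [exact: closed_closure|].
have cz0 : closure U z0 by exact: subset_closure.
pose a := cabs Q.[z0] ^+ 2; pose b := cabs P.[z0] ^+ 2.
have a0 : 0 < a by rewrite exprn_gt0// cabs_gt0 Q0.
have ab : a < b by rewrite ltrXn2r ?cabs_ge0.
have M2 : 0 < M ^+ 2 + 1 by rewrite ltr_wpDl ?sqr_ge0.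
(* Small enough that the weight stays below the excess [b / a] attained at [z0], so the weighted
   quotient cannot be maximal on the boundary. *)
pose eta := (b / a - 1) / (M ^+ 2 + 1).
have ba1 : 1 < b / a by rewrite ltr_pdivlMr// mul1r.
have eta0 : 0 < eta by rewrite divr_gt0// subr_gt0.
have etaM : 1 + eta * M ^+ 2 < b / a.
  rewrite -ltrBrDl /eta mulrAC ltr_pdivrMr// ltr_pM2l ?subr_gt0//.
  by rewrite ltrDl.
pose w z := 1 + eta * cabs z ^+ 2.
have w1 z : 1 <= w z by rewrite /w lerDl mulr_ge0 ?(ltW eta0)// sqr_ge0.
have w0 z : 0 < w z by apply: lt_le_trans (w1 z).
have wM z : closure U z -> w z < b / a.
  move=> /cUM zM; apply: le_lt_trans etaM; rewrite lerD2l ler_wpM2l ?(ltW eta0)//.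
  by rewrite lerXn2r ?nnegrE ?cabs_ge0// (le_trans _ zM) ?cabs_ge0.
pose F z := cabs P.[z] ^+ 2 / cabs Q.[z] ^+ 2 * w z.
have cp (p : {poly C}) z : {for z, continuous (fun z => cabs p.[z] ^+ 2)}.
  have h : {for z, continuous (fun z => cabs p.[z])}.
    by apply: continuous_comp; [exact: horner_continuous|exact: cabs_continuous].
  exact: (@continuousM R C _ _ z h h).
have cF : {within closure U, continuous F}.
  apply: continuous_in_subspaceT => z /set_mem cz.
  apply: (@continuousM R C (fun z => cabs P.[z] ^+ 2 / cabs Q.[z] ^+ 2) w z).
    apply: (@continuousM R C (fun z => cabs P.[z] ^+ 2) (fun z => (cabs Q.[z] ^+ 2)^-1) z); first exact: cp.
    apply: continuousV; last exact: cp.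
    by rewrite expf_neq0// cabs_eq0 Q0.
  have h : {for z, continuous (fun z => eta * cabs z ^+ 2)}.
    apply: (@continuousM R C (cst eta) (fun z => cabs z ^+ 2) z); first exact: cst_continuous.
    exact: (@continuousM R C _ _ z (@cabs_continuous R z) (@cabs_continuous R z)).
  have h1 : {for z, continuous (cst 1 : C -> R)} by exact: cst_continuous.
  exact: (@continuousD R R C (cst 1) (fun z => eta * cabs z ^+ 2) z h1 h).
have [z1 /set_mem cz1 Fmax] := compact_EVT_max (ex_intro _ z0 cz0) cU cF.
have Fz0 : b / a <= F z1.
  apply: le_trans (Fmax z0 (mem_set cz0)).
  by rewrite /F -/a -/b ler_peMr ?w1// ltW// (lt_trans ltr01).
have Uz1 : U z1.
  apply: contrapT => nU; move: Fz0; rewrite leNgt => /negP; apply.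
  apply: le_lt_trans (wM z1 cz1); rewrite /F ler_piMl ?(ltW (w0 _))//.
  rewrite ler_pdivrMr ?mul1r ?exprn_gt0 ?cabs_gt0 ?Q0//.
  by rewrite lerXn2r ?nnegrE ?cabs_ge0// PQ.
have P1 : P.[z1] != 0.
  apply/eqP => h; move: Fz0; rewrite /F h cabs0 expr0n /= !mul0r leNgt.
  by rewrite (lt_trans ltr01).
have Q1 : Q.[z1] != 0 by exact: Q0.
have [r1 r10 r1P] := (openCP U).1 oU z1 Uz1.
have [r2 r20 r2P] := horner_neq0_near P1.
have [B1 E1] := expands_ln_norm2 P1.
have [B2 E2] := expands_ln_norm2 Q1.
have [c [E3 sc]] := expands_ln_weight (w0 z1).
have lnF z : U z -> P.[z] != 0 ->
    ln (cabs P.[z] ^+ 2) + (-1) * ln (cabs Q.[z] ^+ 2) + ln (w z) = ln (F z).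
  move=> Uz Pz; have Qz : Q.[z] != 0 by apply/Q0/subset_closure.
  by rewrite mulN1r /F lnM ?ln_div ?posrE ?divr_gt0 ?exprn_gt0 ?cabs_gt0.
have F0 z : closure U z -> P.[z] != 0 -> 0 < F z.
  move=> cz Pz; have Qz := Q0 z cz.
  by apply: mulr_gt0 (w0 z); apply: divr_gt0; apply: exprn_gt0; rewrite cabs_gt0.
have key (e : C) : cabs e = 1 ->
    (cabs (P^`().[z1] / P.[z1] * e) ^+ 2 + 2 * Re (B1 * e ^+ 2) - 2 * Re (P^`().[z1] / P.[z1] * e) ^+ 2)
    + (-1) * (cabs (Q^`().[z1] / Q.[z1] * e) ^+ 2 + 2 * Re (B2 * e ^+ 2) - 2 * Re (Q^`().[z1] / Q.[z1] * e) ^+ 2)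
    + c e <= 0.
  move=> e1; have [c1 E3e] := E3 e.
  have E := expandsD (expandsD (E1 e) (expandsZ (-1) (E2 e))) E3e.
  apply: (expands_max (_ : 0 < Num.min r1 r2) E); first by rewrite lt_min r10.
  move=> d; rewrite lt_min => /andP[d1 d2].
  have hd : cabs (z1 + rc d * e - z1) = `|d|.
    by rewrite addrAC subrr add0r cabsM cabs_rc e1 mulr1.
  have Uz : U (z1 + rc d * e) by apply: r1P; rewrite hd.
  have Pz : P.[z1 + rc d * e] != 0 by apply: r2P; rewrite hd.
  rewrite -!/(w _) !lnF// ler_ln ?posrE.
  - by apply: Fmax; apply/mem_set/subset_closure.
  - exact: F0 (subset_closure Uz) Pz.
  - exact: F0 cz1 P1.
(* Summing the two directions removes [P] and [Q], and only the positive contribution of the weight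
   is left. *)
have := lerD (key 1 (@cabs1 R)) (key _ (@cabs_i R)); rewrite addr0.
have := sum_directions (P^`().[z1] / P.[z1]) B1.
have := sum_directions (Q^`().[z1] / Q.[z1]) B2.
have : 0 < c 1 + c 'i%C.
  by rewrite sc; apply: divr_gt0; [exact: mulr_gt0|apply: exprn_gt0; exact: w0].
lra.
Qed.

End MaximumPrinciple2.

(** * A Schwarz-Pick inequality for maps from the unit disc to the exterior of the unit disc *)

Section Harnack.
Variable R : realType.
Local Notation C := (Cplx R).
Local Notation Re := (@complex.Re R).
Local Notation Im := (@complex.Im R).

Lemma continuous_cabs_horner (p : {poly C}) : continuous (fun z => cabs p.[z]).
Proof.
move=> z; apply: continuous_comp; [exact: horner_continuous|exact: cabs_continuous].
Qed.

Lemma closed_disc_compact (c : C) (r : R) : compact [set z : C | cabs (z - c) <= r].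
Proof.
apply: (subclosed_compact _ (@disc_compact R (cabs c + r))).
  apply: (@closed_comp _ _ (fun z => cabs (z - c)) [set y | y <= r]); last exact: closed_le.
  have e : (fun z => cabs (z - c)) = (fun z => cabs ('X - c%:P : {poly C}).[z]).
    by apply/funext => w; rewrite !hornerE.
  by rewrite e => w _; exact: continuous_cabs_horner.
by move=> w /= wr; have := cabs_sub w c; lra.
Qed.

Lemma continuous_mulR (f g : C -> R) z : {for z, continuous f} -> {for z, continuous g} ->
  {for z, continuous (fun z => f z * g z)}.
Proof. move=> cf cg; exact: (@continuousM R C f g z cf cg). Qed.

Lemma continuous_sqr (f : C -> R) z : {for z, continuous f} ->
  {for z, continuous (fun z => f z ^+ 2)}.
Proof. move=> cf; exact: (continuous_mulR cf cf). Qed.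

Lemma continuous_ln_norm2 (q : {poly C}) z : q.[z] != 0 ->
  {for z, continuous (fun z => ln (cabs q.[z] ^+ 2))}.
Proof.
move=> qz; apply: (@continuous_comp _ _ _ (fun z => cabs q.[z] ^+ 2) (@ln R)).
  by apply: continuous_sqr; exact: continuous_cabs_horner.
by apply: continuous_ln; rewrite exprn_gt0// cabs_gt0.
Qed.

(* The Ahlfors-Schwarz argument: with v = ln |q|^2, at a maximum of
   |q'/q| (1 - |z|^2) / v the second-order coefficients of its logarithm in the
   directions 1 and i have a sum that is at most 0; this is the inequality. *)
Lemma log_gradient (q : {poly C}) : (forall z, cabs z <= 1 -> 1 < cabs q.[z]) ->
  forall z, cabs z < 1 ->
  cabs (q^`().[z] / q.[z]) * (1 - cabs z ^+ 2) <= ln (cabs q.[z] ^+ 2).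
Proof.
move=> q1 z0 z01; rewrite leNgt; apply/negP => bad.
pose D := [set z : C | cabs z <= 1].
pose v z := ln (cabs q.[z] ^+ 2).
have qn z : D z -> q.[z] != 0 by move=> /q1 h; rewrite -cabs_gt0 (lt_trans ltr01).
have v0 z : D z -> 0 < v z by move=> /q1 h; apply: ln_gt0; rewrite exprn_egt1.
pose w z : R := 1 + (-1) * cabs z ^+ 2.
pose F z := cabs q^`().[z] ^+ 2 / cabs q.[z] ^+ 2 * w z ^+ 2 / v z ^+ 2.
have cF : {within D, continuous F}.
  apply: continuous_in_subspaceT => z /set_mem Dz; apply: continuous_mulR.
    apply: continuous_mulR.
      apply: continuous_mulR; first by apply: continuous_sqr; exact: continuous_cabs_horner.
      apply: continuousV; last by apply: continuous_sqr; exact: continuous_cabs_horner.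
      by rewrite expf_neq0// cabs_eq0 qn.
    apply: continuous_sqr.
    have h : {for z, continuous (fun z => (-1) * cabs z ^+ 2)}.
      apply: (@continuous_mulR (cst (-1)) (fun z => cabs z ^+ 2)); first exact: cst_continuous.
      by apply: continuous_sqr; exact: cabs_continuous.
    have h1 : {for z, continuous (cst 1 : C -> R)} by exact: cst_continuous.
    exact: (@continuousD R R C (cst 1) (fun z => (-1) * cabs z ^+ 2) z h1 h).
  apply: continuousV; first by rewrite expf_neq0// gt_eqF// v0.
  by apply: continuous_sqr; apply: continuous_ln_norm2; exact: qn.
have Dz0 : D z0 by exact: ltW.
have [z1 /set_mem D1 Fmax] := compact_EVT_max (ex_intro _ z0 Dz0) (@disc_compact R 1) cF.
have w0 z : cabs z < 1 -> 0 < w z.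
  by move=> h; rewrite /w mulN1r subr_gt0 exprn_ilt1 ?cabs_ge0.
have Fz0 : 1 < F z0.
  rewrite /F ltr_pdivlMr ?exprn_gt0 ?v0// mul1r -expr_div_n -exprMn.
  rewrite ltrXn2r ?nnegrE ?ltW ?v0//.
  by move: bad; rewrite -mulN1r -/(v z0) -/(w z0) cabsM cabsV.
have Fz1 : 1 < F z1 by apply: lt_le_trans Fz0 (Fmax z0 (mem_set Dz0)).
(* The weight [w] vanishes on the circle while the maximum of [F] exceeds 1; likewise [q'] cannot
   vanish at [z1]. *)
have z11 : cabs z1 < 1.
  rewrite lt_neqAle D1 andbT; apply/eqP => h; move: Fz1.
  by rewrite /F /w h expr1n mulr1 subrr expr0n/= mulr0 mul0r ltNge ler01.
have q'1 : q^`().[z1] != 0.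
  by apply/eqP => h; move: Fz1; rewrite /F h cabs0 expr0n/= !mul0r ltNge ler01.
have q1n : q.[z1] != 0 := qn z1 D1.
have w1 := w0 z1 z11.
have v1 := v0 z1 D1.
have [r2 r20 r2P] := horner_neq0_near q'1.
have [B1 E1] := expands_ln_norm2 q'1.
have [B2 E2] := expands_ln_norm2 q1n.
have [c [E3 sc]] := expands_ln_weight w1.
have F0 z : cabs z < 1 -> q^`().[z] != 0 -> 0 < F z.
  move=> z1' Pz; have Dz : D z by exact: ltW.
  have Qz := qn z Dz; have vz := v0 z Dz; have wz := w0 z z1'.
  by apply: divr_gt0; [apply: mulr_gt0; [apply: divr_gt0|]|]; apply: exprn_gt0; rewrite ?cabs_gt0.
have lnF z : cabs z < 1 -> q^`().[z] != 0 ->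
    ln (cabs q^`().[z] ^+ 2) + (-1) * ln (cabs q.[z] ^+ 2) + 2 * ln (w z) + (-2) * ln (v z) = ln (F z).
  move=> z1' Pz; have Dz : D z by exact: ltW.
  have Qz := qn z Dz; have vz := v0 z Dz; have wz := w0 z z1'.
  have h1 : 0 < cabs q^`().[z] ^+ 2 by apply: exprn_gt0; rewrite cabs_gt0.
  have h2 : 0 < cabs q.[z] ^+ 2 by apply: exprn_gt0; rewrite cabs_gt0.
  have h3 : 0 < w z ^+ 2 by apply: exprn_gt0.
  have h4 : 0 < v z ^+ 2 by apply: exprn_gt0.
  have h12 := divr_gt0 h1 h2; have h123 := mulr_gt0 h12 h3.
  have -> : ln (F z) = ln (cabs q^`().[z] ^+ 2 / cabs q.[z] ^+ 2 * w z ^+ 2) - ln (v z ^+ 2).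
    by apply: ln_div; rewrite posrE.
  have -> : ln (cabs q^`().[z] ^+ 2 / cabs q.[z] ^+ 2 * w z ^+ 2) =
      ln (cabs q^`().[z] ^+ 2 / cabs q.[z] ^+ 2) + ln (w z ^+ 2).
    by apply: lnM; rewrite posrE.
  have -> : ln (cabs q^`().[z] ^+ 2 / cabs q.[z] ^+ 2) =
      ln (cabs q^`().[z] ^+ 2) - ln (cabs q.[z] ^+ 2).
    by apply: ln_div; rewrite posrE.
  by rewrite (lnXn 2 wz) (lnXn 2 vz) -(mulr_natl (ln (w z))) -(mulr_natl (ln (v z))); ring.
set A := q^`().[z1] / q.[z1] in E2 *.
(* [L2] and [L1] are the second-order coefficients of [ln |q|^2] and [ln |q'|^2]; both are harmonic
   near [z1], so each sums to 0 over the two directions. *)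
pose L2 e := cabs (A * e) ^+ 2 + 2 * Re (B2 * e ^+ 2) - 2 * Re (A * e) ^+ 2.
pose L1 e := cabs (q^`()^`().[z1] / q^`().[z1] * e) ^+ 2 + 2 * Re (B1 * e ^+ 2) - 2 * Re (q^`()^`().[z1] / q^`().[z1] * e) ^+ 2.
pose V := v z1.
have key (e : C) : cabs e = 1 ->
    L1 e + (-1) * L2 e + 2 * c e + (-2) * (L2 e / V - (2 * Re (A * e) / V) ^+ 2 / 2) <= 0.
  move=> e1; have [c1 E3e] := E3 e.
  have E := expandsD (expandsD (expandsD (E1 e) (expandsZ (-1) (E2 e))) (expandsZ 2 E3e))
    (expandsZ (-2) (expands_ln v1 (E2 e))).
  have r1 : 0 < 1 - cabs z1 by rewrite subr_gt0.
  apply: (expands_max (_ : 0 < Num.min (1 - cabs z1) r2) E); first by rewrite lt_min r1.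
  move=> d; rewrite lt_min => /andP[d1 d2].
  have hd : cabs (z1 + rc d * e - z1) = `|d|.
    by rewrite addrAC subrr add0r cabsM cabs_rc e1 mulr1.
  have Uz : cabs (z1 + rc d * e) < 1.
    by have := cabs_sub (z1 + rc d * e) z1; rewrite hd; lra.
  have Pz : q^`().[z1 + rc d * e] != 0 by apply: r2P; rewrite hd.
  rewrite -!/(w _) -!/(v _) !lnF// ler_ln ?posrE; [|exact: F0|exact: F0].
  by apply: Fmax; apply/mem_set/ltW.
have h := lerD (key 1 (@cabs1 R)) (key _ (@cabs_i R)); rewrite addr0 in h.
have s1 : L1 1 + L1 'i%C = 0 := sum_directions _ B1.
have s2 : L2 1 + L2 'i%C = 0 := sum_directions A B2.
have s3 := sum_Re_directions A.
have V0 : V != 0 by rewrite gt_eqF.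
have : (L1 1 + L1 'i%C) - (L2 1 + L2 'i%C) + 2 * (c 1 + c 'i%C)
  - 2 * ((L2 1 + L2 'i%C) / V) + 4 * (Re (A * 1) ^+ 2 + Re (A * 'i%C) ^+ 2) / V ^+ 2 <= 0.
  apply: le_trans h; rewrite le_eqVlt; apply/orP; left; apply/eqP.
  move: (L1 1) (L1 'i%C) (L2 1) (L2 'i%C) (c 1) (c 'i%C) (Re (A * 1)) (Re (A * 'i%C)) => *.
  by field.
rewrite s1 s2 s3 sc -/(w z1) mul0r mulr0 !subr0 add0r leNgt => /negP; apply.
have AF : F z1 = cabs A ^+ 2 * w z1 ^+ 2 / V ^+ 2.
  by rewrite /F /A cabsM cabsV exprMn exprVn.
have w2 : 0 < w z1 ^+ 2 by rewrite exprn_gt0.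
(* The surviving terms are the curvature of the weight and the gradient of [ln v]; together they
   have the sign of [F z1 - 1]. *)
rewrite (_ : _ + _ = 4 / w z1 ^+ 2 * (F z1 - 1)); last first.
  by rewrite AF; field; rewrite V0 gt_eqF.
by apply: mulr_gt0; [apply: divr_gt0|rewrite subr_gt0].
Qed.

End Harnack.

(** * Harnack and Schwarz inequalities *)

Section HarnackSchwarz.
Variable R : realType.
Local Notation C := (Cplx R).
Local Notation Re := (@complex.Re R).
Local Notation Im := (@complex.Im R).

(** [log_gradient] is integrated along the segment from 0 to [y]: the derivative of [ln (ln |q|^2)]
    there is at most 2, since [|y| <= 1/2] is below [1 - |t y|^2]. This is the origin of
    [expR 2]. *)
Lemma harnack_unit (q : {poly C}) : (forall z, cabs z <= 1 -> 1 < cabs q.[z]) ->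
  forall y, cabs y <= 2^-1 -> ln (cabs q.[y]) <= expR 2 * ln (cabs q.[0]).
Proof.
move=> q1 y y2.
pose v z := ln (cabs q.[z] ^+ 2).
have qn z : cabs z <= 1 -> q.[z] != 0 by move=> /q1 h; rewrite -cabs_gt0 (lt_trans ltr01).
have v0 z : cabs z <= 1 -> 0 < v z by move=> /q1 h; apply: ln_gt0; rewrite exprn_egt1.
pose phi (t : R) := ln (v (rc t * y)).
pose dphi (t : R) := 2 * Re (q^`().[rc t * y] / q.[rc t * y] * y) / v (rc t * y).
have small (t : R) : 0 <= t <= 1 -> cabs (rc t * y) <= 2^-1.
  move=> /andP[t0 t1]; apply: le_trans y2; rewrite cabsM cabs_rc ger0_norm//.
  by rewrite ler_piMl ?cabs_ge0.
have h21 : (2^-1 : R) <= 1 by lra.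
have D (t : R) : 0 <= t <= 1 -> is_derive t 1 phi (dphi t).
  move=> t01; have zt := le_trans (small t t01) h21.
  have [B E] := expands_ln_norm2 (qn _ zt).
  have E2 := expands_ln (v0 _ zt) (E y).
  apply: expands_derive; apply: expands_ext E2 => d.
  by rewrite /phi /v rcD mulrDl.
have dle (t : R) : 0 <= t <= 1 -> dphi t <= 2.
  move=> t01; have zt := small t t01; have zt1 := le_trans zt h21.
  have vt := v0 _ zt1.
  have := log_gradient q1 (le_lt_trans zt (_ : 2^-1 < 1)).
  rewrite -/(v _) => /(_ _)/wrap[]; first lra.
  move=> g.
  rewrite /dphi ler_pdivrMr// ler_pM2l//.
  apply: le_trans (ler_norm _) _; apply: le_trans (cabs_Re _) _.
  rewrite cabsM; apply: le_trans g; rewrite ler_wpM2l ?cabs_ge0//.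
  apply: (le_trans y2); have : cabs (rc t * y) ^+ 2 <= 2^-1 ^+ 2.
    by rewrite lerXn2r ?nnegrE ?cabs_ge0.
  lra.
have cphi : {within `[0, 1], continuous phi}.
  apply: derivable_within_continuous => t; rewrite in_itv /= => t01.
  by have [] := D t t01.
have Di (t : R) : t \in `]0, 1[%R -> is_derive t 1 phi (dphi t).
  by rewrite in_itv /= => /andP[t0 t1]; apply: D; rewrite !ltW.
have [t] := MVT ltr01 Di cphi.
rewrite in_itv /= subr0 mulr1 => /andP[t0 t1] e.
have t01 : 0 <= t <= 1 by rewrite !ltW.
have := dle t t01; rewrite -e /phi rc1 mul1r rc0 mul0r => h.
have y1 : cabs y <= 1 := le_trans y2 h21.
have c01 : cabs (0 : C) <= 1 by rewrite cabs0.
have h3 : v y <= expR 2 * v 0.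
  rewrite -ler_ln ?posrE ?mulr_gt0 ?expR_gt0 ?v0// lnM ?posrE ?expR_gt0 ?v0// expRK.
  lra.
move: h3; rewrite /v !(lnXn 2) ?(lt_trans ltr01) ?q1//.
by rewrite mulrnAr lerMn2r.
Qed.

Lemma harnack (q : {poly C}) (z0 : C) (r : R) : 0 < r ->
  (forall z, cabs (z - z0) <= r -> 1 < cabs q.[z]) ->
  forall y, cabs (y - z0) <= r / 2 -> ln (cabs q.[y]) <= expR 2 * ln (cabs q.[z0]).
Proof.
move=> r0 q1 y yr.
have rn : rc r != 0 by rewrite rc_eq0 gt_eqF.
pose Q := q \Po (rc r *: 'X + z0%:P).
have QE z : Q.[z] = q.[rc r * z + z0] by rewrite horner_comp hornerD hornerZ hornerX hornerC.
have := @harnack_unit Q _ (rc r^-1 * (y - z0)) _; rewrite !QE mulr0 add0r.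
rewrite mulrA -rcM divff ?gt_eqF// rc1 mul1r subrK; apply.
  move=> z z1; rewrite QE; apply: q1; rewrite addrK cabsM cabs_rc gtr0_norm//.
  by rewrite ler_piMr// ltW.
by rewrite cabsM cabs_rc gtr0_norm ?invr_gt0// mulrC ler_pdivrMr// mulrC.
Qed.

(** The difference quotient at [z0] is a polynomial, at most [2 * B / r] on the circle of radius
    [r]; the maximum principle compares it with that constant. *)
Lemma schwarz (g : {poly C}) (z0 : C) (r B : R) : 0 < r -> 0 < B ->
  (forall z, cabs (z - z0) <= r -> cabs g.[z] <= B) ->
  forall y, cabs (y - z0) < r -> cabs (g.[y] - g.[z0]) <= 2 * B / r * cabs (y - z0).
Proof.
move=> r0 B0 gB y yr.
have /factor_theorem [Q Qe] : root (g - g.[z0]%:P) z0 by rewrite rootE !hornerE subrr.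
have QE z : g.[z] - g.[z0] = Q.[z] * (z - z0).
  by have := congr1 (horner^~ z) Qe; rewrite !hornerE.
pose U := [set z : C | cabs (z - z0) < r].
have k0 : 0 < 2 * B / r by rewrite !mulr_gt0// invr_gt0.
have cU z : closure U z -> cabs (z - z0) <= r.
  move=> cz; rewrite leNgt; apply/negP => zr.
  have e0 : 0 < cabs (z - z0) - r by rewrite subr_gt0.
  have [w Uw wz] := (closureCP U z).1 cz _ e0.
  by have := cabs_tri z z0 w; rewrite (cabsB z w); move: Uw; rewrite /U /=; lra.
have := @max_principle R U (cabs z0 + r) Q (rc (2 * B / r))%:P _ _ _ _ y yr.
rewrite hornerC cabs_rc (gtr0_norm k0) => h; rewrite QE cabsM ler_wpM2r ?cabs_ge0//; apply: h.
- apply/openCP => z Uz; exists (r - cabs (z - z0)); first by rewrite subr_gt0.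
  by move=> w wz; rewrite /U /=; have := cabs_tri w z0 z; lra.
- by move=> z Uz; have := cabs_subD z z0; have := cabs_sub z z0; move: Uz; rewrite /U /=; lra.
- by move=> z _; rewrite hornerC rc_eq0 gt_eqF.
- move=> z /cU zr Uz; rewrite hornerC cabs_rc (gtr0_norm k0).
  have zr' : cabs (z - z0) = r by apply/eqP; rewrite eq_le zr leNgt; apply/negP.
  rewrite -(ler_pM2r r0) -{1}zr' -cabsM -QE divfK ?gt_eqF//.
  apply: le_trans (cabsBD _ _) _; rewrite mulr2n mulrDl mul1r lerD ?gB// subrr cabs0 ltW//.
Qed.

Lemma continuous_invC (z : C) : z != 0 -> {for z, continuous (fun w : C => w^-1)}.
Proof. by move=> z0; apply: (@continuousV C C id z). Qed.

Definition revpoly (N : nat) (p : {poly C}) : {poly C} := \poly_(i < N.+1) p`_(N - i).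

Lemma revpoly0 N p : (revpoly N p).[0] = p`_N.
Proof. by rewrite horner_coef0 coef_poly /= subn0. Qed.

Lemma revpolyE N (p : {poly C}) w : (size p <= N.+1)%N -> w != 0 ->
  (revpoly N p).[w] = w ^+ N * p.[w^-1].
Proof.
move=> sp w0; rewrite horner_poly (horner_coef_wide _ sp) mulr_sumr.
rewrite (reindex_inj rev_ord_inj) /=; apply: eq_bigr => i _.
have iN : (i <= N)%N by rewrite -ltnS.
rewrite subSS subKn// [RHS]mulrCA; congr (_ * _).
have -> : w ^+ N = w ^+ (N - i) * w ^+ i by rewrite -exprD subnK.
by rewrite exprVn mulfK ?expf_neq0.
Qed.

(* The maximum principle in the coordinate 1/z, in which [revpoly N P] is z^N P(1/z). *)
Lemma exterior_max (U : set C) (r0 r1 c : R) (N : nat) (P Q : {poly C}) : open U ->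
  0 < r0 -> 0 < c -> (forall z, U z -> r0 <= cabs z) -> (forall z, r1 <= cabs z -> U z) ->
  (size P <= N.+1)%N -> size Q = N.+1 ->
  (forall z, closure U z -> Q.[z] != 0) ->
  (forall z, closure U z -> ~ U z -> cabs P.[z] <= c * cabs Q.[z]) ->
  (forall z, U z -> cabs P.[z] <= c * cabs Q.[z]) /\ cabs P`_N <= c * cabs Q`_N.
Proof.
move=> oU r00 c0 Ur0 Ur1 sP sQ Q0 PQ.
have sQ' : (size Q <= N.+1)%N by rewrite sQ.
have QN : Q`_N != 0 by rewrite -[N]/(N.+1.-1) -sQ -/(lead_coef Q) lead_coef_eq0 -size_poly_eq0 sQ.
(* The image of [U] and of infinity under inversion; as 0 is not in [U], the convention [0^-1 = 0]
   adds nothing. *)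
pose V := [set w : C | w = 0 \/ U w^-1].
pose Q1 := rc c *: revpoly N Q.
have Q1E w : w != 0 -> Q1.[w] = w ^+ N * (rc c * Q.[w^-1]).
  by move=> w0; rewrite hornerZ revpolyE// mulrCA.
have r1' : 0 < `|r1| + 1 by rewrite ltr_wpDl.
have oV : open V.
  apply/openCP => w [->|Uw].
    exists (`|r1| + 1)^-1; first by rewrite invr_gt0.
    move=> y; rewrite subr0 => yr; have [->|y0] := eqVneq y 0; first by left.
    right; apply: Ur1; rewrite cabsV; apply: le_trans (ler_norm _) _.
    apply: (@le_trans _ _ (`|r1| + 1)); first by rewrite lerDl.
    by rewrite -[leLHS]invrK lef_pV2 ?posrE ?cabs_gt0 ?invr_gt0// ltW.
  have w0 : w != 0.
    by apply/eqP => h; have := Ur0 _ Uw; rewrite h invr0 cabs0 leNgt r00.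
  have [e e0 eP] := (openCP U).1 oU _ Uw.
  have /contCC/(_ e e0) [d d0 dP] := continuous_invC w0.
  by exists d => // y /dP /eP; right.
have V0 w : V w -> cabs w <= r0^-1.
  move=> [->|/Ur0]; first by rewrite cabs0 invr_ge0 ltW.
  have [->|w0] := eqVneq w 0; first by rewrite cabs0 invr_ge0 (ltW r00).
  by rewrite cabsV => h; rewrite -[leLHS]invrK lef_pV2 ?posrE ?invr_gt0 ?cabs_gt0.
have clV w : w != 0 -> closure V w -> closure U w^-1.
  move=> w0 cw; apply/closureCP => e e0.
  have /contCC/(_ e e0) [d d0 dP] := continuous_invC w0.
  have dw : 0 < Num.min d (cabs w) by rewrite lt_min d0 cabs_gt0.
  have [y Vy] := (closureCP V w).1 cw _ dw; rewrite lt_min => /andP[yd yw].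
  exists y^-1; last exact: dP.
  case: Vy => // y0; move: yw; rewrite y0 sub0r cabsN ltxx//.
have H := @max_principle R V r0^-1 (revpoly N P) Q1 oV V0.
have {}H : forall w, V w -> cabs (revpoly N P).[w] <= cabs Q1.[w].
  apply: H => [w cw|w cw nV].
    have [->|w0] := eqVneq w 0; first by rewrite hornerZ revpoly0 mulf_neq0// rc_eq0 gt_eqF.
    rewrite Q1E//; apply: mulf_neq0; first by rewrite expf_neq0.
    apply: mulf_neq0; first by rewrite rc_eq0 gt_eqF.
    exact: Q0 (clV w w0 cw).
  have w0 : w != 0 by apply/eqP => h; apply: nV; left.
  rewrite Q1E// revpolyE// cabsM [leRHS]cabsM ler_wpM2l ?cabs_ge0// cabsM cabs_rc gtr0_norm//.
  by apply: PQ; [exact: clV|move=> Uw; apply: nV; right].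
split.
  move=> z Uz; have z0 : z != 0.
    by apply/eqP => h; have := Ur0 _ Uz; rewrite h cabs0 leNgt r00.
  have := H z^-1; rewrite Q1E ?invr_eq0// revpolyE ?invr_eq0// invrK => /(_ _)/wrap[].
    by right; rewrite invrK.
  rewrite cabsM [leRHS]cabsM ler_pM2l ?cabs_gt0 ?expf_neq0 ?invr_eq0//.
  by rewrite cabsM cabs_rc gtr0_norm.
(* The value at 0 of a reversed polynomial is its coefficient of index [N]: this is the comparison
   at infinity. *)
have := H 0 (or_introl erefl).
by rewrite revpoly0 hornerZ revpoly0 cabsM cabs_rc gtr0_norm.
Qed.

End HarnackSchwarz.

(** * Preimages under quadratic polynomials *)

Section Quadratics.
Variable R : realType.
Local Notation C := (Cplx R).
Implicit Types (p h : {poly C}).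

Definition crit p : C := - p`_1 / (2 * p`_2).

Lemma quadE p z : size p = 3%N -> p.[z] = p`_2 * (z - crit p) ^+ 2 + p.[crit p].
Proof.
move=> sp; have a0 : p`_2 != 0 by rewrite -[2%N]/(3.-1)%N -sp -/(lead_coef p) lead_coef_eq0 -size_poly_eq0 sp.
rewrite !horner_coef sp !big_ord_recl !big_ord0 /= /crit /bump /= !addn0 ?add0n ?addn1.
by field.
Qed.

Lemma quad_lead p : size p = 3%N -> p`_2 != 0.
Proof.
by move=> sp; rewrite -[2%N]/(3.-1)%N -sp -/(lead_coef p) lead_coef_eq0 -size_poly_eq0 sp.
Qed.

Lemma quad_sub p z w : size p = 3%N ->
  p.[z] - p.[w] = p`_2 * (z - w) * (z - (2 * crit p - w)).
Proof. by move=> sp; rewrite (quadE z sp) (quadE w sp); ring. Qed.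

Lemma quad_sym p z : size p = 3%N -> p.[2 * crit p - z] = p.[z].
Proof. by move=> sp; apply/eqP; rewrite -subr_eq0 quad_sub// subrr mulr0. Qed.

Lemma quad_fiber p z w : size p = 3%N -> p.[z] = p.[w] -> z = w \/ z = 2 * crit p - w.
Proof.
move=> sp /eqP; rewrite -subr_eq0 quad_sub// !mulf_eq0 (negbTE (quad_lead sp)) /=.
by rewrite !subr_eq0 => /orP[]/eqP; [left|right].
Qed.

(** A quantitative open mapping property: of the two preimages of [w], the one nearer to [z0] is no
    farther from [z0] than from the mirror image of [z0]. *)
Lemma quad_open_at p z0 w : size p = 3%N ->
  exists2 z, p.[z] = w & cabs p`_2 * cabs (z - z0) ^+ 2 <= cabs (w - p.[z0]).
Proof.
move=> sp; have a0 := quad_lead sp.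
pose z := crit p + sqrtC ((w - p.[crit p]) / p`_2).
have zw : p.[z] = w.
  by rewrite (quadE z sp) /z addrAC subrr add0r sqrtCK mulrC divfK// subrK.
have := quad_sub z z0 sp; rewrite zw => e.
have c1 : cabs (2 * crit p - z - z0) = cabs (z - (2 * crit p - z0)).
  by rewrite cabsB; congr cabs; ring.
have [le|/ltW le] := leP (cabs (z - z0)) (cabs (z - (2 * crit p - z0))).
  exists z => //; rewrite e !cabsM expr2 -mulrA ler_wpM2l ?cabs_ge0//.
  by rewrite ler_wpM2l ?cabs_ge0.
exists (2 * crit p - z); first by rewrite quad_sym.
rewrite e !cabsM expr2 c1 -mulrA ler_wpM2l ?cabs_ge0//.
by rewrite ler_wpM2r ?cabs_ge0.
Qed.

Lemma quad_open p (O : set C) : size p = 3%N -> open O -> open (horner p @` O).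
Proof.
move=> sp /openCP oO; apply/openCP => _ [z0 Oz0 <-].
have a0 : 0 < cabs p`_2 by rewrite cabs_gt0 quad_lead.
have [e e0 eP] := oO z0 Oz0.
exists (cabs p`_2 * e ^+ 2); first by rewrite mulr_gt0// exprn_gt0.
move=> w we; have [z zw zz0] := quad_open_at z0 w sp.
exists z => //; apply: eP; rewrite -(@ltr_pXn2r _ 2) ?nnegrE ?cabs_ge0 ?(ltW e0)//.
by rewrite -(ltr_pM2l a0); apply: le_lt_trans zz0 we.
Qed.

(* The fibers of p are the orbits of z |-> 2 crit p - z. *)
Lemma preimage_saturated p (S Z O F : set C) : size p = 3%N -> connected S ->
  open O -> closed F -> Z = (horner p @^-1` S) `&` O -> Z = (horner p @^-1` S) `&` F ->
  (forall z, Z z -> Z (2 * crit p - z)) -> Z !=set0 -> Z = horner p @^-1` S.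
Proof.
move=> sp cS oO cF ZO ZF sat [z0 Zz0].
have sat' z w : p.[z] = p.[w] -> Z w -> Z z.
  by move=> /(quad_fiber sp) [->|->] //; exact: sat.
have SE : horner p @` Z = S.
  apply: cS; first by exists p.[z0], z0.
    exists (horner p @` O); first exact: quad_open.
    apply/seteqP; split=> w.
      by move=> [z Zz <-]; move: Zz; rewrite ZO => -[Sz Oz]; split=> //; exists z.
    by move=> [Sw [z Oz zw]]; exists z => //; rewrite ZO; split=> //; rewrite /preimage /= zw.
  exists (~` (horner p @` ~` F)); first by apply: open_closedC; apply: quad_open => //; exact: closed_openC.
  apply/seteqP; split=> w.
    move=> [z Zz <-]; split; first by move: Zz; rewrite ZO => -[].
    move=> [y nF yz]; have : Z y by exact: sat' Zz.
    by rewrite ZF => -[_ /nF].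
  move=> [Sw nw]; have [z zw _] := quad_open_at 0 w sp.
  exists z => //; rewrite ZF; split; first by rewrite /preimage /= zw.
  by apply: contrapT => nF; apply: nw; exists z.
apply/seteqP; split=> z; first by rewrite ZO => -[].
by rewrite /preimage /= -SE => -[y Zy yz]; apply: sat' Zy.
Qed.

(** A clopen part containing [E], intersected with its mirror image, is nonempty and saturated,
    hence is everything. By connectedness [E] lies in a given clopen part or in its complement. [E]
    will be the critical point or a neighborhood of infinity. *)
Lemma preimage_connected p (S E : set C) (e : C) : size p = 3%N -> connected S ->
  connected E -> E `<=` horner p @^-1` S -> E e -> E (2 * crit p - e) ->
  connected (horner p @^-1` S).
Proof.
move=> sp cS cE ET Ee Ee' B B0 [ O oO BO] [F cF BF].
pose s z : C := 2 * crit p - z.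
have sK z : s (s z) = z by rewrite /s; ring.
have cs : continuous s.
  move=> z; apply/contCC => r r0; exists r => // y.
  by rewrite (_ : s y - s z = z - y) 1?cabsB// /s; ring.
have sT z : (horner p @^-1` S) (s z) = (horner p @^-1` S) z by rewrite /preimage /= quad_sym.
have osO (O' : set C) : open O' -> open (s @^-1` O').
  by move=> oO'; apply: open_comp => // z _; exact: cs.
have csF (F' : set C) : closed F' -> closed (s @^-1` F').
  by move=> cF'; apply: closed_comp => // z _; exact: cs.
have main (B' O' F' : set C) : open O' -> closed F' -> B' = (horner p @^-1` S) `&` O' ->
    B' = (horner p @^-1` S) `&` F' -> E `<=` B' -> B' = horner p @^-1` S.
  move=> oO' cF' BO' BF' EB.
  have Z1 : B' `&` s @^-1` B' = (horner p @^-1` S) `&` (O' `&` s @^-1` O').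
    rewrite BO'; apply/seteqP; split=> z; first by (move=> [[Tz Oz] [_ Oz']]).
    by move=> [Tz [Oz Oz']]; split=> //; split=> //; rewrite -/(s z) sT.
  have Z2 : B' `&` s @^-1` B' = (horner p @^-1` S) `&` (F' `&` s @^-1` F').
    rewrite BF'; apply/seteqP; split=> z; first by (move=> [[Tz Oz] [_ Oz']]).
    by move=> [Tz [Oz Oz']]; split=> //; split=> //; rewrite -/(s z) sT.
  have ZT : B' `&` s @^-1` B' = horner p @^-1` S.
    apply: (preimage_saturated sp cS _ _ Z1 Z2).
    - exact: (openI oO' (osO _ oO')).
    - exact: (closedI cF' (csF _ cF')).
    - by move=> z [Bz Bz']; split=> //; rewrite /preimage /= -/(s _) -/(s z) sK.
    - by exists e; split; exact: EB.
  apply/seteqP; split=> z; first by rewrite BO' => -[].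
  by rewrite -{1}ZT => -[].
have [EB|/set0P EB] := eqVneq (E `&` B) set0; last first.
  apply: (main B O F) => //.
  suff EE : E `&` B = E by move=> z; rewrite -{1}EE => -[].
  apply: cE => //.
    by exists O => //; rewrite BO setIA (setIidl ET).
  by exists F => //; rewrite BF setIA (setIidl ET).
exfalso; have [b Bb] := B0.
have BT : (horner p @^-1` S) `&` ~` F = horner p @^-1` S.
  apply: (main _ (~` F) (~` O)) => //; first exact: closed_openC.
  - exact: open_closedC.
  - apply/seteqP; split=> z [Tz nz]; split=> //.
      by move=> Oz; apply: nz; have : B z; [by rewrite BO|rewrite BF => -[]].
    by move=> Fz; apply: nz; have : B z; [by rewrite BF|rewrite BO => -[]].
  - move=> z Ez; split; first exact: ET.
    by move=> Fz; rewrite -[False]/(set0 z) -EB; split=> //; rewrite BF; split=> //; exact: ET.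
have : (horner p @^-1` S) b by move: Bb; rewrite BF => -[].
by rewrite -BT => -[_]; apply; move: Bb; rewrite BF => -[].
Qed.

(** The two pieces of a separation of the intersection have disjoint open neighborhoods, whose union
    contains some [D n] by compactness, and these would separate [D n]. *)
Lemma nested_connected (D : nat -> set C) : (forall m, compact (D m)) ->
  (forall m, connected (D m)) -> (forall m, D m.+1 `<=` D m) ->
  connected [set z | forall m, D m z].
Proof.
move=> cD coD dD B [b Bb] [ O oO BO] [F cF BF].
set K := [set z | forall m, D m z].
have dD' m n : (m <= n)%N -> D n `<=` D m.
  move=> /subnK <-; elim: (n - m)%N => //= k IH z; rewrite addSn => /dD; exact: IH.
have clD m : closed (D m) by apply: compact_closed (cD m); exact: norm_hausdorff.
have cK : closed K.
  rewrite (_ : K = \bigcap_m D m); first by apply: closed_bigI => m _; exact: clD.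
  by apply/seteqP; split=> z H m; [move=> _; exact: H|exact: H].
have cB : compact B.
  apply: (subclosed_compact _ (cD 0%N)); first by rewrite BF; exact: closedI.
  by move=> z; rewrite BF => -[Kz _]; exact: Kz.
have cQ : closed (K `&` ~` O) by exact: (closedI cK (open_closedC oO)).
have BQ : B `&` (K `&` ~` O) = set0.
  by apply/seteqP; split=> // z [Bz [_]]; apply; move: Bz; rewrite BO => -[].
have [d d0 dP] := compact_closed_gap cB cQ BQ.
pose UB := [set z : C | exists2 x, B x & cabs (z - x) < d / 2].
pose UQ := [set z : C | exists2 x, (K `&` ~` O) x & cabs (z - x) < d / 2].
have oU (X : set C) : open [set z : C | exists2 x, X x & cabs (z - x) < d / 2].
  apply/openCP => z [x Xx zx]; exists (d / 2 - cabs (z - x)); first by rewrite subr_gt0.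
  by move=> y yz; exists x => //; have := cabs_tri y x z; lra.
have dis z : UB z -> UQ z -> False.
  move=> [x Bx zx] [y Qy zy]; have := dP x y Bx Qy.
  by have := cabs_tri x y z; rewrite (cabsB x z); lra.
have [n nP] : exists n, forall m x, (n <= m)%N -> D 0%N x -> (D m x -> UB x \/ UQ x).
  apply: compact_uniform_nat (cD 0%N) _ => x D0x.
  have [Kx|nK] := pselect (K x).
    exists 0%N, (d / 2); first by rewrite divr_gt0.
    move=> y m yx _ _; have [Ox|nO] := pselect (O x).
      by left; exists x => //; rewrite BO.
    by right; exists x.
  have [n nD] : exists n, ~ D n x by apply/existsNP.
  have [e e0 eP] := (openCP (~` D n)).1 (closed_openC (clD n)) x nD.
  by exists n, e => // y m /eP nDy nm /(dD' _ _ nm).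
have DB : D n `&` UB = D n.
  apply: coD.
  - exists b; split; first by move: Bb; rewrite BO => -[Kb _]; exact: Kb.
    by exists b => //; rewrite subrr cabs0 divr_gt0.
  - by exists UB => //; exact: oU.
  - exists (~` UQ); first exact/open_closedC/oU.
    apply/seteqP; split=> z [Dz h]; split=> //; first by move=> h2; exact: dis h h2.
    by have [] := nP n z (leqnn _) (dD' _ _ (leq0n n) _ Dz) Dz.
apply/seteqP; split=> z; first by rewrite BO => -[].
move=> Kz; rewrite BO; split=> //; apply: contrapT => nO.
have : (D n `&` UB) z by rewrite DB; exact: Kz.
by move=> [_ h]; apply: (dis z h); exists z => //; rewrite subrr cabs0 divr_gt0.
Qed.

End Quadratics.

(** * Words and filled Julia sets *)

Section Words.
Variable R : realType.
Local Notation C := (Cplx R).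
Implicit Types (p h x : {poly C}) (s : seq {poly C}).

(* The composition of the letters of s, the first letter being applied first. *)
Fixpoint wpoly s : {poly C} := if s is h :: s' then wpoly s' \Po h else 'X.

Lemma wpoly_nil z : (wpoly [::]).[z] = z. Proof. by rewrite hornerX. Qed.

Lemma wpoly_cons h s z : (wpoly (h :: s)).[z] = (wpoly s).[h.[z]].
Proof. by rewrite /= horner_comp. Qed.

Lemma wpoly_cat s t z : (wpoly (s ++ t)).[z] = (wpoly t).[(wpoly s).[z]].
Proof.
elim: s z => [|h s IH] z; first by rewrite wpoly_nil.
by rewrite cat_cons !wpoly_cons IH.
Qed.

Definition itp x m := wpoly (nseq m x).

Lemma itpD x m n z : (itp x (m + n)).[z] = (itp x n).[(itp x m).[z]].
Proof. by rewrite /itp nseqD wpoly_cat. Qed.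

Lemma itp0 x z : (itp x 0).[z] = z. Proof. exact: wpoly_nil. Qed.

Lemma itpS x m z : (itp x m.+1).[z] = (itp x m).[x.[z]].
Proof. exact: wpoly_cons. Qed.

Lemma itpSr x m z : (itp x m.+1).[z] = x.[(itp x m).[z]].
Proof. by rewrite -addn1 itpD itpS itp0. Qed.

(** An escape radius with a rate. The condition survives enlarging [r], so finitely many letters
    share one radius. *)
Definition escapes (r : R) h := 0 < r /\ forall w, r <= cabs w -> 2 * cabs w <= cabs h.[w].

Lemma escapes_le r r' h : r <= r' -> escapes r h -> escapes r' h.
Proof.
move=> rr [r0 H]; split; first exact: lt_le_trans rr.
by move=> w /(le_trans rr); exact: H.
Qed.

Lemma escapes_exists h : size h = 3%N -> exists r : R, escapes r h.
Proof.
move=> sh; have a0 : 0 < cabs h`_2 by rewrite cabs_gt0 quad_lead.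
set a := cabs h`_2 in a0; pose b := cabs h`_1; pose c := cabs h`_0.
have b0 : 0 <= b := cabs_ge0 _; have c0 : 0 <= c := cabs_ge0 _.
exists ((b + c + 2) / a + 1); split.
  by rewrite ltr_wpDl// divr_ge0 ?(ltW a0)// !addr_ge0.
move=> w wr; have w1 : 1 <= cabs w.
  by apply: le_trans wr; rewrite lerDr divr_ge0 ?(ltW a0)// !addr_ge0.
have aw : b + c + 2 <= a * cabs w.
  rewrite mulrC -ler_pdivrMr//; apply: le_trans wr; by rewrite lerDl.
have hE : h.[w] = h`_2 * w ^+ 2 + (h`_1 * w + h`_0).
  rewrite horner_coef sh !big_ord_recl big_ord0 /= /bump /= ?addn0 ?add0n ?addn1.
  by ring.
have := cabs_subD (h`_2 * w ^+ 2) (h`_1 * w + h`_0); rewrite -hE.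
have := cabsD (h`_1 * w) h`_0.
rewrite (cabsM h`_1) (cabsM h`_2 (w ^+ 2)) cabsX -/a -/b -/c.
have : (b + c + 2) * cabs w <= a * cabs w ^+ 2.
  by rewrite expr2 mulrA ler_wpM2r ?cabs_ge0.
have : c <= c * cabs w by rewrite ler_peMr.
move: (cabs w) => t; rewrite !mulrDl; lra.
Qed.

Lemma escapes_seq s : (forall h, h \in s -> size h = 3%N) ->
  exists2 r : R, 0 < r & forall h, h \in s -> escapes r h.
Proof.
elim: s => [|h s IH] H; first by exists 1.
have [|r r0 rP] := IH; first by move=> g gs; apply: H; rewrite in_cons gs orbT.
have [r' rP'] := escapes_exists (H h (mem_head _ _)).
exists (Num.max r r'); first by rewrite lt_max r0.
move=> g; rewrite in_cons => /orP[/eqP ->|/rP].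
  by apply: escapes_le rP'; rewrite le_max lexx orbT.
by apply: escapes_le; rewrite le_max lexx.
Qed.

Lemma escapes_iter r x m w : escapes r x -> r <= cabs w ->
  2 ^+ m * cabs w <= cabs (itp x m).[w].
Proof.
move=> [r0 H]; elim: m w => [|m IH] w rw; first by rewrite mul1r itp0.
have h := H w rw.
have h2 : r <= cabs x.[w] by apply: le_trans h; have := cabs_ge0 w; lra.
rewrite itpS; apply: le_trans (IH _ h2); rewrite exprSr -mulrA ler_wpM2l// exprn_ge0.
Qed.

Lemma escapes_word r s w : (forall h, h \in s -> escapes r h) -> r <= cabs w ->
  cabs w <= cabs (wpoly s).[w].
Proof.
elim: s w => [|h s IH] w H rw; first by rewrite wpoly_nil.
rewrite wpoly_cons; have [r0 hw] := H h (mem_head _ _).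
have h1 : cabs w <= cabs h.[w] by have := hw w rw; have := cabs_ge0 w; lra.
apply: (le_trans h1); apply: IH; last exact: le_trans h1.
by move=> g gs; apply: H; rewrite in_cons gs orbT.
Qed.

Definition filled_julia x : set C := [set w | exists B : R, forall m, cabs (itp x m).[w] <= B].
Definition pull s x : set C := [set z | filled_julia x (wpoly s).[z]].

Lemma pow2_unbounded (a B : R) : 0 < a -> exists n, B < 2 ^+ n * a.
Proof.
move=> a0; have [n nB] : exists n : nat, B / a < n%:R.
  exists (Num.truncn `|B / a|).+1; apply: le_lt_trans (ler_norm _) _.
  by have := truncnS_gt `|B / a|.
exists n; rewrite -ltr_pdivrMr//; apply: lt_trans nB _.
by rewrite -natrX ltr_nat ltn_expl.
Qed.

Lemma filledP r x w : escapes r x -> filled_julia x w <-> forall m, cabs (itp x m).[w] <= r.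
Proof.
move=> e; split; last by exists r.
move=> [B HB] m; rewrite leNgt; apply/negP => /ltW h.
have h0 : 0 < cabs (itp x m).[w] by apply: lt_le_trans h; case: e.
have [n nB] := pow2_unbounded B h0.
have := escapes_iter n e h; rewrite -itpD => /(lt_le_trans nB).
by rewrite ltNge HB.
Qed.

Lemma filled_step x w : filled_julia x x.[w] <-> filled_julia x w.
Proof.
split=> -[B HB].
  exists (Num.max B (cabs w)) => -[|m]; first by rewrite itp0 le_max lexx orbT.
  by rewrite itpS le_max HB.
by exists B => m; rewrite -itpS.
Qed.

Lemma pull_nil x : pull [::] x = filled_julia x.
Proof. by apply/seteqP; split=> z; rewrite /pull /= hornerX. Qed.

Lemma pull_cons h s x : pull (h :: s) x = horner h @^-1` pull s x.
Proof. by apply/seteqP; split=> z; rewrite /pull /preimage /= horner_comp. Qed.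

(** Complete invariance of [filled_julia x] under [x]. It allows words to be brought to any larger
    common length. *)
Lemma pull_pad s x k : pull (s ++ nseq k x) x = pull s x.
Proof.
apply/seteqP; split=> z; rewrite /pull /= wpoly_cat;
  elim: k (wpoly s).[z] => [|k IH] w; rewrite ?wpoly_nil// wpoly_cons.
  by move/IH; rewrite filled_step.
by rewrite -filled_step => /IH.
Qed.

Section FixedRadius.
Variables (r : R) (s : seq {poly C}) (x : {poly C}).
Hypotheses (er : forall h, h \in s -> escapes r h) (ex : escapes r x).

Lemma pullP z : pull s x z <-> forall m, cabs (itp x m).[(wpoly s).[z]] <= r.
Proof. exact: filledP. Qed.

Lemma pull_le z : pull s x z -> cabs z <= r.
Proof.
move=> /pullP/(_ 0%N); rewrite itp0 => h; rewrite leNgt; apply/negP => rz.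
by have := escapes_word er (ltW rz); lra.
Qed.

Lemma pull_closed : closed (pull s x).
Proof.
rewrite (_ : pull s x = \bigcap_m [set z | cabs (itp x m \Po wpoly s).[z] <= r]).
  apply: closed_bigI => m _.
  apply: (@closed_comp _ _ (fun z => cabs (itp x m \Po wpoly s).[z]) [set y | y <= r]).
    by move=> z _; exact: continuous_cabs_horner.
  exact: closed_le.
apply/seteqP; split=> z.
  by move=> /pullP H m _ /=; rewrite horner_comp.
by move=> H; apply/pullP => m; have := H m I; rewrite /= horner_comp.
Qed.

Lemma pull_compact : compact (pull s x).
Proof. by apply: (subclosed_compact pull_closed (@disc_compact R r)); exact: pull_le. Qed.

(** Once the orbit of a point has passed the escape radius, so have the orbits of its neighbors, and
    moduli keep doubling; compactness makes the stage uniform. *)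
Lemma pull_escape_uniform (D : set C) (B : R) : compact D -> D `&` pull s x = set0 ->
  exists n, forall m z, (n <= m)%N -> D z -> B < cabs (itp x m).[(wpoly s).[z]].
Proof.
move=> cD DK; apply: compact_uniform_nat => // z Dz.
have [n nr] : exists n, ~ (cabs (itp x n).[(wpoly s).[z]] <= r).
  by apply/existsNP => H; rewrite -[False]/(set0 z) -DK; split=> //; exact/pullP.
have {}nr : r < cabs (itp x n \Po wpoly s).[z] by rewrite horner_comp ltNge; apply/negP.
have [k kB] := pow2_unbounded B ex.1.
have d0 : 0 < cabs (itp x n \Po wpoly s).[z] - r by rewrite subr_gt0.
have /contCR/(_ _ d0) [e e0 eP] := @continuous_cabs_horner R (itp x n \Po wpoly s) z.
exists (n + k)%N, e => // y m /eP; rewrite !horner_comp in nr *.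
rewrite ltr_norml => /andP[h _] nkm.
have hr : r <= cabs (itp x n).[(wpoly s).[y]] by move: h; lra.
have nm : (n <= m)%N by apply: leq_trans nkm; rewrite leq_addr.
rewrite -(subnKC nm) itpD; apply: lt_le_trans (escapes_iter _ ex hr).
apply: (lt_le_trans kB); apply: ler_pM; [by rewrite exprn_ge0|exact: ltW ex.1| |exact: hr].
by rewrite ler_weXn2l ?ler1n// leq_subRL.
Qed.

End FixedRadius.

Definition word_in (A : set {poly C}) s := forall h, h \in s -> A h.

(** Boundedness of P^*(G) read on words: the critical values of the letters and their images under
    all words, the empty one included. *)
Definition postcritically_bounded (A : set {poly C}) (M : R) :=
  (forall h, A h -> size h = 3%N) /\
  forall h s, A h -> word_in A s -> cabs (wpoly s).[h.[crit h]] <= M.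

Lemma word_in_cons A h s : word_in A (h :: s) <-> A h /\ word_in A s.
Proof.
split=> [H|[Ah H] g]; first by split=> [|g gs]; apply: H; rewrite in_cons ?eqxx ?gs ?orbT.
by rewrite in_cons => /orP[/eqP ->//|/H].
Qed.
Lemma word_in_cat A s t : word_in A (s ++ t) <-> word_in A s /\ word_in A t.
Proof.
split=> [H|[Hs Ht] g]; first by split=> g gs; apply: H; rewrite mem_cat gs ?orbT.
by rewrite mem_cat => /orP[/Hs|/Ht].
Qed.
Lemma word_in_nseq (A : set {poly C}) x k : A x -> word_in A (nseq k x).
Proof. by move=> Ax h; rewrite mem_nseq => /andP[_ /eqP ->]. Qed.
Section Connectedness.
Variables (A : set {poly C}) (M : R).
Hypothesis hA : postcritically_bounded A M.

Lemma word_escapes s x : word_in A s -> A x ->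
  exists r : R, (forall h, h \in s -> escapes r h) /\ escapes r x.
Proof.
move=> sA xA; have [h|r r0 rP] := @escapes_seq (x :: s).
  by rewrite in_cons => /orP[/eqP ->|/sA]; exact: hA.1.
exists r; split; last by apply: rP; rewrite mem_head.
by move=> h hs; apply: rP; rewrite in_cons hs orbT.
Qed.

Lemma pull_critical_value h s x : A h -> word_in A s -> A x -> pull s x h.[crit h].
Proof.
move=> Ah sA xA; exists M => m; rewrite /itp -wpoly_cat; apply: hA.2 => //.
by apply/word_in_cat; split=> //; exact: word_in_nseq.
Qed.

Lemma quad_preimage_connected h (S : set C) : A h -> connected S -> S h.[crit h] ->
  connected (horner h @^-1` S).
Proof.
move=> Ah cS Sb; apply: (@preimage_connected R h S [set crit h] (crit h)) => //.
- exact: hA.1.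
- exact: connected1.
- by move=> _ ->.
- by rewrite /=; ring.
Qed.

Lemma quad_preimage_connected_out h (S : set C) (r : R) : A h -> connected S ->
  (forall z, r < cabs z -> S z) -> connected (horner h @^-1` S).
Proof.
move=> Ah cS Sr; have [r' er'] := escapes_exists (hA.1 _ Ah).
pose m := Num.max r' `|r|; have m0 : 0 < m by rewrite lt_max er'.1.
(* So far from the critical point that [e] and its mirror image both have modulus above [m]. *)
pose e : C := crit h + rc (m + cabs (crit h) + 1).
apply: (@preimage_connected R h S [set z | m < cabs z] e) => //.
- exact: hA.1.
- exact: outside_connected.
- move=> z /= mz; apply: Sr.
  have rz : r' <= cabs z by apply: le_trans (ltW mz); rewrite le_max lexx.
  have := er'.2 z rz; have : r <= m by apply: le_trans (ler_norm r) _; rewrite le_max lexx orbT.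
  by have := cabs_ge0 z; lra.
- rewrite /e /=; have := cabs_subD (rc (m + cabs (crit h) + 1)) (crit h).
  rewrite cabs_rc ger0_norm ?addr_ge0 ?(ltW m0) ?cabs_ge0//.
  by rewrite [crit h + _]addrC; lra.
- rewrite /e /= (_ : _ - _ = - (rc (m + cabs (crit h) + 1) - crit h)); last ring.
  rewrite cabsN; have := cabs_sub (rc (m + cabs (crit h) + 1)) (crit h).
  by rewrite cabs_rc ger0_norm ?addr_ge0 ?(ltW m0) ?cabs_ge0//; lra.
Qed.

Lemma filled_connected x : A x -> connected (filled_julia x).
Proof.
move=> Ax; have [r0 er0] := escapes_exists (hA.1 _ Ax).
(* Beyond [M], so that every set where [|x^m| <= r] contains the critical value, and its preimage is
   again connected. *)
pose r := Num.max r0 M.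
have er : escapes r x by apply: escapes_le er0; rewrite le_max lexx.
rewrite (_ : filled_julia x = [set w | forall m, [set z | cabs (itp x m).[z] <= r] w]); last first.
  by apply/seteqP; split=> w /(filledP _ er).
apply: nested_connected => m.
- apply: (subclosed_compact _ (@disc_compact R r)).
    apply: (@closed_comp _ _ (fun z => cabs (itp x m).[z]) [set y | y <= r]).
      by move=> z _; exact: continuous_cabs_horner.
    exact: closed_le.
  move=> z /= h; rewrite leNgt; apply/negP => rz.
  have := escapes_iter m er (ltW rz); have : cabs z <= 2 ^+ m * cabs z.
    by rewrite ler_peMl ?cabs_ge0// exprn_ege1// ler1n.
  by lra.
- elim: m => [|m IH].
    rewrite (_ : mkset _ = [set z | cabs (z - 0) <= r]); first exact: ball_connected.
    by apply/seteqP; split=> z; rewrite /= itp0 subr0.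
  rewrite (_ : mkset _ = horner x @^-1` [set z | cabs (itp x m).[z] <= r]); last first.
    by apply/seteqP; split=> z; rewrite /preimage /= itpS.
  apply: quad_preimage_connected => //=.
  apply: (@le_trans _ _ M); last by rewrite le_max lexx orbT.
  by apply: hA.2 => //; exact: word_in_nseq.
- move=> z /=; rewrite itpSr => h; rewrite leNgt; apply/negP => rz.
  by have := er.2 _ (ltW rz); have := er.1; lra.
Qed.

(** A union of the connected sets where [|x^m| > r], all containing the exterior of one disc. *)
Lemma filled_setC_connected x : A x -> connected (~` filled_julia x).
Proof.
move=> Ax; have [r er] := escapes_exists (hA.1 _ Ax).
rewrite (_ : ~` filled_julia x = \bigcup_m [set w | r < cabs (itp x m).[w]]); last first.
  apply/seteqP; split=> w.
    move=> nK; have /existsNP[m mr] : ~ forall m, cabs (itp x m).[w] <= r by move/(filledP w er).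
    by exists m => //=; rewrite ltNge; apply/negP.
  by move=> [m _ /= h] /(filledP w er)/(_ m); rewrite leNgt h.
have out m z : r < cabs z -> r < cabs (itp x m).[z].
  move=> rz; apply: (lt_le_trans rz); apply: le_trans (escapes_iter m er (ltW rz)).
  by rewrite ler_peMl ?cabs_ge0// exprn_ege1// ler1n.
apply: bigcup_connected.
  exists (rc (r + 1)) => m _; apply: out.
  by rewrite cabs_rc gtr0_norm ?addr_gt0 ?er.1// ltrDl.
elim=> [_|m IH _].
  rewrite (_ : mkset _ = [set z | r < cabs z]); first exact: outside_connected er.1.
  by apply/seteqP; split=> z; rewrite /= itp0.
rewrite (_ : mkset _ = horner x @^-1` [set w | r < cabs (itp x m).[w]]); last first.
  by apply/seteqP; split=> z; rewrite /preimage /= itpS.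
by apply: (quad_preimage_connected_out Ax (IH I)) => z; exact: out.
Qed.

Lemma pull_connected s x : word_in A s -> A x -> connected (pull s x).
Proof.
move=> + Ax; elim: s => [_|h s IH /word_in_cons[Ah sA]].
  by rewrite pull_nil; exact: filled_connected.
rewrite pull_cons; apply: quad_preimage_connected => //; first exact: IH.
exact: pull_critical_value.
Qed.

Lemma pull_setC_connected s x : word_in A s -> A x -> connected (~` pull s x).
Proof.
move=> + Ax; elim: s => [_|h s IH /word_in_cons[Ah sA]].
  by rewrite pull_nil; exact: filled_setC_connected.
rewrite pull_cons preimage_setC.
have [r [er ex]] := word_escapes sA Ax.
apply: (@quad_preimage_connected_out h _ r Ah (IH sA)) => z rz Kz.
by have := pull_le er ex Kz; rewrite leNgt rz.
Qed.

End Connectedness.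
End Words.
Arguments pull_connected {R A M} _ {s x} _ _.
Arguments pull_setC_connected {R A M} _ {s x} _ _.
Arguments pull_compact {R r s x} _ _.
Arguments pull_closed {R r s x} _.

(** * Capacities *)

Section Capacity.
Variable R : realType.
Local Notation C := (Cplx R).
Implicit Types (p h x : {poly C}) (s : seq {poly C}).

Fixpoint wlead s : R := if s is h :: s' then cabs h`_2 ^+ (2 ^ size s') * wlead s' else 1.

(* lam s x = c^(- 2^|s|), where c is the logarithmic capacity of pull s x. *)
Fixpoint lam s x : R := if s is h :: s' then cabs h`_2 ^+ (2 ^ size s') * lam s' x else cabs x`_2.

(** Leading coefficients of x^m o s thus determine [lam] in the limit: a factor independent of [m]
    in an estimate of them is lost after extracting a root of order 2^m. *)
Lemma wlead_lam s x m : cabs x`_2 * wlead (s ++ nseq m x) = lam s x ^+ (2 ^ m).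
Proof.
elim: s => [|h s IH] /=.
  elim: m => [|m IH] /=; first by rewrite mulr1.
  by rewrite mulrCA IH size_nseq -exprD addnn -mul2n expnS.
by rewrite mulrCA IH exprMn -exprM size_cat size_nseq expnD.
Qed.

Definition quads s := forall h, h \in s -> size h = 3%N.

Lemma quads_cons h s : quads (h :: s) -> size h = 3%N /\ quads s.
Proof. by move=> H; split=> [|g gs]; apply: H; rewrite in_cons ?eqxx ?gs ?orbT. Qed.

Lemma size_wpoly s : quads s -> size (wpoly s) = (2 ^ size s).+1.
Proof.
elim: s => [|h s IH]; first by rewrite size_polyX.
move=> /quads_cons[sh qs] /=; have e := size_comp_poly (wpoly s) h.
have sn : size (wpoly s \Po h) != 0%N.
  rewrite size_poly_eq0 -lead_coef_eq0 lead_coef_comp ?sh// mulf_neq0 ?expf_neq0//.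
    by rewrite lead_coef_eq0 -size_poly_eq0 (IH qs).
  by rewrite lead_coef_eq0 -size_poly_eq0 sh.
by rewrite -[LHS]prednK ?lt0n// e (IH qs) sh /= expnS mulnC.
Qed.

Lemma lead_wpoly s : quads s -> cabs (wpoly s)`_(2 ^ size s) = wlead s.
Proof.
elim: s => [|h s IH]; first by rewrite /= expn0 coefX cabs1.
move=> qhs; have [sh qs] := quads_cons qhs.
have e : (wpoly (h :: s))`_(2 ^ size (h :: s)) = lead_coef (wpoly (h :: s)).
  by rewrite lead_coefE size_wpoly.
rewrite e /= lead_coef_comp ?sh// cabsM cabsX !lead_coefE size_wpoly// sh /= IH//.
by rewrite mulrC.
Qed.

Lemma bernoulli_le (X : R) n : 0 <= X -> 1 + n%:R * X <= (1 + X) ^+ n.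
Proof.
move=> X0; elim: n => [|n IH]; first by rewrite mul0r addr0.
rewrite exprS; apply: le_trans (_ : (1 + X) * (1 + n%:R * X) <= _).
  rewrite -natr1; have : 0 <= n%:R * (X * X) by rewrite mulr_ge0 ?ler0n ?mulr_ge0.
  by rewrite mulrDl mulrDr; lra.
by rewrite ler_wpM2l// addr_ge0.
Qed.

Lemma pow_unbounded (X B : R) : 1 < X -> exists n, forall m, (n <= m)%N -> B < X ^+ (2 ^ m).
Proof.
move=> X1; have X0 : 0 < X - 1 by rewrite subr_gt0.
have [n nB] := pow2_unbounded B X0.
exists n => m nm; apply: (lt_le_trans nB).
have -> : X = 1 + (X - 1) by rewrite addrC subrK.
apply: le_trans (bernoulli_le _ (ltW X0)).
rewrite (addrC 1 (X - 1)) addrK ler_wpDl//.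
rewrite ler_pM2r// -natrX ler_nat leq_pexp2l//.
Qed.

(* Compare on the complement of pull s' x' the polynomials x'^m o s' and x^m o s,
   the latter precomposed with the contraction of ratio 1 / (1 + t) centered at b;
   they have the same degree, and the first is bounded on the boundary while the
   second is large there. The values at infinity give the inequality as m grows. *)
Lemma capacity_gap s s' x x' (r d : R) : quads s -> quads s' -> size s = size s' ->
  size x = 3%N -> size x' = 3%N ->
  (forall h, h \in s -> escapes r h) -> (forall h, h \in s' -> escapes r h) ->
  escapes r x -> escapes r x' -> 0 < d -> pull s x !=set0 ->
  (forall z y, pull s x z -> cabs (y - z) < d -> pull s' x' y) ->
  lam s' x' * (1 + d / (4 * r)) ^+ (2 ^ size s) <= lam s x.
Proof.
move=> qs qs' ss sx sx' er er' ex ex' d0 [b Tb] gap.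
have r0 : 0 < r := ex.1.
(* [pull s x] lies in the disc of radius [r], so scaling it by [1 + t] about its point [b] moves its
   points by at most [t * (2 * r)], which is [d / 2]. *)
pose t := d / (4 * r); have t0 : 0 < t by rewrite divr_gt0// mulr_gt0.
have t1 : 0 < 1 + t by rewrite addr_gt0.
have tn : rc (1 + t) != 0 by rewrite rc_eq0 gt_eqF.
(* Translating [b] to the origin turns the contraction into a multiplication, and keeps [U] away
   from 0 as [exterior_max] demands. *)
pose U := [set z : C | ~ pull s' x' (z + b)].
have cT' : closed (pull s' x') := pull_closed ex'.
have oU : open U.
  apply/openCP => z Uz; have [e e0 eP] := (openCP _).1 (closed_openC cT') _ Uz.
  by exists e => // y yz; apply: eP; rewrite (_ : _ - _ = y - z)//; ring.
have Ud z : U z -> d <= cabs z.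
  move=> Uz; rewrite leNgt; apply/negP => zd; apply: Uz; apply: (gap b) => //.
  by rewrite addrK.
pose r1 := r + cabs b + 1.
have Ur z : r1 <= cabs z -> U z.
  by move=> rz /(pull_le er' ex') h; have := cabs_subD z b; rewrite /r1 in rz; lra.
have clT z : closure U z -> ~ pull s x (b + rc (1 + t)^-1 * z).
  move=> cz Tz; have d2 : 0 < d / 2 by rewrite divr_gt0.
  have [w Uw wz] := (closureCP U z).1 cz _ d2; apply: Uw.
  apply: (gap _ _ Tz); set y := b + _ in Tz *.
  have zy : z + b - y = rc t * (y - b).
    rewrite /y rcV rcD rc1 in tn *; field; exact: tn.
  have : cabs (z + b - y) <= d / 2.
    rewrite zy cabsM cabs_rc gtr0_norm//.
    apply: (@le_trans _ _ (t * (2 * r))); last by rewrite /t le_eqVlt; apply/orP; left; apply/eqP; field; rewrite gt_eqF.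
    rewrite ler_pM2l//; apply: le_trans (cabsBD _ _) _.
    by rewrite mulr2n mulrDl mul1r lerD// (pull_le er ex).
  have := cabs_tri (w + b) y (z + b); rewrite (_ : w + b - (z + b) = w - z); last ring.
  lra.
pose D := [set b + rc (1 + t)^-1 * z | z in closure U `&` ~` U].
have cD : compact D.
  apply: continuous_compact.
    apply/continuous_subspaceT/continuous_addC; first exact: continuous_cstC.
    by apply: continuous_mulC; [exact: continuous_cstC|move=> z; exact: id].
  apply: (subclosed_compact _ (@disc_compact R r1)).
    by apply: closedI; [exact: closed_closure|exact: open_closedC].
  move=> z [_ nU] /=; rewrite leNgt; apply/negP => /ltW /Ur; exact: nU.
have DT : D `&` pull s x = set0.
  by apply/seteqP; split=> // _ [[z [cz _] <-]]; exact: clT.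
have [n nP] := pull_escape_uniform ex (r + 1) cD DT.
pose N m := (2 ^ size (s ++ nseq m x))%N.
have NE m : N m = (2 ^ size s * 2 ^ m)%N by rewrite /N size_cat size_nseq expnD.
have qcat s1 x1 m : quads s1 -> size x1 = 3%N -> quads (s1 ++ nseq m x1).
  move=> q1 sx1 h; rewrite mem_cat => /orP[/q1//|]; rewrite mem_nseq => /andP[_ /eqP ->//].
have key m : (n <= m)%N -> wlead (s' ++ nseq m x') * (1 + t) ^+ N m <= r * wlead (s ++ nseq m x).
  move=> nm.
  have q := qcat s x m qs sx; have q' := qcat s' x' m qs' sx'.
  pose w0 := (wpoly (s ++ nseq m x)).[b].
  pose P := wpoly (s' ++ nseq m x') \Po ('X + b%:P).
  pose L : {poly C} := rc (1 + t)^-1 *: 'X + b%:P.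
  (* Subtracting the value at [b], whose orbit is bounded, forces the zeros of [Q] to correspond to
     points of [pull s x], hence to avoid [closure U]. On the boundary [|Q|] remains at least 1. *)
  pose Q := wpoly (s ++ nseq m x) \Po L - w0%:P.
  have k0 : rc (1 + t)^-1 != 0 by rewrite rc_eq0 gt_eqF// invr_gt0.
  have szL : size L = 2%N.
    by rewrite /L size_polyDl size_scale ?size_polyX// (leq_ltn_trans (size_polyC_leq1 _)).
  have leadL : lead_coef L = rc (1 + t)^-1.
    rewrite /L lead_coefDl; first by rewrite lead_coefZ lead_coefX mulr1.
    by rewrite size_scale// size_polyX (leq_ltn_trans (size_polyC_leq1 _)).
  have szX : size ('X + b%:P : {poly C}) = 2%N by rewrite size_XaddC.
  have Npos : (0 < N m)%N by rewrite expn_gt0.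
  have sc (p q1 : {poly C}) : size p = (N m).+1 -> size q1 = 2%N -> size (p \Po q1) = (N m).+1.
    move=> sp sq; have := size_comp_poly p q1; rewrite sp sq /= muln1 => e.
    rewrite -e prednK// lt0n; apply/eqP => h; move: Npos.
    by rewrite -e h.
  have sw : size (wpoly (s ++ nseq m x)) = (N m).+1 by rewrite size_wpoly.
  have NE' : N m = (2 ^ size (s' ++ nseq m x'))%N by rewrite /N !size_cat !size_nseq ss.
  have sw' : size (wpoly (s' ++ nseq m x')) = (N m).+1 by rewrite NE' size_wpoly.
  have sQ0 : size (wpoly (s ++ nseq m x) \Po L) = (N m).+1 by exact: sc.
  have sw0 : (size w0%:P < (N m).+1)%N by apply: leq_ltn_trans (size_polyC_leq1 _) _.
  have sQ : size Q = (N m).+1 by rewrite /Q size_polyDl ?size_polyN// sQ0.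
  have sP : (size P <= (N m).+1)%N by rewrite sc.
  have PE z : P.[z] = (itp x' m).[(wpoly s').[z + b]].
    by rewrite horner_comp !hornerE wpoly_cat.
  have QE z : Q.[z] = (itp x m).[(wpoly s).[b + rc (1 + t)^-1 * z]] - w0.
    rewrite /Q hornerD hornerN hornerC horner_comp /L hornerD hornerZ hornerX hornerC.
    by rewrite [_ + b]addrC wpoly_cat.
  have w0r : cabs w0 <= r.
    by rewrite /w0 wpoly_cat; exact: (pullP s ex b).1 Tb m.
  have Q0 z : closure U z -> Q.[z] != 0.
    move=> cz; rewrite QE subr_eq0; apply/eqP => h; apply: (clT z cz).
    rewrite -(pull_pad s x m) /pull /= wpoly_cat -/(itp x m) h.
    by have : pull (s ++ nseq m x) x b by rewrite pull_pad.
  have PQ z : closure U z -> ~ U z -> cabs P.[z] <= r * cabs Q.[z].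
    move=> cz nU; have Tz : pull s' x' (z + b) by apply: contrapT.
    have h1 : cabs P.[z] <= r by rewrite PE; exact: (pullP s' ex' (z + b)).1 Tz m.
    apply: (le_trans h1); rewrite ler_peMr ?(ltW r0)// QE.
    have /(nP m _ nm) : D (b + rc (1 + t)^-1 * z) by exists z.
    by have := cabs_sub (itp x m).[(wpoly s).[b + rc (1 + t)^-1 * z]] w0; lra.
  have [_] := exterior_max oU d0 r0 Ud Ur sP sQ Q0 PQ.
  have -> : cabs P`_(N m) = wlead (s' ++ nseq m x').
    have -> : P`_(N m) = lead_coef P by rewrite lead_coefE (sc _ _ sw' szX).
    rewrite lead_coef_comp ?szX// [lead_coef ('X + _)]lead_coefDl ?size_polyX ?(leq_ltn_trans (size_polyC_leq1 _))//.
    by rewrite lead_coefX expr1n mulr1 lead_coefE sw' /= NE' lead_wpoly.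
  have -> : cabs Q`_(N m) = wlead (s ++ nseq m x) / (1 + t) ^+ N m.
    have -> : Q`_(N m) = lead_coef (wpoly (s ++ nseq m x) \Po L).
      rewrite lead_coefE sQ0 /Q coefB coefC.
      by case: (N m) Npos => //= k _; rewrite subr0.
    rewrite lead_coef_comp ?szL// leadL sw /= lead_coefE sw /= cabsM lead_wpoly//.
    by rewrite cabsX cabs_rc ger0_norm ?invr_ge0 ?(ltW t1)// exprVn.
  by rewrite mulrA ler_pdivlMr ?exprn_gt0.
have a0 : 0 < cabs x`_2 by rewrite cabs_gt0 quad_lead.
have a0' : 0 < cabs x'`_2 by rewrite cabs_gt0 quad_lead.
have lam0 s1 x1 : quads s1 -> size x1 = 3%N -> 0 < lam s1 x1.
  move=> + sx1; elim: s1 => [_|h s1 IH /quads_cons[sh qs1]] /=; first by rewrite cabs_gt0 quad_lead.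
  by rewrite mulr_gt0 ?IH// exprn_gt0// cabs_gt0 quad_lead.
have L0 := lam0 s x qs sx.
(* A ratio above 1, raised to the power 2^m, would exceed the constant factor in [key], which does
   not depend on [m]. *)
rewrite leNgt -/t; apply/negP => bad.
have X1 : 1 < lam s' x' * (1 + t) ^+ (2 ^ size s) / lam s x.
  by rewrite ltr_pdivlMr// mul1r.
have [k kP] := pow_unbounded (r * cabs x'`_2 / cabs x`_2) X1.
pose m := maxn n k.
have := kP m (leq_maxr _ _); rewrite ltNge => /negP; apply.
have := key m (leq_maxl _ _).
rewrite -(ler_pM2l a0') mulrA wlead_lam NE mulrCA -(ler_pM2l a0).
rewrite [leRHS](_ : _ = r * cabs x'`_2 * (cabs x`_2 * wlead (s ++ nseq m x))); last ring.
rewrite wlead_lam exprM -exprMn => h.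
rewrite exprMn exprVn ler_pdivrMr ?exprn_gt0// mulrAC ler_pdivlMr// mulrC.
exact: h.
Qed.

End Capacity.

(** * Chains of words on one side of a separation *)

Section Chain.
Variable R : realType.
Local Notation C := (Cplx R).
Implicit Types (p h x : {poly C}) (s : seq {poly C}).

(** A segment shorter than [d] from a point of [T] to a point outside [T'] would cross both
    boundaries. *)
Lemma neighborhood_sub (T T' : set C) (d : R) : closed T -> closed T' -> T `<=` T' -> 0 < d ->
  (forall u v, bd T u -> bd T' v -> d <= cabs (u - v)) ->
  forall z y, T z -> cabs (y - z) < d -> T' y.
Proof.
move=> cT cT' TT' d0 gap z y Tz yz; apply: contrapT => nT'y.
have [p [sp bp]] : segment z y `&` bd T !=set0.
  apply: connected_bd (segment_connectedC z y) _ _.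
    by exists z; split=> //; exact: segmentl.
  by exists y; split; [exact: segmentr|move=> /TT'].
have [q [sq bq]] : segment z y `&` bd T' !=set0.
  apply: connected_bd (segment_connectedC z y) _ _.
    by exists z; split; [exact: segmentl|exact: TT'].
  by exists y; split; [exact: segmentr|].
have := gap p q bp bq; rewrite leNgt => /negP; apply.
exact: le_lt_trans (segment_diam sp sq) yz.
Qed.

(** By [bd_one_side], [bd T] lies in [T'] or in the closure of its complement. In the first case [T]
    is in [T'], as the connected unbounded complement of [T'] avoids [bd T]; in the second the
    connected [T'], which meets [T], cannot cross [bd T]. *)
Lemma nested_of_gap (T T' : set C) (d r : R) : compact T -> compact T' ->
  connected T -> connected T' -> connected (~` T) -> connected (~` T') ->
  (forall z, T z -> cabs z <= r) -> (forall z, T' z -> cabs z <= r) ->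
  T `&` T' !=set0 -> 0 < d ->
  (forall u v, bd T u -> bd T' v -> d <= cabs (u - v)) ->
  (forall z y, T z -> cabs (y - z) < d -> T' y) \/ (forall z y, T' z -> cabs (y - z) < d -> T y).
Proof.
move=> kT kT' oT oT' nT nT' Tr Tr' [b [Tb Tb']] d0 gap.
have cT : closed T by apply: compact_closed kT; exact: norm_hausdorff.
have cT' : closed T' by apply: compact_closed kT'; exact: norm_hausdorff.
have dis z : bd T z -> bd T' z -> False.
  by move=> h h'; have := gap z z h h'; rewrite subrr cabs0 leNgt d0.
have side : bd T `<=` T' \/ bd T `<=` closure (~` T').
  apply: (bd_one_side kT oT nT cT' (@closed_closure _ (~` T'))).
    apply/seteqP; split=> // z [[bz Tz'] cz]; apply: (dis z bz); split=> //.
    exact: subset_closure.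
  move=> z bz; have [Tz'|nTz'] := pselect (T' z); first by left.
  by right; exact: subset_closure.
case: side => side.
  left; apply: (@neighborhood_sub T T' d cT cT' _ d0 gap) => z Tz; apply: contrapT => nTz'.
  have [p [np bp]] : ~` T' `&` bd T !=set0.
    apply: connected_bd nT' _ _; first by exists z.
    have m0 : 0 < Num.max r 0 + 1 by rewrite ltr_wpDl// le_max lexx orbT.
    have m1 : r < cabs (rc (Num.max r 0 + 1)).
      by rewrite cabs_rc gtr0_norm// ltr_pwDr// le_max lexx.
    by exists (rc (Num.max r 0 + 1)); split; [move=> /Tr'|move=> /Tr]; rewrite leNgt m1.
  exact: np (side p bp).
have gap' u v : bd T' u -> bd T v -> d <= cabs (u - v) by move=> bu bv; rewrite cabsB; exact: gap.
right; apply: (@neighborhood_sub T' T d cT' cT _ d0 gap') => z Tz'.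
apply: contrapT => nTz.
have [p [Tp bp]] : T' `&` bd T !=set0.
  by apply: connected_bd oT' _ _; [exists b|exists z].
by apply: (dis p bp); split; [exact: subset_closure|exact: side].
Qed.

(** The factor of [lam] due to a prefix followed by [k] letters. It depends on the tail through its
    length only, so it cancels when tails of equal length are compared. *)
Fixpoint lamc (k : nat) s : R :=
  if s is h :: s' then cabs h`_2 ^+ (2 ^ (size s' + k)) * lamc k s' else 1.

Lemma lam_cat s t x : lam (s ++ t) x = lamc (size t) s * lam t x.
Proof.
elim: s => [|h s IH] /=; first by rewrite mul1r.
by rewrite size_cat IH mulrA.
Qed.

(** The exponents of the repeated letter are the powers of 2 below 2^m and one more 1 for the final
    set; they add up to 2^m, the exponent of the first letter. *)
Lemma lam_swap m h k : lam (h :: nseq m k) k = lam (k :: nseq m h) h.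
Proof.
have e g : lam (nseq m g) g = cabs g`_2 ^+ (2 ^ m).
  elim: m => [|m IH] /=; first by rewrite expn0.
  by rewrite IH size_nseq -exprD addnn -mul2n expnS.
by rewrite /= !e !size_nseq mulrC.
Qed.

Section OneSide.
Variables (A : set {poly C}) (M : R).
Hypothesis hA : postcritically_bounded A M.

Lemma lam_gt0 s x : word_in A s -> A x -> 0 < lam s x.
Proof.
move=> + Ax; elim: s => [_|h s IH /word_in_cons[Ah sA]] /=.
  by rewrite cabs_gt0 quad_lead// hA.1.
by rewrite mulr_gt0 ?IH// exprn_gt0// cabs_gt0 quad_lead// hA.1.
Qed.

Lemma lamc_gt0 k s : word_in A s -> 0 < lamc k s.
Proof.
elim: s => [_|h s IH /word_in_cons[Ah sA]] /=; first exact: ltr01.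
by rewrite mulr_gt0 ?IH// exprn_gt0// cabs_gt0 quad_lead// hA.1.
Qed.

Variables (L : seq {poly C}) (P Q : set C).
Hypotheses (LA : word_in A L) (cP : closed P) (cQ : closed Q) (PQ0 : P `&` Q = set0).
Hypothesis PQ : forall s x, word_in A s -> A x -> bd (pull s x) `<=` P `|` Q.

Definition onP s x := bd (pull s x) `<=` P.
(** Restriction to the finite list [L] makes the escape radius, the coefficient ratio and the gap
    uniform. *)
Definition inL s := forall h, h \in s -> h \in L.

Lemma inLA s : inL s -> word_in A s.
Proof. by move=> sL h /sL; exact: LA. Qed.

Lemma onP_or_onQ s x : word_in A s -> A x -> onP s x \/ bd (pull s x) `<=` Q.
Proof.
move=> sA xA; have [r [er ex]] := word_escapes hA sA xA.
apply: (@bd_one_side _ (pull s x) P Q _ _ _ cP cQ).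
- exact (pull_compact er ex).
- exact (pull_connected hA sA xA).
- exact (pull_setC_connected hA sA xA).
- by apply/seteqP; split=> // z [[_ Pz] Qz]; rewrite -PQ0.
- exact: PQ.
Qed.

Lemma ratio_bound : exists2 K : R, 1 <= K & forall h g, h \in L -> g \in L ->
  cabs h`_2 <= K * cabs g`_2.
Proof.
have [U U1 UP] : exists2 U : R, 1 <= U & forall h, h \in L -> cabs h`_2 <= U.
  elim: (L) => [|h s [U U1 UP]]; first by exists 1.
  exists (Num.max U (cabs h`_2)); first by rewrite le_max U1.
  move=> g; rewrite in_cons => /orP[/eqP ->|/UP gU]; first by rewrite le_max lexx orbT.
  by rewrite le_max gU.
have [V V1 VP] : exists2 V : R, 1 <= V & forall h, h \in L -> 1 <= V * cabs h`_2.
  move: LA; elim: (L) => [|h s IH] hs; first by exists 1.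
  have [V V1 VP] := IH (fun g gs => hs g (mem_behead (s := h :: s) gs)).
  have h0 : 0 < cabs h`_2 by rewrite cabs_gt0 quad_lead//; apply/hA.1/hs/mem_head.
  exists (Num.max V (cabs h`_2)^-1); first by rewrite le_max V1.
  move=> g; rewrite in_cons => /orP[/eqP ->|/VP gV].
    by rewrite -ler_pdivrMr// mul1r le_max lexx orbT.
  by apply: (le_trans gV); rewrite ler_wpM2r ?cabs_ge0// le_max lexx.
exists (U * V) => [|h g /UP hU /VP gV]; first by rewrite -[1]mulr1 ler_pM.
by rewrite -mulrA; apply: (le_trans hU); rewrite ler_peMr// (le_trans _ U1).
Qed.

(** If the second boundary lay in [Q], both would be at distance [d], the gap between [P] within the
    escape disc and [Q]. The sets would be nested, and [capacity_gap] would give a ratio of [lam] of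
    at least [t ^+ (2 ^ size s)], above [K] for long words. *)
Lemma onP_step (K : R) : exists n0 : nat, forall s x s' x',
  (n0 <= size s)%N -> size s = size s' -> inL s -> inL s' -> x \in L -> x' \in L ->
  lam s x <= K * lam s' x' -> lam s' x' <= K * lam s x -> onP s x -> onP s' x'.
Proof.
have qL h : h \in L -> size h = 3%N by move=> /LA; exact: hA.1.
have [r r0 rP] := escapes_seq qL.
pose DP := P `&` [set z : C | cabs z <= r].
have cDP : compact DP.
  apply: (subclosed_compact _ (@disc_compact R r)); last by move=> z [].
  apply: (closedI cP); apply: compact_closed (@disc_compact R r); exact: norm_hausdorff.
have DPQ : DP `&` Q = set0 by apply/seteqP; split=> // z [[Pz _] Qz]; rewrite -PQ0.
have [d d0 dP] := compact_closed_gap cDP cQ DPQ.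
pose t := 1 + d / (4 * r).
have t1 : 1 < t by rewrite ltrDl divr_gt0// mulr_gt0.
have [n0 n0P] := pow_unbounded K t1.
exists n0 => s x s' x' n0s ss sL sL' xL xL' l1 l2 oP.
have sA := inLA sL; have sA' := inLA sL'; have xA := LA xL; have xA' := LA xL'.
have [//|oQ] := onP_or_onQ sA' xA'.
have er h : h \in s -> escapes r h by move=> /sL /rP.
have er' h : h \in s' -> escapes r h by move=> /sL' /rP.
have ex := rP _ xL; have ex' := rP _ xL'.
have kT := pull_compact er ex; have kT' := pull_compact er' ex'.
have gap y z : bd (pull s x) y -> bd (pull s' x') z -> d <= cabs (y - z).
  move=> by_ bz; apply: dP; last exact: oQ.
  by split; [exact: oP|apply: (pull_le er ex); exact: bd_sub (pull_closed ex) _ by_].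
have qs : quads s by move=> h /sL /qL.
have qs' : quads s' by move=> h /sL' /qL.
(* Any critical value of a letter belongs to all these sets; this is what excludes disjoint ones. *)
have inh : pull s x `&` pull s' x' !=set0.
  by exists x.[crit x]; split; [exact (pull_critical_value hA xA sA xA)|exact (pull_critical_value hA xA sA' xA')].
have l0 := lam_gt0 sA xA; have l0' := lam_gt0 sA' xA'.
have tn : K < t ^+ (2 ^ size s) := n0P _ n0s.
exfalso.
case: (nested_of_gap kT kT' (pull_connected hA sA xA) (pull_connected hA sA' xA')
  (pull_setC_connected hA sA xA) (pull_setC_connected hA sA' xA')
  (fun z => @pull_le _ _ _ _ er ex z) (fun z => @pull_le _ _ _ _ er' ex' z) inh d0 gap) => nest.
  have ne : pull s x !=set0 by have [b [Tb _]] := inh; exists b.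
  have := capacity_gap qs qs' ss (qL _ xL) (qL _ xL') er er' ex ex' d0 ne nest.
  rewrite -/t => h; have := le_trans h l1; rewrite mulrC ler_pM2r// leNgt tn//.
have ne : pull s' x' !=set0 by have [b [_ Tb]] := inh; exists b.
have := capacity_gap qs' qs (esym ss) (qL _ xL') (qL _ xL) er' er ex' ex d0 ne nest.
by rewrite -/t -ss => h; have := le_trans h l2; rewrite mulrC ler_pM2r// leNgt tn.
Qed.

(* Exchanging the tails h k k...k and k h h...h does not change lam, so any two
   tails are joined by steps changing lam by a bounded factor only. *)
Lemma onP_chain : exists n0 : nat, forall m u v v' y y',
  (n0 <= size u + m)%N -> size v = m -> size v' = m -> inL u -> inL v -> inL v' ->
  y \in L -> y' \in L -> onP (u ++ v) y -> onP (u ++ v') y'.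
Proof.
have [K K1 KP] := ratio_bound.
have K0 : 0 < K by apply: lt_le_trans K1.
have [n0 n0P] := onP_step K; exists n0.
have inL_cat s t : inL s -> inL t -> inL (s ++ t).
  by move=> sL tL h; rewrite mem_cat => /orP[/sL|/tL].
have inL_nseq k h : h \in L -> inL (nseq k h).
  by move=> hL g; rewrite mem_nseq => /andP[_ /eqP ->].
have step u v v' y y' : (n0 <= size u + size v)%N -> size v = size v' -> inL u -> inL v -> inL v' ->
    y \in L -> y' \in L -> lam v y <= K * lam v' y' -> lam v' y' <= K * lam v y ->
    onP (u ++ v) y -> onP (u ++ v') y'.
  move=> nu vv uL vL vL' yL yL' l1 l2; apply: n0P; rewrite ?size_cat ?vv -?vv//; try exact: inL_cat.
  - by rewrite !lam_cat -vv mulrCA ler_pM2l// lamc_gt0//; exact: inLA.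
  - by rewrite !lam_cat -vv mulrCA ler_pM2l// lamc_gt0//; exact: inLA.
elim=> [|m IH] u v v' y y'.
  move=> nu /size0nil -> /size0nil -> uL _ _ yL yL'; apply: step => //=; rewrite ?KP//.
move=> nu; case: v => [//|h v] [sv]; case: v' => [//|k v'] [sv'] uL vL vL' yL yL' o.
have hL : h \in L by apply: vL; rewrite mem_head.
have kL : k \in L by apply: vL'; rewrite mem_head.
have vL1 : inL v by move=> g gv; apply: vL; rewrite in_cons gv orbT.
have vL1' : inL v' by move=> g gv; apply: vL'; rewrite in_cons gv orbT.
have rc_ g w : u ++ g :: w = (u ++ [:: g]) ++ w by rewrite -catA.
have nu' : forall g, (n0 <= size (u ++ [:: g]) + m)%N by move=> g; rewrite size_cat /= addn1 addSnnS.
have uL' g : g \in L -> inL (u ++ [:: g]).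
  by move=> gL; apply: inL_cat => // f; rewrite inE => /eqP ->.
(* The letter [h] joins the prefix, so the induction hypothesis may replace the tail [v] by copies
   of [k]; after the swap it turns the copies of [h] into [v']. *)
have o1 : onP (u ++ h :: nseq m k) k.
  rewrite rc_; apply: (IH _ v _ y) => //; rewrite ?size_nseq//; [exact: uL'|exact: inL_nseq|by rewrite -rc_].
have o2 : onP (u ++ k :: nseq m h) h.
  have l0 (g f : {poly C}) : g \in L -> f \in L -> 0 <= lam (g :: nseq m f) f.
    move=> gL fL; apply: ltW; apply: lam_gt0 (LA fL).
    by apply/word_in_cons; split; [exact: LA|apply: word_in_nseq; exact: LA].
  have inL2 (g f : {poly C}) : g \in L -> f \in L -> inL (g :: nseq m f).
    by move=> gL fL e; rewrite in_cons => /orP[/eqP ->//|]; exact: inL_nseq.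
  have nu2 (g f : {poly C}) : (n0 <= size u + size (g :: nseq m f))%N by rewrite /= size_nseq.
  have se : size (h :: nseq m k) = size (k :: nseq m h) by rewrite /= !size_nseq.
  refine (step u _ _ k h (nu2 h k) se uL (inL2 h k hL kL) (inL2 k h kL hL) kL hL _ _ o1).
    by rewrite lam_swap ler_peMl// l0.
  by rewrite lam_swap ler_peMl// l0.
by rewrite rc_; apply: (IH _ (nseq m h) _ h) => //; rewrite ?size_nseq//; [exact: uL'|exact: inL_nseq|rewrite -rc_].
Qed.

End OneSide.

(** [L] consists of the letters of the two given words and their final letters; both words are
    padded to one length beyond the threshold of [L]. *)
Lemma all_one_side (A : set {poly C}) (M : R) (P Q : set C) : postcritically_bounded A M ->
  closed P -> closed Q -> P `&` Q = set0 ->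
  (forall s x, word_in A s -> A x -> bd (pull s x) `<=` P `|` Q) ->
  forall s x s' x', word_in A s -> A x -> word_in A s' -> A x' ->
  bd (pull s x) `<=` P -> bd (pull s' x') `<=` P.
Proof.
move=> hA cP cQ PQ0 PQ s x s' x' sA xA sA' xA'.
pose L := x :: x' :: s ++ s'.
have LA : word_in A L.
  by apply/word_in_cons; split=> //; apply/word_in_cons; split=> //; apply/word_in_cat.
have [n0 n0P] := onP_chain hA LA cP cQ PQ0 PQ.
pose n := (n0 + size s + size s')%N.
have := n0P n [::] (s ++ nseq (n - size s) x) (s' ++ nseq (n - size s') x') x x'.
rewrite /onP !cat0s !pull_pad; apply => //.
- by rewrite add0n /n -addnA leq_addr.
- by rewrite size_cat size_nseq subnKC// /n -addnA addnCA leq_addr.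
- by rewrite size_cat size_nseq subnKC// /n leq_addl.
- by move=> h; rewrite mem_cat /L !inE mem_cat mem_nseq => /orP[->|/andP[_ /eqP ->]]; rewrite ?orbT ?eqxx.
- by move=> h; rewrite mem_cat /L !inE mem_cat mem_nseq => /orP[->|/andP[_ /eqP ->]]; rewrite ?orbT ?eqxx ?orbT.
- by rewrite /L !inE eqxx.
- by rewrite /L !inE eqxx orbT.
Qed.

End Chain.

(** * Equicontinuity off the boundaries *)

Section Equicontinuity.
Variable R : realType.
Local Notation C := (Cplx R).
Implicit Types (p h : {poly C}) (s : seq {poly C}).

(** [ln |h(w)|] is [2 * ln |w|] up to a bounded error for large [w]. Truncating the modulus below at
    [r0 >= 1] extends the upper bound to all [w] and keeps logarithms nonnegative. *)
Lemma growth h : size h = 3%N -> exists r0 k : R, [/\ 1 <= r0, escapes r0 h, 0 <= k,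
  forall w, ln (Num.max (cabs h.[w]) r0) <= 2 * ln (Num.max (cabs w) r0) + k &
  forall w, r0 <= cabs w -> 2 * ln (cabs w) - k <= ln (cabs h.[w])].
Proof.
move=> sh; have [r er] := escapes_exists sh.
have a0 : 0 < cabs h`_2 by rewrite cabs_gt0 quad_lead.
set a := cabs h`_2 in a0; pose b := cabs h`_1; pose c := cabs h`_0.
have b0 : 0 <= b := cabs_ge0 _; have c0 : 0 <= c := cabs_ge0 _.
have hE w : h.[w] = h`_2 * w ^+ 2 + (h`_1 * w + h`_0).
  rewrite horner_coef sh !big_ord_recl big_ord0 /= /bump /= ?addn0 ?add0n ?addn1.
  by ring.
(* Beyond this radius the lower-order terms of [h] are at most half the leading term. *)
pose r0 := Num.max r (1 + 2 * (b + c) / a).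
have r01 : 1 <= r0.
  rewrite le_max; apply/orP; right; rewrite lerDl divr_ge0 ?(ltW a0)//.
  by rewrite mulr_ge0// addr_ge0.
have r00 : 0 < r0 by apply: lt_le_trans r01.
pose S := a + b + c + 1.
have S1 : 1 <= S by rewrite /S lerDr !addr_ge0// ltW.
have S0 : 0 < S by apply: lt_le_trans S1.
exists r0, (ln S + `|ln (a / 2)|); split => //.
- by apply: escapes_le er; rewrite le_max lexx.
- by rewrite addr_ge0// ln_ge0.
- move=> w; set m := Num.max (cabs w) r0.
  have m1 : 1 <= m by rewrite le_max r01 orbT.
  have m0 : 0 < m by apply: lt_le_trans m1.
  have wm : cabs w <= m by rewrite le_max lexx.
  have mS : Num.max (cabs h.[w]) r0 <= S * m ^+ 2.
    have rm : r0 <= m by rewrite le_max lexx orbT.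
    rewrite ge_max; apply/andP; split; last first.
      apply: (le_trans rm); rewrite expr2 mulrA ler_peMl// ?(ltW m0)//.
      by rewrite -[1]mulr1 ler_pM.
    rewrite hE; apply: le_trans (cabsD _ _) _.
    have t1 : cabs (h`_2 * w ^+ 2) <= a * m ^+ 2.
      by rewrite (cabsM h`_2 (w ^+ 2)) cabsX ler_wpM2l ?(ltW a0)// lerXn2r ?nnegrE ?cabs_ge0// ltW.
    have t2 : cabs (h`_1 * w + h`_0) <= (b + c) * m ^+ 2.
      apply: le_trans (cabsD _ _) _; rewrite cabsM -/b -/c mulrDl lerD//.
        rewrite ler_wpM2l// (le_trans wm)// expr2 ler_peMl// ltW//.
      by rewrite ler_peMr// expr2 -[1]mulr1 ler_pM.
    apply: (le_trans (lerD t1 t2)); rewrite -mulrDl ler_wpM2r ?exprn_ge0 ?(ltW m0)//.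
    by rewrite /S; lra.
  have M0 : 0 < Num.max (cabs h.[w]) r0 by rewrite lt_max r00 orbT.
  have : ln (Num.max (cabs h.[w]) r0) <= ln (S * m ^+ 2).
    by rewrite ler_ln ?posrE// mulr_gt0// exprn_gt0.
  rewrite lnM ?posrE ?exprn_gt0// (lnXn 2 m0) => h1.
  by have := normr_ge0 (ln (a / 2)); lra.
- move=> w rw; have w0 : 0 < cabs w by apply: lt_le_trans rw.
  have w1 : 1 <= cabs w by apply: le_trans rw.
  have wa : 2 * (b + c) <= a * cabs w.
    rewrite [leRHS]mulrC -ler_pdivrMr//; apply: le_trans rw.
    by rewrite le_max; apply/orP; right; rewrite lerDr.
  have hb : a / 2 * cabs w ^+ 2 <= cabs h.[w].
    have := cabs_subD (h`_2 * w ^+ 2) (h`_1 * w + h`_0); rewrite -hE.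
    have := cabsD (h`_1 * w) h`_0.
    rewrite (cabsM h`_1) (cabsM h`_2 (w ^+ 2)) cabsX -/a -/b -/c.
    have : 2 * (b + c) * cabs w <= a * cabs w ^+ 2 by rewrite expr2 mulrA ler_wpM2r ?cabs_ge0.
    have : c <= c * cabs w by rewrite ler_peMr.
    by move: (cabs w) => t; rewrite !mulrDr !mulrDl; lra.
  have a2 : 0 < a / 2 by rewrite divr_gt0.
  have p0 : 0 < a / 2 * cabs w ^+ 2 by rewrite mulr_gt0// exprn_gt0.
  have : ln (a / 2 * cabs w ^+ 2) <= ln (cabs h.[w]).
    by rewrite ler_ln ?posrE// (lt_le_trans p0).
  rewrite lnM ?posrE ?exprn_gt0// (lnXn 2 w0).
  have : - `|ln (a / 2)| <= ln (a / 2) by rewrite lerNl -normrN ler_norm.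
  by have := ln_ge0 S1; lra.
Qed.

Section FixedLetter.
Variables (h : {poly C}) (r0 k : R).
Hypotheses (sh : size h = 3%N) (r01 : 1 <= r0) (eh : escapes r0 h) (k0 : 0 <= k).
Hypothesis up : forall w, ln (Num.max (cabs h.[w]) r0) <= 2 * ln (Num.max (cabs w) r0) + k.
Hypothesis low : forall w, r0 <= cabs w -> 2 * ln (cabs w) - k <= ln (cabs h.[w]).

Definition Mx (w : C) : R := Num.max (cabs w) r0.

Lemma Mx_ge1 w : 1 <= Mx w.
Proof. by rewrite le_max r01 orbT. Qed.
Lemma Mx_gt0 w : 0 < Mx w.
Proof. by apply: lt_le_trans (Mx_ge1 w). Qed.
Lemma lnMx_ge0 w : 0 <= ln (Mx w).
Proof. exact/ln_ge0/Mx_ge1. Qed.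

(** Shifting by [k] turns the recursion [u -> 2 u + k] into a doubling; [lower_iter] shifts by
    [- k]. *)
Lemma upper_iter m w : ln (Mx (itp h m).[w]) <= 2 ^+ m * (ln (Mx w) + k).
Proof.
suff : ln (Mx (itp h m).[w]) + k <= 2 ^+ m * (ln (Mx w) + k).
  by apply: le_trans; rewrite lerDl.
elim: m => [|m IH]; first by rewrite itp0 mul1r.
rewrite itpSr exprS -mulrA; have := up (itp h m).[w]; rewrite -/(Mx _) -/(Mx _).
move: IH; set X := 2 ^+ m * _; set Y := ln _; set Z := ln _ => h1 h2; lra.
Qed.

Lemma lower_iter m w : r0 <= cabs w -> 2 ^+ m * (ln (cabs w) - k) <= ln (cabs (itp h m).[w]).
Proof.
move=> rw; suff : 2 ^+ m * (ln (cabs w) - k) <= ln (cabs (itp h m).[w]) - k.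
  by move=> /le_trans; apply; rewrite gerBl.
elim: m => [|m IH]; first by rewrite itp0 mul1r.
have rm : r0 <= cabs (itp h m).[w].
  apply: (le_trans rw); apply: le_trans (escapes_iter m eh rw).
  by rewrite ler_peMl ?cabs_ge0// exprn_ege1// ler1n.
rewrite itpSr exprS -mulrA; have := low rm.
by move: IH; set X := 2 ^+ m * _; set Y := ln _; set Z := ln _ => h1 h2; lra.
Qed.

Lemma bd_connected_dichotomy s (D : set C) : connected D -> (forall z, D z -> ~ bd (pull s h) z) ->
  D `<=` pull s h \/ D `&` pull s h = set0.
Proof.
move=> cD Db; have [e|/set0P e] := eqVneq (D `&` pull s h) set0; first by right.
left=> z Dz; apply: contrapT => nz.
have [p [Dp bp]] : D `&` bd (pull s h) !=set0 by apply: connected_bd cD e _; exists z.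
exact: Db bp.
Qed.

(** Harnack is applied to h^n o s with [n] depending on [s]. The factor 2^n from [lower_iter] at [y]
    and [upper_iter] at [z] cancels, leaving constants independent of [s]. *)
Lemma harnack_word s (x0 : C) (r : R) : 0 < r ->
  (forall z, cabs (z - x0) <= r -> ~ bd (pull s h) z) ->
  forall y z, cabs (y - x0) <= r / 8 -> cabs (z - x0) <= r / 8 ->
  ln (Mx (wpoly s).[y]) <= expR 2 * ln (Mx (wpoly s).[z]) + (1 + expR 2) * k.
Proof.
move=> rp Db y z yr zr.
have E1 : 1 <= expR 2 :> R by rewrite -[leLHS]expR0 ler_expR.
have E0 : 0 < expR 2 :> R by exact: expR_gt0.
have triv : cabs (wpoly s).[y] <= r0 ->
    ln (Mx (wpoly s).[y]) <= expR 2 * ln (Mx (wpoly s).[z]) + (1 + expR 2) * k.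
  move=> h1; have -> : Mx (wpoly s).[y] = r0 by rewrite /Mx max_r.
  have : ln r0 <= ln (Mx (wpoly s).[z]).
    by rewrite ler_ln ?posrE ?Mx_gt0 ?(lt_le_trans ltr01)// le_max lexx orbT.
  have : ln (Mx (wpoly s).[z]) <= expR 2 * ln (Mx (wpoly s).[z]) by rewrite ler_peMl// lnMx_ge0.
  have : 0 <= (1 + expR 2) * k by rewrite mulr_ge0// addr_ge0// ltW.
  lra.
have [sub|dis] := bd_connected_dichotomy (@ball_connected R x0 r) Db.
  have yr1 : cabs (y - x0) <= r by lra.
  by apply: triv; have := (pullP s eh y).1 (sub y yr1) 0%N; rewrite itp0.
have cB : compact [set z : C | cabs (z - x0) <= r] := @closed_disc_compact R x0 r.
have [n nP] := pull_escape_uniform eh 1 cB dis.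
have [/triv//|/ltW ry] := leP (cabs (wpoly s).[y]) r0.
(* Harnack is centered at [z]: the disc of radius [r / 2] about [z] stays in the given one, and [y]
   is within [r / 4] of [z]. *)
have r2 : 0 < r / 2 by rewrite divr_gt0.
have q1 w : cabs (w - z) <= r / 2 -> 1 < cabs (itp h n \Po wpoly s).[w].
  move=> wz; rewrite horner_comp; apply: nP => //=.
  by have := cabs_tri w x0 z; lra.
have H := @harnack R (itp h n \Po wpoly s) z (r / 2) r2 q1 y.
have {}H : ln (cabs (itp h n).[(wpoly s).[y]]) <= expR 2 * ln (cabs (itp h n).[(wpoly s).[z]]).
  move: H; rewrite !horner_comp; apply.
  by have := cabs_tri y z x0; rewrite (cabsB x0 z); lra.
have l := lower_iter n ry.
have u := upper_iter n (wpoly s).[z].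
have uu : ln (cabs (itp h n).[(wpoly s).[z]]) <= ln (Mx (itp h n).[(wpoly s).[z]]).
  have c0 : 0 < cabs (itp h n).[(wpoly s).[z]].
    by apply: (lt_trans ltr01); apply: nP => //=; lra.
  by rewrite ler_ln ?posrE ?Mx_gt0// le_max lexx.
have p2 : 0 < 2 ^+ n :> R by rewrite exprn_gt0.
have : 2 ^+ n * (ln (cabs (wpoly s).[y]) - k) <= 2 ^+ n * (expR 2 * (ln (Mx (wpoly s).[z]) + k)).
  apply: (le_trans l); apply: (le_trans H); rewrite mulrCA ler_pM2l//.
  exact: le_trans uu u.
rewrite ler_pM2l// => h2; rewrite {1}/Mx max_l//.
by move: h2; move: (ln (Mx _)) (ln (cabs _)) (expR 2) => X Y E; lra.
Qed.

(* Either both values are close to each other, or both are large: this is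
   equicontinuity for the chordal metric. *)
Lemma equicontinuous_finite (W : set (seq {poly C})) (x0 : C) (r : R) : 0 < r ->
  (forall s, W s -> forall z, cabs (z - x0) <= r -> ~ bd (pull s h) z) ->
  forall e, 0 < e -> exists2 d : R, 0 < d & forall s y, W s -> cabs (y - x0) < d ->
    cabs ((wpoly s).[y] - (wpoly s).[x0]) < e \/
    (e^-1 < cabs (wpoly s).[y] /\ e^-1 < cabs (wpoly s).[x0]).
Proof.
move=> rp Db e e0.
pose E : R := expR 2; have E0 : 0 < E by exact: expR_gt0.
have E1 : 1 <= E by rewrite -[leLHS]expR0 ler_expR.
pose kk := (1 + E) * k; have kk0 : 0 <= kk by rewrite mulr_ge0// addr_ge0// ltW.
pose b := Num.max e^-1 r0; have b1 : 1 <= b by rewrite le_max r01 orbT.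
have b0 : 0 < b by apply: lt_le_trans b1.
(* Above [T] at [x0], the Harnack bound from [x0] to [y] puts [ln b] below [ln (Mx _)] at [y].
   Otherwise the bound from [y] to [x0] gives [|s(y)| <= B] on a disc, and [schwarz] applies. *)
pose T := E * ln b + kk.
have T0 : 0 <= T by rewrite addr_ge0// mulr_ge0 ?ln_ge0// ltW.
pose B := expR (E * T + kk); have B0 : 0 < B by exact: expR_gt0.
have r8 : 0 < r / 8 by rewrite divr_gt0.
exists (Num.min (r / 8) (e / (2 * B / (r / 8) + 1))).
  by rewrite lt_min r8 divr_gt0// addr_gt0// !mulr_gt0// invr_gt0.
move=> s y Ws; rewrite lt_min => /andP[y8 ye].
have x8 : cabs (x0 - x0) <= r / 8 by rewrite subrr cabs0 ltW.
have HW u v := @harnack_word s x0 r rp (Db s Ws) u v.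
have [big|small] := ltP T (ln (Mx (wpoly s).[x0])).
  right.
  have large z : ln b < ln (Mx (wpoly s).[z]) -> e^-1 < cabs (wpoly s).[z].
    rewrite ltr_ln ?posrE ?Mx_gt0// /b /Mx lt_max.
    move=> /orP[|]; last by rewrite gt_max ltxx andbF.
    by rewrite gt_max => /andP[].
  split; apply: large.
    have := HW x0 y x8 (ltW y8); rewrite -/E -/kk => h1.
    have : T < E * ln (Mx (wpoly s).[y]) + kk by apply: lt_le_trans h1.
    by rewrite /T ltrD2r ltr_pM2l.
  apply: le_lt_trans big; rewrite /T; apply: (@le_trans _ _ (E * ln b)).
    by rewrite ler_peMl// ln_ge0.
  by rewrite lerDl.
left.
have bound z : cabs (z - x0) <= r / 8 -> cabs (wpoly s).[z] <= B.
  move=> z8; have := HW z x0 z8 x8; rewrite -/E -/kk => h1.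
  have h2 : ln (Mx (wpoly s).[z]) <= E * T + kk.
    by apply: (le_trans h1); rewrite lerD2r ler_pM2l.
  apply: (@le_trans _ _ (Mx (wpoly s).[z])); first by rewrite le_max lexx.
  by rewrite -(lnK (_ : Mx _ \in Num.pos)) ?posrE ?Mx_gt0// ler_expR.
apply: le_lt_trans (schwarz r8 B0 bound y8) _.
have q0 : 0 <= 2 * B / (r / 8) by rewrite !mulr_ge0 ?invr_ge0 ?(ltW B0) ?(ltW r8).
move: ye; rewrite ltr_pdivlMr ?ltr_wpDl// mulrC; apply: le_lt_trans.
by rewrite ler_wpM2r ?cabs_ge0// lerDl.
Qed.

End FixedLetter.
End Equicontinuity.

(** * Uniform growth of words near infinity *)

Section AtInfinity.
Variable R : realType.
Local Notation C := (Cplx R).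
Variables (h : {poly C}) (r0 k : R).
Hypotheses (sh : size h = 3%N) (r01 : 1 <= r0) (eh : escapes r0 h) (k0 : 0 <= k).
Hypothesis up : forall w, ln (Num.max (cabs h.[w]) r0) <= 2 * ln (Num.max (cabs w) r0) + k.

(* Compare z^N with the polynomial h^m o s, of degree N, outside a disc. *)
Lemma far_word s (R1 rs : R) : quads s -> pull s h !=set0 -> 0 < R1 ->
  (forall z, pull s h z -> cabs z <= rs) ->
  (forall z, bd (pull s h) z -> cabs z <= R1) ->
  forall z, R1 + 1 < cabs z -> ln (cabs z / (R1 + 1)) <= ln 2 + k + ln (Mx r0 (wpoly s).[z]).
Proof.
move=> qs [b Tb] R10 Trs Tbd.
(* The exterior of the disc is connected, avoids the boundary and contains points outside the
   bounded set. *)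
have Tin z : pull s h z -> cabs z <= R1.
  move=> Tz; rewrite leNgt; apply/negP => zR.
  have [p [/= pR bp]] : [set z : C | R1 < cabs z] `&` bd (pull s h) !=set0.
    apply: (connected_bd (outside_connected R1 R10)); first by exists z.
    pose m := Num.max R1 rs + 1.
    have m1 : R1 < m by rewrite /m ltr_pwDr// le_max lexx.
    have m2 : rs < m by rewrite /m ltr_pwDr// le_max lexx orbT.
    have cm : cabs (rc m) = m by rewrite cabs_rc gtr0_norm// (lt_trans R10).
    by exists (rc m); split; rewrite /= ?cm//; move=> /Trs; rewrite cm leNgt m2.
  by have := Tbd p bp; rewrite leNgt pR.
move=> z; set R2 := R1 + 1 => zR2.
have R20 : 0 < R2 by rewrite /R2; lra.
have R2n : rc R2^-1 != 0 by rewrite rc_eq0 gt_eqF// invr_gt0.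
have r00 : 0 < r0 by exact: eh.1.
pose U := [set z : C | R2 < cabs z].
have oU : open U by apply: open_comp (@open_gt _ R2) => w _; exact: cabs_continuous.
have clU w : closure U w -> R2 <= cabs w.
  move=> cw; rewrite leNgt; apply/negP => wR.
  have e0 : 0 < R2 - cabs w by rewrite subr_gt0.
  have [y Uy yw] := (closureCP U w).1 cw _ e0.
  by have := cabs_sub y w; move: Uy; rewrite /U /=; lra.
have clT w : closure U w -> ~ pull s h w.
  by move=> /clU wR /Tin; rewrite /R2 in wR; lra.
pose D := closure U `&` ~` U.
have cD : compact D.
  apply: (subclosed_compact _ (@disc_compact R R2)).
    by apply: closedI; [exact: closed_closure|exact: open_closedC].
  by move=> w [_ nU] /=; rewrite leNgt; apply/negP.
have DT : D `&` pull s h = set0.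
  by apply/seteqP; split=> // w [[cw _]]; exact: clT.
have [m mP] := pull_escape_uniform eh (r0 + 1) cD DT.
pose N := (2 ^ size (s ++ nseq m h))%N.
have NE : N = (2 ^ size s * 2 ^ m)%N by rewrite /N size_cat size_nseq expnD.
have q : quads (s ++ nseq m h).
  by move=> g; rewrite mem_cat => /orP[/qs//|]; rewrite mem_nseq => /andP[_ /eqP ->].
pose w0 := (wpoly (s ++ nseq m h)).[b].
pose Q := wpoly (s ++ nseq m h) - w0%:P.
pose P : {poly C} := (rc R2^-1) ^+ N *: 'X^N.
have Npos : (0 < N)%N by rewrite expn_gt0.
have sw : size (wpoly (s ++ nseq m h)) = N.+1 by rewrite size_wpoly.
have sw0 : (size w0%:P < N.+1)%N by apply: leq_ltn_trans (size_polyC_leq1 _) _.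
have sQ : size Q = N.+1 by rewrite /Q size_polyDl ?size_polyN sw.
have sP : (size P <= N.+1)%N by apply: leq_trans (size_scale_leq _ _) _; rewrite size_polyXn.
have PE w : cabs P.[w] = (cabs w / R2) ^+ N.
  rewrite /P hornerZ hornerXn -exprMn cabsX cabsM cabs_rc gtr0_norm ?invr_gt0//.
  by rewrite mulrC.
have QE w : Q.[w] = (itp h m).[(wpoly s).[w]] - w0.
  by rewrite /Q hornerD hornerN hornerC wpoly_cat.
have w0r : cabs w0 <= r0 by rewrite /w0 wpoly_cat; exact: (pullP s eh b).1 Tb m.
have Q0 w : closure U w -> Q.[w] != 0.
  move=> cw; rewrite QE subr_eq0; apply/eqP => hh; apply: (clT w cw).
  rewrite -(pull_pad s h m) /pull /= wpoly_cat -/(itp h m) hh.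
  by have : pull (s ++ nseq m h) h b by rewrite pull_pad.
have PQ w : closure U w -> ~ U w -> cabs P.[w] <= 1 * cabs Q.[w].
  move=> cw nU; have wR : cabs w = R2.
    by apply/eqP; rewrite eq_le clU// andbT leNgt; apply/negP.
  rewrite PE wR divff ?gt_eqF// expr1n mul1r QE.
  have := mP m w (leqnn _) (conj cw nU).
  by have := cabs_sub (itp h m).[(wpoly s).[w]] w0; lra.
have UR w : U w -> R2 <= cabs w by move=> /ltW.
have RU w : R2 + 1 <= cabs w -> U w by rewrite /U /=; lra.
have [H _] := exterior_max oU R20 ltr01 UR RU sP sQ Q0 PQ.
have := H z zR2; rewrite PE mul1r QE => le.
set X := cabs z / R2 in le *.
have X1 : 1 < X by rewrite /X ltr_pdivlMr// mul1r.
have X0 : 0 < X by apply: lt_trans X1.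
set qz := (itp h m).[_] in le.
have le2 : X ^+ N <= 2 * Mx r0 qz.
  apply: (le_trans le); apply: le_trans (cabsBD _ _) _.
  rewrite mulr2n mulrDl mul1r; apply: lerD; first by rewrite /Mx le_max lexx.
  by rewrite /Mx le_max w0r orbT.
have lnle : ln X *+ N <= ln 2 + ln (Mx r0 qz).
  have M0 : 0 < Mx r0 qz := Mx_gt0 r01 qz.
  have M2 : 0 < 2 * Mx r0 qz by apply: mulr_gt0.
  have XN : 0 < X ^+ N by apply: exprn_gt0.
  by rewrite -lnXn// -lnM ?posrE// ler_ln ?posrE.
have u := upper_iter k0 up m (wpoly s).[z]; rewrite -/qz in u.
have lnX0 : 0 <= ln X by apply: ln_ge0; exact: ltW.
have p1 : 1 <= 2 ^+ m :> R by rewrite exprn_ege1// ler1n.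
have p0 : 0 < 2 ^+ m :> R by apply: lt_le_trans p1.
have ln2 : 0 <= ln 2 :> R by apply: ln_ge0; rewrite ler1n.
(* [N] is at least 2^m whatever the length of [s], so the final bound is uniform in [s]. *)
have hN : 2 ^+ m * ln X <= ln X *+ N.
  have -> : 2 ^+ m * ln X = ln X *+ (2 ^ m) by rewrite -(mulr_natl (ln X)) natrX.
  by rewrite ler_wpMn2l// NE leq_pmull// expn_gt0.
rewrite -(ler_pM2l p0); apply: (le_trans hN); apply: (le_trans lnle).
apply: (@le_trans _ _ (2 ^+ m * ln 2 + 2 ^+ m * (ln (Mx r0 (wpoly s).[z]) + k))).
  by apply: lerD => //; rewrite ler_peMl.
by rewrite -mulrDr ler_pM2l//; lra.
Qed.

Lemma words_near_infinity (W : set (seq {poly C})) (R1 : R) : 0 < R1 ->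
  (forall s, W s -> quads s /\ pull s h !=set0) ->
  (forall s, W s -> exists rs : R, forall z, pull s h z -> cabs z <= rs) ->
  (forall s, W s -> forall z, bd (pull s h) z -> cabs z <= R1) ->
  forall B, exists R3 : R, forall s z, W s -> R3 < cabs z -> B < cabs (wpoly s).[z].
Proof.
move=> R10 W1 W2 W3 B.
pose b := Num.max B r0; have b0 : 0 < b by rewrite lt_max (lt_le_trans ltr01 r01) orbT.
exists ((R1 + 1) * Num.max 1 (expR (ln 2 + k + ln b))) => s z Ws zR.
have R20 : 0 < R1 + 1 by rewrite addr_gt0.
have [qs ne] := W1 s Ws; have [rs rsP] := W2 s Ws.
have zX : Num.max 1 (expR (ln 2 + k + ln b)) < cabs z / (R1 + 1).
  by rewrite ltr_pdivlMr// mulrC.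
have z1 : R1 + 1 < cabs z.
  apply: le_lt_trans zR; rewrite ler_peMr ?(ltW R20)//.
  by rewrite le_max lexx.
have := far_word qs ne R10 rsP (W3 s Ws) z1.
have X0 : 0 < cabs z / (R1 + 1) by apply: le_lt_trans zX; rewrite le_max ler01.
move: zX; rewrite gt_max => /andP[_ zX].
have : ln 2 + k + ln b < ln (cabs z / (R1 + 1)).
  by rewrite -[ltLHS]expRK ltr_ln ?posrE ?expR_gt0.
move=> h1 h2; have : ln b < ln (Mx r0 (wpoly s).[z]) by move: (lt_le_trans h1 h2); rewrite ltrD2l.
rewrite ltr_ln ?posrE ?(Mx_gt0 r01)// /b /Mx lt_max.
by move=> /orP[|]; rewrite gt_max ?ltxx ?andbF// => /andP[].
Qed.

End AtInfinity.

(** * The sphere *)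

Section Sphere.
Variable R : realType.
Local Notation C := (Cplx R).
Local Notation S2 := (sphere R).

Definition sz (z : C) : R := Num.sqrt (1 + cabs z ^+ 2).

Definition chord (x y : S2) : R :=
  match x, y with
  | Some z, Some w => 2 * cabs (z - w) / (sz z * sz w)
  | Some z, None | None, Some z => 2 / sz z
  | None, None => 0
  end.

Lemma sz_sqr z : sz z ^+ 2 = 1 + cabs z ^+ 2.
Proof. by rewrite sqr_sqrtr// addr_ge0// exprn_ge0// cabs_ge0. Qed.
Lemma sz_ge1 z : 1 <= sz z.
Proof.
by rewrite -(@ler_pXn2r _ 2) ?nnegrE ?sqrtr_ge0// expr1n sz_sqr lerDl exprn_ge0// cabs_ge0.
Qed.
Lemma sz_gt0 z : 0 < sz z.
Proof. exact: lt_le_trans ltr01 (sz_ge1 z). Qed.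
Lemma sz_ge z : cabs z <= sz z.
Proof.
rewrite -(@ler_pXn2r _ 2) ?nnegrE ?cabs_ge0 ?(ltW (sz_gt0 z))// sz_sqr; lra.
Qed.
Lemma sz_le z : sz z <= 1 + cabs z.
Proof.
rewrite -(@ler_pXn2r _ 2) ?nnegrE ?(ltW (sz_gt0 z))// ?addr_ge0 ?cabs_ge0// sz_sqr.
by have := cabs_ge0 z; move: (cabs z) => t; nra.
Qed.

Lemma chordalE x y : chordal x y = rc (chord x y).
Proof.
have sq z : sqrtC (1 + `|z| ^+ 2) = rc (sz z) :> C.
  rewrite cabsE -rcX -rc1 -rcD -sz_sqr rcX sqrCK//.
  by rewrite -[0 : C]rc0 rc_le ltW// sz_gt0.
case: x => [z|]; case: y => [w|] //=; rewrite ?sq ?cabsE.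
- by rewrite rcM rcV !rcM rc_nat.
- by rewrite rcM rcV rc_nat.
- by rewrite rcM rcV rc_nat.
Qed.

Lemma chordC x y : chord x y = chord y x.
Proof. by case: x => [z|]; case: y => [w|] //=; rewrite cabsB [sz z * _]mulrC. Qed.

Lemma chord_fin_le (z w : C) : chord (Some z) (Some w) <= 2 * cabs (z - w).
Proof.
rewrite /= ler_pdivrMr ?mulr_gt0 ?sz_gt0// ler_peMr ?mulr_ge0 ?cabs_ge0//.
by rewrite -[1]mulr1 ler_pM ?sz_ge1.
Qed.

Lemma cs_chord (w v : C) : cabs (1 + w * (v^*)%C) <= sz w * sz v.
Proof.
have h : cabs (1 + w * (v^*)%C) <= 1 + cabs w * cabs v.
  by apply: le_trans (cabsD _ _) _; rewrite cabs1 cabsM cabs_conj.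
apply: (le_trans h).
have a1 : 0 <= 1 + cabs w * cabs v by rewrite addr_ge0// mulr_ge0 ?cabs_ge0.
have a2 : 0 <= sz w * sz v by rewrite mulr_ge0 ?(ltW (sz_gt0 _)).
rewrite -(@ler_pXn2r _ 2) ?nnegrE//.
rewrite exprMn !sz_sqr; have := sqr_ge0 (cabs w - cabs v).
by move: (cabs w) (cabs v) => a b; nra.
Qed.

Lemma sz_lip (z v : C) : sz v <= cabs (z - v) + sz z.
Proof.
rewrite -(@ler_pXn2r _ 2) ?nnegrE ?(ltW (sz_gt0 _)) ?addr_ge0 ?cabs_ge0 ?(ltW (sz_gt0 _))//.
rewrite sqrrD !sz_sqr.
have h : cabs v <= cabs (z - v) + cabs z by have := cabs_sub v z; rewrite (cabsB v); lra.
have h2 := sz_ge z; have := cabs_ge0 v; have := cabs_ge0 z; have := cabs_ge0 (z - v).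
move: (cabs v) (cabs z) (cabs (z - v)) (sz z) h h2 => a b c d; nra.
Qed.

(** For finite points this is the identity [e] below combined with Cauchy-Schwarz for the vectors
    (1, w) and (1, v), which is [cs_chord]. *)
Lemma chord_triangle x y v : chord x y <= chord x v + chord v y.
Proof.
case: x => [z|]; case: y => [w|]; case: v => [v|] /=; rewrite ?add0r ?addr0 ?lexx//.
- have e : (z - w) * (1 + v * (v^*)%C) = (z - v) * (1 + w * (v^*)%C) + (v - w) * (1 + z * (v^*)%C).
    by ring.
  have sv : cabs (1 + v * (v^*)%C) = sz v ^+ 2.
    by rewrite mul_conjC -rc1 -rcD cabs_rc sz_sqr ger0_norm// addr_ge0// exprn_ge0// cabs_ge0.
  have h : cabs (z - w) * sz v ^+ 2 <= cabs (z - v) * (sz w * sz v) + cabs (v - w) * (sz z * sz v).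
    rewrite -sv -cabsM e; apply: le_trans (cabsD _ _) _; rewrite !cabsM.
    by apply: lerD; rewrite ler_wpM2l ?cabs_ge0// cs_chord.
  have [z0 w0 v0] : [/\ 0 < sz z, 0 < sz w & 0 < sz v] by split; exact: sz_gt0.
  rewrite [leRHS](_ : _ = 2 * (cabs (z - v) * (sz w * sz v) + cabs (v - w) * (sz z * sz v)) /
     (sz z * sz w * sz v ^+ 2)); last by field; rewrite !gt_eqF.
  rewrite ler_pdivlMr ?mulr_gt0 ?exprn_gt0//.
  rewrite [leLHS](_ : _ = 2 * (cabs (z - w) * sz v ^+ 2)); last by field; rewrite !gt_eqF.
  by rewrite ler_pM2l.
- have [z0 w0] : [/\ 0 < sz z & 0 < sz w] by split; exact: sz_gt0.
  rewrite [leRHS](_ : _ = 2 * (sz w + sz z) / (sz z * sz w)); last by field; rewrite !gt_eqF.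
  rewrite ler_pM2r ?invr_gt0 ?mulr_gt0// ler_pM2l//; apply: le_trans (cabsBD _ _) _.
  by rewrite addrC lerD// sz_ge.
- have [z0 v0] : [/\ 0 < sz z & 0 < sz v] by split; exact: sz_gt0.
  rewrite [leRHS](_ : _ = 2 * (cabs (z - v) + sz z) / (sz z * sz v)); last by field; rewrite !gt_eqF.
  rewrite (_ : 2 / sz z = 2 * sz v / (sz z * sz v)); last by field; rewrite !gt_eqF.
  by rewrite ler_pM2r ?invr_gt0 ?mulr_gt0// ler_pM2l// sz_lip.
- have [w0 v0] : [/\ 0 < sz w & 0 < sz v] by split; exact: sz_gt0.
  rewrite [leRHS](_ : _ = 2 * (cabs (w - v) + sz w) / (sz w * sz v)); last by rewrite (cabsB v w); field; rewrite !gt_eqF.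
  rewrite (_ : 2 / sz w = 2 * sz v / (sz w * sz v)); last by field; rewrite !gt_eqF.
  by rewrite ler_pM2r ?invr_gt0 ?mulr_gt0// ler_pM2l// sz_lip.
- by rewrite addr_ge0// divr_ge0// ltW// sz_gt0.
Qed.

Lemma nbhs_fin (z : C) (V : set S2) : nbhs (fin z : S2) V <-> nbhs z (fun w => V (fin w)).
Proof. by []. Qed.

Lemma nbhs_infty (V : set S2) : nbhs (@infty R) V <->
  V (@infty R) /\ exists r : R, forall z, r < cabs z -> V (fin z).
Proof.
split.
  move=> [K [cK _] KV]; split; first by apply: KV; right.
  have [K0|/set0P K0] := eqVneq K set0.
    by exists 0 => z _; apply: KV; left; exists z => //; rewrite K0.
  have [c _ cm] := compact_EVT_max K0 cK (continuous_subspaceT (@cabs_continuous R)).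
  exists (cabs c) => z cz; apply: KV; left; exists z => //.
  by move=> Kz; have := cm z (mem_set Kz); rewrite leNgt cz.
move=> [Vi [r rV]]; exists [set z : C | cabs z <= r].
  split; first exact: disc_compact.
  apply: (@closed_comp _ _ (@cabs R) [set y | y <= r]) => [y _|]; [exact: cabs_continuous|exact: closed_le].
move=> x [[z /= nz <-]|->] //; apply: rV; rewrite ltNge; exact/negP.
Qed.

Lemma chord_ball_nbhs (x : S2) (e : R) : 0 < e -> nbhs x [set y | chord y x < e].
Proof.
move=> e0; case: x => [z|].
  apply/nbhs_fin/nbhsC; exists (e / 2); first by rewrite divr_gt0.
  by move=> w wz /=; apply: le_lt_trans (chord_fin_le _ _) _; lra.
apply/nbhs_infty; split=> //; exists (2 / e) => z ze /=.
rewrite ltr_pdivrMr ?sz_gt0// mulrC -ltr_pdivrMr//; exact: lt_le_trans ze (sz_ge z).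
Qed.

(* The limit is taken along an ultrafilter. *)
Lemma ascoli (W : set (S2 -> S2)) (K : set S2) : compact K ->
  (forall x e, K x -> 0 < e -> exists2 V, nbhs x V & forall g y, W g -> V y -> chord (g y) (g x) < e) ->
  forall f : nat -> S2 -> S2, (forall n, W (f n)) ->
  exists (s : nat -> nat) (l : S2 -> S2), {homo s : m n / (m < n)%N} /\
    forall e : R, 0 < e -> \forall n \near \oo, forall x, K x -> chord (f (s n) x) (l x) < e.
Proof.
move=> cK eq f Wf.
have [F [UF subF]] := ultraFilterLemma (eventually_filter : ProperFilter (\oo : set_system nat)).
have PF : ProperFilter F by exact: ultra_proper.
have lim x : exists p : S2, (fun n => f n x) @ F --> p.
  have cS : compact [set: S2] := one_point_compactification_compact.
  have PfF : ProperFilter ((fun n => f n x) @ F) by exact: fmap_proper_filter.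
  have [p [_ clp]] := cS _ PfF filterT.
  exists p => V Vp; have [//|h] := in_ultra_setVsetC [set n | V (f n x)] UF.
  by have [y [nVy Vy]] := clp (~` V) V h Vp.
have [l lP] := choice lim.
have close x e : 0 < e -> F [set n | chord (f n x) (l x) < e].
  by move=> e0; exact: (lP x _ (chord_ball_nbhs (l x) e0)).
have unif e : 0 < e -> F [set n | forall x, K x -> chord (f n x) (l x) < e].
  move=> e0; have e8 : 0 < e / 8 by rewrite divr_gt0.
  move: (cK); rewrite compact_near_coveringP => /(_ nat F (fun n x => chord (f n x) (l x) < e)).
  apply => x Kx; have [V Vx VP] := eq x (e / 8) Kx e8.
  exists (V, [set n | chord (f n x) (l x) < e / 8]); first by split=> //; exact: close.
  move=> [y n] /= [Vy cn].
  (* An auxiliary index that is good at both [x] and [y]: it controls the limit at [y] by the limit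
     at [x], and five errors of [e / 8] add up. *)
  have [m [cm1 cm2]] := filter_ex (filterI (close x _ e8) (close y _ e8)).
  have h1 := VP _ y (Wf n) Vy; have h2 := VP _ y (Wf m) Vy.
  have := chord_triangle (f n y) (l y) (f n x).
  have := chord_triangle (f n x) (l y) (l x).
  have := chord_triangle (l x) (l y) (f m x).
  have := chord_triangle (f m x) (l y) (f m y).
  rewrite (chordC (l x) (f m x)) (chordC (f m x) (f m y)).
  by rewrite /= in cm1 cm2; lra.
have pick k N : exists n, (N < n)%N /\ forall x, K x -> chord (f n x) (l x) < k.+1%:R^-1.
  have k0 : 0 < k.+1%:R^-1 :> R by rewrite invr_gt0.
  have FN : F [set n | (N < n)%N] by apply: subF; exists N.+1.
  by have [n [n1 n2]] := filter_ex (filterI FN (unif _ k0)); exists n.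
have [c cP] := choice (fun kN : nat * nat => pick kN.1 kN.2).
pose s := fix s k := if k is k'.+1 then c (k'.+1, s k') else c (0%N, 0%N).
exists s, l; split.
  by apply: homo_ltn; [exact: ltn_trans|move=> n; exact: (cP (n.+1, s n)).1].
move=> e e0; have [N Ne] := ltr_add_invr e0; rewrite add0r in Ne.
exists N => // n /= Nn x Kx.
apply: (@lt_trans _ _ n.+1%:R^-1).
  by case: n {Nn} => [|n]; [exact: (cP (0%N, 0%N)).2|exact: (cP (n.+1, s n)).2].
by apply: le_lt_trans Ne; rewrite lef_pV2 ?posrE ?ltr0n// ler_nat ltnS.
Qed.

End Sphere.

(** * The Julia set of the semigroup *)

Section SemigroupWords.
Variable R : realType.
Local Notation C := (Cplx R).
Local Notation S2 := (sphere R).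
Implicit Types (s : seq {poly C}).
Variables (A G : set (S2 -> S2)).
Hypotheses (hA : forall g, A g -> has_degree 2 g) (hGA : G = generated_semigroup A).

Definition letters : set {poly C} := [set p : {poly C} | size p = 3%N /\ A (poly_map p)].

Lemma poly_map_comp (p q : {poly C}) : poly_map (p \Po q) = poly_map p \o poly_map q.
Proof. by apply/funext => -[z|] //=; rewrite horner_comp. Qed.

Lemma semigroup_word s : word_in letters s -> s != [::] -> G (poly_map (wpoly s)).
Proof.
rewrite hGA; elim: s => [//|h [|h' s] IH] /word_in_cons[[sh Ah] sA] _ H HH.
  by rewrite /= comp_polyX; exact: HH.2.
have IH' : H (poly_map (wpoly (h' :: s))) := IH sA isT H HH.
rewrite [wpoly _]/= poly_map_comp; exact: HH.1 IH' (HH.2 _ Ah).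
Qed.

Lemma semigroup_wordP g : G g -> exists s, [/\ s != [::], word_in letters s & g = poly_map (wpoly s)].
Proof.
rewrite hGA => Gg; apply: (Gg [set g | exists s, [/\ s != [::], word_in letters s & g = poly_map (wpoly s)]]).
split=> [f f' [s [s0 sA ->]] [s' [s0' sA' ->]]|f Af].
  exists (s' ++ s); split.
  - by rewrite -size_eq0 size_cat addn_eq0 negb_and size_eq0 s0'.
  - exact/word_in_cat.
  - by apply/funext => -[z|] //=; rewrite wpoly_cat.
have [p sp fp] := hA Af; exists [:: p]; split=> //.
  by apply/word_in_cons; split=> //; split=> //; rewrite -fp.
by rewrite /= comp_polyX.
Qed.

Lemma is_derive_horner (p : {poly C}) (z : C) : is_derive z (1 : C) (horner p) p^`().[z].
Proof.
have [b [r H]] := poly_taylor2 p z.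
have [M M0 MP] := disc_bounded r 1.
have cv : h^-1 *: (p.[h *: 1 + z] - p.[z]) @[h --> (0:C)^'] --> p^`().[z].
  move=> B /nbhsC [e e0 eB].
  have k0 : 0 < cabs b + M by rewrite ltr_wpDl ?cabs_ge0.
  apply/(nbhsC 0); exists (Num.min 1 (e / (cabs b + M))).
    by rewrite lt_min ltr01 divr_gt0.
  move=> h; rewrite subr0 lt_min => /andP[h1 he] hn0; apply: eB.
  rewrite /GRing.scale /= mulr1 [h + z]addrC H.
  rewrite (_ : _ - _ = h * (b + h * r.[h])); last by field.
  rewrite cabsM; apply: (@le_lt_trans _ _ (cabs h * (cabs b + M))); last by rewrite -ltr_pdivlMr.
  rewrite ler_wpM2l ?cabs_ge0//; apply: le_trans (cabsD _ _) _; rewrite lerD2l cabsM.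
  rewrite -[M]mul1r ler_pM ?cabs_ge0 ?(ltW h1)//.
  by apply: MP; exact: ltW.
have dv : derivable (horner p) z 1 by apply/cvg_ex; exists p^`().[z].
by apply: DeriveDef => //; exact: cvg_lim cv.
Qed.

Lemma deriv_crit (p : {poly C}) : size p = 3%N -> p^`().[crit p] = 0.
Proof.
move=> sp; have a0 := quad_lead sp.
have sd : (size p^`() <= 2)%N.
  by rewrite -ltnS -sp lt_size_deriv// -size_poly_eq0 sp.
rewrite (horner_coef_wide _ sd) !big_ord_recl big_ord0 /= !coef_deriv /crit /bump /=.
by field.
Qed.

(** By the chain rule the critical point of [h] is critical for the word [h :: s]; the charts at
    finite points are the identity, so [local_expr] is the polynomial itself. *)
Lemma postcritical_word h s : letters h -> word_in letters s ->
  postcritical G (fin (wpoly s).[h.[crit h]]).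
Proof.
move=> Ah sA; apply: subset_closure.
exists (poly_map (wpoly (h :: s))).
  by apply: semigroup_word => //; apply/word_in_cons.
exists (fin (crit h)); last by rewrite /= horner_comp.
rewrite /critical_point.
rewrite (_ : local_expr _ _ = horner (wpoly (h :: s))); last first.
  by apply/funext => w; rewrite /local_expr.
have -> : 0 = (wpoly (h :: s))^`().[crit h].
  by rewrite /= deriv_comp hornerM deriv_crit ?mulr0//; exact: Ah.1.
exact: is_derive_horner.
Qed.

Lemma calG_bounded : calG G -> exists M : R, postcritically_bounded letters M.
Proof.
move=> [_ _ [M [Mr HM]]].
have M1 : M < M + 1 by rewrite ltrDl.
exists (complex.Re (M + 1)); split; first by move=> h [].
move=> h s Ah sA.
have /(HM _ M1) : (@fin R @^-1` planar_postcritical G : set C) (wpoly s).[h.[crit h]].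
  by split=> //; exact: postcritical_word.
rewrite /= cabsE -[X in _ <= X -> _]RRe_real ?rpredD ?rpred1//.
by rewrite -[X in _ <= X]/(rc _) rc_le.
Qed.

End SemigroupWords.

(** * The Julia set as the closure of the union of the boundaries *)

Section JuliaSet.
Variable R : realType.
Local Notation C := (Cplx R).
Local Notation S2 := (sphere R).
Implicit Types (s : seq {poly C}) (x : {poly C}).
Variables (A G : set (S2 -> S2)) (M : R).
Hypotheses (hA : forall g, A g -> has_degree 2 g) (hGA : G = generated_semigroup A).
Local Notation Lt := (letters A).
Hypothesis hM : postcritically_bounded Lt M.

(* On pull s x the maps x^n o s stay bounded, off it they tend to infinity. *)
Lemma bd_pull_Julia s x (z : C) : word_in Lt s -> Lt x -> bd (pull s x) z -> Julia G (fin z).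
Proof.
move=> sA xA bz [U [oU Uz] nU].
have [r [er ex]] := word_escapes hM sA xA.
have r0 : 0 < r := ex.1.
pose f n := poly_map (wpoly (s ++ nseq n.+1 x)).
have fG n : G (f n).
  apply: (semigroup_word hGA).
    by apply/word_in_cat; split; [exact: sA|apply: word_in_nseq].
  by rewrite -size_eq0 size_cat size_nseq addnS.
have [sub [l [hsub H]]] := nU f fG.
have subge n : (n <= sub n)%N.
  by elim: n => // n IH; apply: leq_ltn_trans IH _; exact: hsub.
have /nbhsC [d d0 dU] : nbhs z (fun w => U (fin w)).
  exact: (open_nbhs_nbhs (conj oU Uz)).
pose D := [set w : C | cabs (w - z) <= d / 2].
have cD : compact D := @closed_disc_compact R z (d / 2).
have cK : compact (@fin R @` D).
  apply: continuous_compact cD; apply: continuous_subspaceT.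
  exact: one_point_compactification_some_continuous.
have KU : @fin R @` D `<=` U.
  by move=> _ [w Dw <-]; apply: dU; move: Dw; rewrite /D /=; lra.
(* A point of modulus at most [r + 1] is at chordal distance at least [4 * e] from infinity, whereas
   three approximations within [e] would bring it closer than [3 * e]. *)
pose e := (2 * (r + 2))^-1.
have r2 : 0 < r + 2 by rewrite addr_gt0.
have e0 : 0 < e by rewrite invr_gt0 mulr_gt0.
have rce : 0 < rc e by rewrite -rc0 rc_lt.
have [N _ HN] := H _ cK KU (rc e) rce.
have close n w : (N <= n)%N -> D w -> chord (f (sub n) (fin w)) (l (fin w)) < e.
  by move=> Nn Dw; rewrite -rc_lt -chordalE; apply: (HN n Nn); exists w.
pose q := wpoly (s ++ nseq (sub N).+1 x).
have Tz : pull s x z := bd_sub (pull_closed ex) bz.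
have qz : cabs q.[z] <= r by rewrite /q wpoly_cat; exact: (pullP s ex z).1 Tz (sub N).+1.
have /contCC/(_ 1 ltr01) [d1 d10 d1P] := @horner_continuous R q z.
have m0 : 0 < Num.min d1 (d / 2) by rewrite lt_min d10 divr_gt0.
(* [y] escapes in the end, but is so close to [z] that the single map [f (sub N)] still sends it
   into the disc of radius [r + 1]. *)
have [y nTy] := (closureCP _ z).1 bz.2 _ m0; rewrite lt_min => /andP[y1 y2].
have Dy : D y := ltW y2.
have qy : cabs q.[y] <= r + 1.
  by have := d1P y y1; have := cabs_sub q.[y] q.[z]; lra.
have y0T : [set y] `&` pull s x = set0 by apply/seteqP; split=> // w [-> /nTy].
have [n nP] := pull_escape_uniform ex (2 / e) (@compact_set1 _ y) y0T.
pose m := maxn N n.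
have big : 2 / e < cabs (wpoly (s ++ nseq (sub m).+1 x)).[y].
  have nm : (n <= (sub m).+1)%N.
    by apply: leq_trans (leqnSn _); apply: leq_trans (subge m); rewrite leq_maxr.
  by rewrite wpoly_cat; exact: (nP (sub m).+1 y nm erefl).
have c1 : chord (f (sub m) (fin y)) (@infty R) < e.
  rewrite /= ltr_pdivrMr ?sz_gt0// mulrC -ltr_pdivrMr//.
  exact: lt_le_trans big (sz_ge _).
have c2 := close m y (leq_maxl _ _) Dy.
have c3 := close N y (leqnn _) Dy.
have := chord_triangle (f (sub N) (fin y)) (@infty R) (l (fin y)).
have := chord_triangle (l (fin y)) (@infty R) (f (sub m) (fin y)).
rewrite (chordC (l (fin y)) (f (sub m) _)).
have : 4 * e <= chord (f (sub N) (fin y)) (@infty R).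
  rewrite /= -/q ler_pdivlMr ?sz_gt0//.
  apply: (@le_trans _ _ (4 * e * (r + 2))).
    rewrite ler_wpM2l ?mulr_ge0 ?(ltW e0)//; apply: le_trans (sz_le _) _; lra.
  by rewrite le_eqVlt; apply/orP; left; apply/eqP; rewrite /e; field; rewrite gt_eqF.
lra.
Qed.

Lemma Julia_closed : closed (Julia G).
Proof.
apply: open_closedC; rewrite openE => y [U [oU Uy] nU].
rewrite /interior nbhsE /=; exists U; first by split.
by move=> w Uw; exists U.
Qed.

Definition bdset : set C := [set z | exists s x, [/\ word_in Lt s, Lt x & bd (pull s x) z]].
(** The closure is taken in the sphere: boundaries may tend to infinity, as for the maps a z^2 with
    a tending to 0. *)
Definition limit_set : set S2 := closure (@fin R @` bdset).

Lemma bd_limit_set s x z : word_in Lt s -> Lt x -> bd (pull s x) z -> limit_set (fin z).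
Proof. by move=> sA xA bz; apply: subset_closure; exists z => //; exists s, x. Qed.

Lemma limit_set_sub_Julia : limit_set `<=` Julia G.
Proof.
rewrite /limit_set [X in _ `<=` X](closure_id _).1; last exact: Julia_closed.
apply: closureS => _ [z [s [x [sA xA bz]]] <-]; exact: bd_pull_Julia bz.
Qed.

(** One fixed letter [h] serves for the whole semigroup, since [limit_set] contains [bd (pull s h)]
    for every word [s]. *)
Lemma equicontinuous_off_limit_set h : Lt h -> forall (y : S2) (e : R), ~ limit_set y -> 0 < e ->
  exists2 V, nbhs y V & forall g w, G g -> V w -> chord (g w) (g y) < e.
Proof.
move=> Lh y e ny e0.
have sh : size h = 3%N := Lh.1.
have [r0 [k [r01 eh k0 up low]]] := growth sh.
have oO : open (~` limit_set) by apply: closed_openC; exact: closed_closure.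
have nO : nbhs y (~` limit_set) := open_nbhs_nbhs (conj oO ny).
have nbd s z : word_in Lt s -> (~` limit_set) (fin z) -> ~ bd (pull s h) z.
  by move=> sA nz bz; apply: nz; exact: bd_limit_set bz.
have WG g : G g -> exists2 s, word_in Lt s & g = poly_map (wpoly s).
  by move=> /(semigroup_wordP hA hGA)[s [_ sA ->]]; exists s.
case: y ny nO => [z0|] ny nO.
  have /nbhsC [d d0 dO] : nbhs z0 (fun w => (~` limit_set) (fin w)) by [].
  have d2 : 0 < d / 2 by rewrite divr_gt0.
  have e8 : 0 < e / 8 by rewrite divr_gt0.
  have Wbd s : word_in Lt s -> forall z, cabs (z - z0) <= d / 2 -> ~ bd (pull s h) z.
    move=> sA z zd; have zd2 : cabs (z - z0) < d by lra.
    exact (nbd s z sA (dO z zd2)).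
  have [c c0 cP] := equicontinuous_finite r01 eh k0 up low d2 Wbd e8.
  exists (@fin R @` [set w | cabs (w - z0) < c]).
    apply/nbhs_fin/nbhsC; exists c => // w wc; exists w => //.
  move=> g _ /WG[s sA ->] [w wc <-].
  have [near|[b1 b2]] := cP s w sA wc.
    by apply: le_lt_trans (chord_fin_le _ _) _; lra.
  have far u : (e / 8)^-1 < cabs u -> chord (fin u : S2) (@infty R) < e / 2.
    move=> hu; rewrite /= ltr_pdivrMr ?sz_gt0//.
    have := lt_le_trans hu (sz_ge u).
    rewrite -(ltr_pM2l e8) divff ?gt_eqF//; lra.
  apply: le_lt_trans (chord_triangle _ _ (@infty R)) _.
  by rewrite (chordC (@infty R)); have := far _ b1; have := far _ b2; rewrite /=; lra.
have [_ [r rO]] := (nbhs_infty _).1 nO.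
pose R1 := Num.max r 1.
have R10 : 0 < R1 by rewrite lt_max ltr01 orbT.
have W1 s : word_in Lt s -> quads s /\ pull s h !=set0.
  move=> sA; split; first by move=> g /sA [].
  exists h.[crit h]; exact (pull_critical_value hM Lh sA Lh).
have W2 s : word_in Lt s -> exists rs : R, forall z, pull s h z -> cabs z <= rs.
  move=> sA; have [rs [er ex]] := word_escapes hM sA Lh.
  by exists rs => z; exact: (pull_le er ex).
have W3 s : word_in Lt s -> forall z, bd (pull s h) z -> cabs z <= R1.
  move=> sA z bz; rewrite leNgt; apply/negP => zR; apply: (nbd s z sA _ bz).
  by apply: rO; apply: le_lt_trans zR; rewrite le_max lexx.
have [R3 R3P] := words_near_infinity sh r01 eh k0 up R10 W1 W2 W3 (2 / e).
exists [set w | w = @infty R \/ exists2 z, R3 < cabs z & w = fin z].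
  apply/nbhs_infty; split; first by left.
  by exists R3 => z zR; right; exists z.
move=> g w /WG[s sA ->] [->|[z zR ->]] //=.
rewrite ltr_pdivrMr ?sz_gt0// mulrC -ltr_pdivrMr//.
exact: lt_le_trans (R3P s z sA zR) (sz_ge _).
Qed.

Lemma compact_neighborhood (y : S2) (O : set S2) : open O -> O y ->
  exists K, [/\ compact K, K `<=` O & nbhs y K].
Proof.
move=> oO Oy; have nO : nbhs y O := open_nbhs_nbhs (conj oO Oy).
have cS : compact [set: S2] := one_point_compactification_compact.
case: y Oy nO => [z|] Oy nO.
  have /nbhsC [d d0 dO] : nbhs z (fun w => O (fin w)) by [].
  exists (@fin R @` [set w | cabs (w - z) <= d / 2]); split.
  - apply: continuous_compact.
      apply: continuous_subspaceT; exact: one_point_compactification_some_continuous.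
    exact (@closed_disc_compact R z (d / 2)).
  - by move=> _ [w /= wd <-]; apply: dO; lra.
  - apply/nbhs_fin/nbhsC; exists (d / 2); first by rewrite divr_gt0.
    by move=> w /ltW wd; exists w.
have [_ [r rO]] := (nbhs_infty _).1 nO.
exists (~` (@fin R @` [set w | cabs w < r + 1])); split.
- apply: (subclosed_compact _ cS) => //; apply: open_closedC.
  apply: one_point_compactification_open_some.
  by apply: (@open_comp _ _ (@cabs R) [set y | y < r + 1]) => [w _|]; [exact: cabs_continuous|exact: open_lt].
- move=> [w|] nw //; apply: rO; have [wr|wr] := ltP (cabs w) (r + 1); last by lra.
  by exfalso; apply: nw; exists w.
- apply/nbhs_infty; split; first by case.
  exists (r + 1) => z zr [w /= wr [wz]]; move: wr; rewrite wz; lra.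
Qed.

(** [ascoli] on a compact neighborhood off [limit_set] gives one subsequence that serves all compact
    subsets of its interior. *)
Lemma Julia_sub_limit_set : Lt !=set0 -> Julia G `<=` limit_set.
Proof.
move=> [h Lh] y; apply: contraPP => ny; apply.
have oO : open (~` limit_set) by apply: closed_openC; exact: closed_closure.
have [K [cK KO nK]] := compact_neighborhood oO ny.
exists (interior K); first by split; [exact: open_interior|exact: nK].
move=> f fG.
have eqK (v : S2) (e : R) : K v -> 0 < e ->
    exists2 V, nbhs v V & forall g w, G g -> V w -> chord (g w) (g v) < e.
  by move=> Kv; exact: (equicontinuous_off_limit_set Lh (KO _ Kv)).
have [sub [l [hsub H]]] := ascoli cK eqK fG.
exists sub, l; split=> // K' _ K'U e e0.
have er : e = rc (complex.Re e) by rewrite /rc RRe_real// ger0_real// ltW.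
have re0 : 0 < complex.Re e by rewrite -rc_lt -er.
have [N _ HN] := H _ re0; exists N => // n Nn v K'v.
by rewrite chordalE er rc_lt; exact: (HN n Nn v (interior_subset (K'U v K'v))).
Qed.

Lemma limit_set_connected : connected limit_set.
Proof.
move=> B [b Bb] [ O' oO BO] [F cF BF].
have cL : closed limit_set by exact: closed_closure.
have cfin : continuous (@fin R : C -> S2) by exact: one_point_compactification_some_continuous.
pose P := @fin R @^-1` (limit_set `&` F); pose Q := @fin R @^-1` (limit_set `&` ~` O').
have cP : closed P.
  by apply: (@closed_comp _ _ (@fin R : C -> S2)) => [z _|]; [exact: cfin|exact: (closedI cL cF)].
have cQ : closed Q.
  by apply: (@closed_comp _ _ (@fin R : C -> S2)) => [z _|]; [exact: cfin|exact: (closedI cL (open_closedC oO))].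
have PQ0 : P `&` Q = set0.
  apply/seteqP; split=> // z [[Lz Fz] [_ nO]]; apply: nO.
  by have : B (fin z); [rewrite BF|rewrite BO => -[]].
have PQ s x : word_in Lt s -> Lt x -> bd (pull s x) `<=` P `|` Q.
  move=> sA xA z bz; have Lz := bd_limit_set sA xA bz.
  have [Oz|nO] := pselect (O' (fin z)); last by right.
  by left; split=> //; have : B (fin z); [rewrite BO|rewrite BF => -[]].
(* An open set meeting a closure meets the set itself, so some planar boundary has a point in [B]
   even if [b] is infinity. *)
have [_ [[z [s [x [sA xA bz]]] <-] Oz]] : (@fin R @` bdset) `&` O' !=set0.
  move: Bb; rewrite BO => -[Lb Ob]; exact: (Lb O' (open_nbhs_nbhs (conj oO Ob))).
have Lz := bd_limit_set sA xA bz.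
have Pz : P z by split=> //; have : B (fin z); [rewrite BO|rewrite BF => -[]].
have sP : bd (pull s x) `<=` P.
  have [//|sQ] := onP_or_onQ hM cP cQ PQ0 PQ sA xA.
  by exfalso; rewrite -[False]/(set0 z) -PQ0; split=> //; exact: sQ.
have all s' x' : word_in Lt s' -> Lt x' -> bd (pull s' x') `<=` P.
  move=> sA' xA'; exact: (all_one_side hM cP cQ PQ0 PQ sA xA sA' xA' sP).
have LF : limit_set `<=` F.
  rewrite [X in _ `<=` X](closure_id _).1//; apply: closureS => _ [w [s' [x' [sA' xA' bw]]] <-].
  by have [] := all s' x' sA' xA' w bw.
by rewrite BF; apply/seteqP; split=> w; [case|move=> Lw; split=> //; exact: LF].
Qed.

End JuliaSet.

Theorem theorem2p15 (R : realType) (G : set (sphere R -> sphere R))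
    (A : set (sphere R -> sphere R))
    (hG : calG G)
    (hA0 : A !=set0)
    (hA : forall g, A g -> has_degree 2 g)
    (hGA : G = generated_semigroup A) :
  connected (Julia G).
Proof.
have [M hM] := calG_bounded hGA hG.
have L0 : letters A !=set0.
  by have [g Ag] := hA0; have [p sp gp] := hA _ Ag; exists p; split=> //; rewrite -gp.
rewrite (_ : Julia G = limit_set A); first exact (limit_set_connected hM).
apply/seteqP; split; first exact (Julia_sub_limit_set hA hGA hM L0).
exact (limit_set_sub_Julia hGA hM).
Qed.
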